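(* A target vector $\boldsymbol{\alpha}=(\alpha_j^k)_{k\in\{1,\dots,K\},\,j\in D_k}$ is age-achievable if and only if there exists a network control policy $\pi$ that stabilizes the network of source-destination age debt queues associated with $\boldsymbol{\alpha}$.
   Context: Network: a graph $G=(V,E)$ with $N$ nodes and slotted time. There are $K$ flows; flow $k$ has source node $k$, a set $D_k$ of destination nodes (one, several, or all other nodes) and a set $C_k$ of commissioned nodes that may forward its updates. Actions and policies: $\mathcal{A}$ is the set of feasible actions, each being a choice of links and corresponding flow transmissions that can be carried out simultaneously in one slot without interference. A feasible network control policy $\pi$ chooses an action $\pi(t)\in\mathcal{A}$ in every slot $t$. $U_{ij}^k(t)\in\{0,1\}$ indicates whether an update of flow $k$ is scheduled on link $(i,j)$ at time $t$. Channel: $S_{ij}(t)\in\{0,1\}$ is the state of link $(i,j)$ (a scheduled transmission succeeds if and only if it equals 1), independent across links and i.i.d. over time with $\mathbb{P}[S_{ij}(t)=1]=\gamma_{ij}$. Ages: each source is active, i.e. generates fresh updates on demand, so the age of its own flow at the source is always $0$. For $j\in C_k\cup D_k$ the age $A_j^k(t)$ of flow $k$ at $j$ evolves by $A_j^k(t+1)=\min(A_j^k(t),A_i^k(t))+1$ if a transmission of flow $k$ from a neighbor $i\in\{k\}\cup C_k$ to $j$ succeeds ($U_{ij}^k(t)S_{ij}(t)=1$), and $A_j^k(t+1)=A_j^k(t)+1$ if no such transmission succeeds. Effective ages: for each source-destination pair $(k,j)$, $j\in D_k$, there is a monotone increasing age cost function $g_j^k$, and $B_j^k(t)=g_j^k(A_j^k(t))$.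 Target vector: $\alpha_j^k$ is a target value of the time-average age cost for the source-destination pair $(k,j)$. Age-achievable: $\boldsymbol{\alpha}$ is age-achievable if there exists a feasible network control policy $\pi$ such that, with probability 1, $\lim_{T\to\infty}\frac1T\sum_{t=1}^{T}B_j^k(t)\le\alpha_j^k$ for all $k$ and all $j\in D_k$. Age debt queues: given $\boldsymbol{\alpha}$, set $Q_j^k(0)=0$ and $Q_j^k(t+1)=\left[Q_j^k(t)+B_j^k(t+1)-\alpha_j^k\right]^+$ for all $k\in\{1,\dots,K\}$ and $j\in D_k$, where $[x]^+=\max\{x,0\}$. Stability: the network of age debt queues is stable under $\pi$ (and $\pi$ stabilizes it) for the target vector $\boldsymbol{\alpha}$ if $$\lim_{T\to\infty}\mathbb{E}\left[\sum_{k=1}^{K}\sum_{j\in D_k}\frac{Q_j^k(T)}{T}\right]=0,$$ the expectation being over the randomness in the channel processes and the policy $\pi$. *)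

(* Defs.v *)
From mathcomp Require Export all_boot all_order all_algebra.
From mathcomp Require Export all_classical all_reals all_analysis.

Set Implicit Arguments.
Unset Strict Implicit.
Unset Printing Implicit Defensive.

Export Order.TTheory GRing.Theory Num.Theory numFieldNormedType.Exports.
#[global] Open Scope classical_set_scope.
#[global] Open Scope ring_scope.

(* Links are ordered pairs of adjacent nodes; an undirected graph is the case
   of a symmetric [edge], with one link per direction. *)
Definition link_type (N : nat) (edge : rel 'I_N) :=
  {e : 'I_N * 'I_N | edge e.1 e.2}.

(* An action is the set of its scheduled transmissions (link, flow).  The
   interference constraints are an arbitrary family [feasible] of actions. *)
Record network (N K : nat) := Network {
  edge : rel 'I_N;
  flows_le_nodes : (K <= N)%N;
  dest : 'I_K -> {set 'I_N};
  comm : 'I_K -> {set 'I_N};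
  feasible : {set {set (link_type edge * 'I_K)}};
  dest_nonempty : forall k, (0 < #|dest k|)%N;
  source_notin_dest : forall k, widen_ord flows_le_nodes k \notin dest k
}.

Section Network.
Variables (N K : nat) (G : network N K).

Definition link := link_type (edge G).
Definition tail (l : link) : 'I_N := (val l).1.
Definition head (l : link) : 'I_N := (val l).2.

Definition action := {set (link * 'I_K)}.

(* [e \in c] iff link [e] is in state 1. *)
Definition chan_state := {set link}.

Definition source (k : 'I_K) : 'I_N := widen_ord (flows_le_nodes G) k.

Definition ages := 'I_K -> 'I_N -> nat.

(* If several transmissions of flow [k] to [j] succeed in the same slot, the
   freshest one counts.  Ages are tracked at all nodes, but those outside
   [source k |: comm k :|: dest k] never influence the other ones. *)
Definition next_ages (a : action) (c : chan_state) (A : ages) : ages :=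
  fun k j =>
    if j == source k then 0%N
    else (\big[minn/A k j]_(l : link | [&& head l == j, (l, k) \in a, l \in c
            & tail l \in source k |: comm G k]) A k (tail l)).+1.

Definition init_ages (A0 : ages) : ages :=
  fun k j => if j == source k then 0%N else A0 k j.

(* A causal, possibly randomized policy: the action in slot [t] is a function
   of the channel states of the slots [0, ..., t - 1], listed in this order, and
   of a private random seed with law [seed_law]; past actions are functions of
   the same data.  The seed is made independent of the channel by running the
   policy under the product of the channel probability and [seed_law]. *)
Record policy (R : realType) := Policy {
  seed_disp : measure_display;
  seed : measurableType seed_disp;
  seed_law : probability seed R;
  act : seq chan_state -> seed -> action;
  act_feasible : forall h z, act h z \in feasible G;
  act_measurable : forall h a, measurable [set z | act h z = a]
}.

End Network.

Section Channel.
Context d (Omega : measurableType d) (R : realType) (P : probability Omega R).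

Definition mutually_independent (I : eqType) d' (T : measurableType d')
    (X : I -> {RV P >-> T}) : Prop :=
  forall (J : seq I) (B : I -> set T), uniq J ->
    (forall i, measurable (B i)) ->
    P (\bigcap_(i in [set` J]) (X i @^-1` B i)) =
    (\prod_(i <- J) P (X i @^-1` B i))%E.

Definition channel_process (L : finType) (gamma : L -> R)
    (S : nat -> L -> {RV P >-> bool}) : Prop :=
  (forall t l, P [set w | S t l w = true] = (gamma l)%:E) /\
  mutually_independent (fun tl : nat * L => S tl.1 tl.2).

End Channel.

Section Dynamics.
Context d (Omega : measurableType d) (R : realType) (P : probability Omega R).
Variables (N K : nat) (G : network N K).
Variable S : nat -> link G -> {RV P >-> bool}.
Variable A0 : ages N K.
Variable g : 'I_K -> 'I_N -> nat -> R.
Variable alpha : 'I_K -> 'I_N -> R.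

Definition chan_at (t : nat) (w : Omega) : chan_state G :=
  [set l | S t l w]%SET.

Section UnderPolicy.
Variable pi : policy G R.

Definition action_at (t : nat) (x : Omega * seed pi) : action G :=
  act (mkseq (fun s => chan_at s x.1) t) x.2.

Fixpoint age (t : nat) (x : Omega * seed pi) : ages N K :=
  if t is u.+1 then next_ages (action_at u x) (chan_at u x.1) (age u x)
  else init_ages G A0.

Definition effective_age (k : 'I_K) (j : 'I_N) (t : nat)
    (x : Omega * seed pi) : R :=
  g k j (age t x k j).

Definition average_cost (k : 'I_K) (j : 'I_N) (x : Omega * seed pi)
    (T : nat) : R :=
  (\sum_(1 <= t < T.+1) effective_age k j t x) / T%:R.

Fixpoint age_debt (k : 'I_K) (j : 'I_N) (t : nat) (x : Omega * seed pi) : R :=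
  if t is u.+1
  then Num.max (age_debt k j u x + effective_age k j u.+1 x - alpha k j) 0
  else 0.

Definition achieves : Prop :=
  {ae (P \x seed_law pi)%E, forall x, forall k j, j \in dest G k ->
    exists2 l : R, average_cost k j x @ \oo --> l & l <= alpha k j}.

Definition stabilizes : Prop :=
  (fun T : nat => 'E_(P \x seed_law pi)[fun x => (\sum_(k < K)
     \sum_(j in dest G k) age_debt k j T x / T%:R)%R])%E @ \oo --> 0%E.

End UnderPolicy.

Definition age_achievable : Prop := exists pi : policy G R, achieves pi.

End Dynamics.

(* Main.v *)
(* Call a target vector acceptable if, for all positive weights y and all
   horizons H, the optimal expected y-weighted cost of H slots started from
   all-zero ages is at most H times the y-weighted target.

   Both properties imply acceptability.  The dynamics is monotone in the ages
   and the all-zero ages are least, so a violated inequality bounds the expected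
   cost of every block of H slots from below.  Exponential moments then show
   that the cumulative excess cost is nonpositive only finitely often, with a
   bound on the expected number of such times that is uniform over policies.

   Conversely, an acceptable target dominates a coordinatewise minimal one.  A
   renewal argument yields, for each weight vector, long cycles of nearly optimal
   weighted cost that can be started from any bounded state: after enough steps
   played open loop, every real state is dominated by the starting state of the
   cycle.  Mixing cycles as in Blackwell's approachability theorem makes one
   cycle good for all destinations simultaneously.  Concatenating slowly
   improving cycles, a truncated second-moment argument bounds the limsup of the
   averages by the minimal target.  By minimality and the lower bound of the
   first part the averages converge to it, and the expected age debts are o(T)
   by comparison with majorants whose means are controlled. *)

Require Import Defs.
From mathcomp Require Import ring lra zify measurable_realfun.

Set Implicit Arguments.
Unset Strict Implicit.
Unset Printing Implicit Defensive.

(** The cost functions are arbitrary increasing sequences, so a cycle cost need not have a second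
    moment and an optimal stationary policy cannot be taken for granted. Hence the use of
    finite-horizon values and of cycles with an explicit budget. Costs are shifted by a constant
    [Mc] that makes every slot cost at least 1. A cycle of finite expected cost then ends almost
    surely, and its cost is a nonnegative variable that can be truncated. A cycle must not rely on
    the real ages at its start. Its open-loop part is planned for the least channel state of
    positive probability, where only the sure links work; every real state contains it, so planned
    ages dominate real ones. Afterwards a fictitious configuration is fed with the real channel
    states. Pairs of bounded cost need no control, as large ages cost them nearly the supremum
    anyway. Achievability asks the averages to converge, which a bound on their upper limit does not
    give. At a coordinatewise minimal target it does: no coordinate can stay below its target unless
    another one exceeds its own. *)

Lemma finite_uniform (A : finType) (P : A -> nat -> Prop) :
  (forall a m n, (m <= n)%N -> P a m -> P a n) ->
  (forall a, exists n, P a n) -> exists n, forall a, P a n.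
Proof.
move=> mon /choice[f Pf]; exists (\max_a f a)%N => a.
by apply: mon (Pf a); apply: leq_bigmax.
Qed.

Lemma le_linear (R : realType) (c e : R) : 0 < e ->
  exists T0, forall T, (T0 <= T)%N -> c <= e * T%:R.
Proof.
move=> e0; exists (Num.bound (`|c| / e)) => T TT; apply: le_trans (ler_norm c) _.
rewrite [leRHS]mulrC -ler_pdivrMr//; apply: ltW.
apply: lt_le_trans (archi_boundP _) _; last by rewrite ler_nat.
by apply: divr_ge0 => //; apply: ltW.
Qed.

Lemma le_linear_succ (R : realType) (c e : R) : 0 < e ->
  exists T0, forall T, (T0 <= T)%N -> (c + e / 2) * T.+1%:R <= (c + e) * T%:R.
Proof.
move=> e0; have e20 : 0 < e / 2 by rewrite divr_gt0.
have [T0 T0P] := le_linear (c + e / 2) e20; exists T0 => T /T0P h.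
rewrite -[T.+1%:R]natr1; have -> : (c + e) * T%:R = (c + e / 2) * T%:R + e / 2 * T%:R by field.
lra.
Qed.

(** * Expectations over independent channel states *)

Section Channel_expectation.
Variables (R : realType) (Ch : finType) (pr : Ch -> R).
Hypothesis pr_ge0 : forall c, 0 <= pr c.
Hypothesis pr_sum1 : \sum_c pr c = 1.

Definition Echan (f : Ch -> R) : R := \sum_c pr c * f c.

(** The comparison is asked only where [pr] is nonzero: later domination arguments use that a
    channel state contains the sure links, which fails on null states. *)
Lemma Echan_le f h : (forall c, pr c != 0 -> f c <= h c) -> Echan f <= Echan h.
Proof.
move=> fh; apply: ler_sum => c _; have [->|p0] := eqVneq (pr c) 0.
  by rewrite !mul0r.
exact: ler_wpM2l (fh _ p0).
Qed.

Lemma eq_Echan f h : (forall c, pr c != 0 -> f c = h c) -> Echan f = Echan h.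
Proof.
move=> fh; apply: eq_bigr => c _; have [->|p0] := eqVneq (pr c) 0.
  by rewrite !mul0r.
by rewrite fh.
Qed.

Lemma Echan_cst k : Echan (fun=> k) = k.
Proof. by rewrite /Echan -mulr_suml pr_sum1 mul1r. Qed.

Lemma EchanD f h : Echan (fun c => f c + h c) = Echan f + Echan h.
Proof. by rewrite /Echan -big_split/=; apply: eq_bigr => c _; rewrite mulrDr. Qed.

Lemma EchanZ k f : Echan (fun c => k * f c) = k * Echan f.
Proof. by rewrite /Echan mulr_sumr; apply: eq_bigr => c _; rewrite mulrCA. Qed.

Lemma EchanB_cst f k : Echan f - k = Echan (fun c => f c - k).
Proof. by rewrite -{1}(Echan_cst k) -mulN1r -EchanZ -EchanD; apply: eq_Echan => c _; rewrite mulN1r. Qed.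

Lemma Echan_sum (I : Type) (r : seq I) (f : I -> Ch -> R) :
  Echan (fun c => \sum_(i <- r) f i c) = \sum_(i <- r) Echan (f i).
Proof.
by rewrite /Echan exchange_big/=; apply: eq_bigr => c _; rewrite mulr_sumr.
Qed.

Lemma Echan_ge0 f : (forall c, pr c != 0 -> 0 <= f c) -> 0 <= Echan f.
Proof. by move=> f0; rewrite -{1}(Echan_cst 0); apply: Echan_le. Qed.

Fixpoint Ehist (T : nat) (f : seq Ch -> R) : R :=
  if T is T'.+1 then Echan (fun c => Ehist T' (fun h => f (c :: h))) else f [::].

Lemma Ehist_le T f h : (forall s, size s = T ->
  (forall c, c \in s -> pr c != 0) -> f s <= h s) -> Ehist T f <= Ehist T h.
Proof.
elim: T f h => [|T IH] f h fh /=; first exact: fh.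
apply: Echan_le => c p0; apply: IH => s sT sp; apply: fh => //=.
  by rewrite sT.
by move=> c'; rewrite inE => /predU1P[->//|/sp].
Qed.

Lemma eq_Ehist T f h : (forall s, size s = T ->
  (forall c, c \in s -> pr c != 0) -> f s = h s) -> Ehist T f = Ehist T h.
Proof.
elim: T f h => [|T IH] f h fh /=; first exact: fh.
apply: eq_Echan => c p0; apply: IH => s sT sp; apply: fh => //=.
  by rewrite sT.
by move=> c'; rewrite inE => /predU1P[->//|/sp].
Qed.

Lemma EhistZ T k f : Ehist T (fun s => k * f s) = k * Ehist T f.
Proof.
by elim: T f => //= T IH f; rewrite -EchanZ; apply: eq_Echan => c _; rewrite IH.
Qed.

Lemma EhistD T f h : Ehist T (fun s => f s + h s) = Ehist T f + Ehist T h.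
Proof.
by elim: T f h => //= T IH f h; rewrite -EchanD; apply: eq_Echan => c _; rewrite IH.
Qed.

Lemma Ehist_cst T k : Ehist T (fun=> k) = k.
Proof. by elim: T => //= T ->; rewrite Echan_cst. Qed.

(** [Pi T q] is a guess for the mean of [phi] when [T] slots remain from [q]. If it is large enough
    at [T = 0] and does not grow on average over one slot, it is an upper bound. The means of cycle
    costs and of the energy are estimated in this way, without stopping times. *)
Lemma Ehist_supermartingale (Q : Type) (step : Q -> Ch -> Q) (Ok : Q -> Prop)
    (phi : Q -> R) (Pi : nat -> Q -> R) :
  (forall q c, Ok q -> Ok (step q c)) ->
  (forall q, Ok q -> phi q <= Pi 0%N q) ->
  (forall T q, Ok q -> Echan (fun c => Pi T (step q c)) <= Pi T.+1 q) ->
  forall T q, Ok q -> Ehist T (fun h => phi (foldl step q h)) <= Pi T q.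
Proof.
move=> Okstep P0 PS; elim=> [|T IH] q Okq /=; first exact: P0.
by apply: le_trans (PS _ _ Okq); apply: Echan_le => c _; apply/IH/Okstep.
Qed.
End Channel_expectation.

(** * Finite-horizon optimal values and renewal *)

Section Dynamic_programming.
Variables (R : realType) (Ch Act : finType) (pr : Ch -> R).
Hypothesis pr_ge0 : forall c, 0 <= pr c.
Hypothesis pr_sum1 : \sum_c pr c = 1.
Variables (F : {set Act}) (a0 : Act).
Hypothesis a0F : a0 \in F.
Local Notation Echan := (Echan pr).
Local Notation Ehist := (Ehist pr).

Definition amin (f : Act -> R) : R := f [arg min_(a < a0 in F) f a]%O.
Definition amax (f : Act -> R) : R := - amin (fun a => - f a).

Lemma amin_le f a : a \in F -> amin f <= f a.
Proof. by rewrite /amin; case: arg_minP => // i iF; apply. Qed.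

Lemma amin_ex f : exists2 a, a \in F & amin f = f a.
Proof. by rewrite /amin; case: arg_minP => // i iF _; exists i. Qed.

Lemma amax_ge f a : a \in F -> f a <= amax f.
Proof. by move=> aF; rewrite lerNr; apply: (amin_le (fun a => - f a)). Qed.

Lemma amax_ex f : exists2 a, a \in F & amax f = f a.
Proof.
by have [a aF e] := amin_ex (fun a => - f a); exists a; rewrite // /amax e opprK.
Qed.

Lemma le_amin f h : (forall a, a \in F -> f a <= h a) -> amin f <= amin h.
Proof.
by move=> fh; have [a aF ->] := amin_ex h; apply: le_trans (fh _ aF); apply: amin_le.
Qed.

Lemma le_amax f h : (forall a, a \in F -> f a <= h a) -> amax f <= amax h.
Proof. by move=> fh; rewrite lerN2; apply: le_amin => a aF; rewrite lerN2 fh. Qed.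

Lemma eq_amin f h : (forall a, a \in F -> f a = h a) -> amin f = amin h.
Proof.
by move=> e; apply/eqP; rewrite eq_le !le_amin// => a aF; rewrite e.
Qed.

Lemma amin_ge f k : (forall a, a \in F -> k <= f a) -> k <= amin f.
Proof. by move=> fk; have [a aF ->] := amin_ex f; apply: fk. Qed.

Lemma amax_le f k : (forall a, a \in F -> f a <= k) -> amax f <= k.
Proof. by move=> fk; have [a aF ->] := amax_ex f; apply: fk. Qed.

Variables (X : Type) (nx : Act -> Ch -> X -> X) (le : X -> X -> Prop) (zero : X).
Hypothesis zero_le : forall x, le zero x.
Hypothesis nx_mono : forall a c x y, le x y -> le (nx a c x) (nx a c y).

Section Values.
Variables (C : X -> R) (Gd : X -> bool).

(** Optimal cost of reaching [Gd], cut after [n] slots with nothing charged for the rest. When [C]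
    is nonnegative off [Gd], the cut value increases with [n]. *)
Fixpoint stopv (n : nat) (x : X) : R :=
  if n is n'.+1 then
    if Gd x then 0 else C x + amin (fun a => Echan (fun c => stopv n' (nx a c x)))
  else 0.

(* [L] compulsory slots, followed by at most [n] slots until [Gd] is reached *)
Fixpoint value (L n : nat) (x : X) : R :=
  if L is L'.+1 then C x + amin (fun a => Echan (fun c => value L' n (nx a c x)))
  else stopv n x.

Hypothesis C_mono : forall x y, le x y -> C x <= C y.
Hypothesis Gd_mono : forall x y, le x y -> Gd y -> Gd x.
Hypothesis C_ge0 : forall x, ~~ Gd x -> 0 <= C x.

Lemma stopv_ge0 n x : 0 <= stopv n x.
Proof.
elim: n x => //= n IH x; case: ifPn => // Gx; apply: addr_ge0; first exact: C_ge0.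
apply: amin_ge => a aF; rewrite -(Echan_cst pr_sum1 0); apply: Echan_le => //.
Qed.

Lemma stopv_homo n m x : (n <= m)%N -> stopv n x <= stopv m x.
Proof.
elim: n m x => [|n IH] [|m] x //=; first by move=> _; exact: (stopv_ge0 m.+1).
rewrite ltnS => nm; case: ifP => // _; rewrite lerD2l; apply: le_amin => a _.
by apply: Echan_le => // c _; apply: IH.
Qed.

Lemma stopv_mono n x y : le x y -> stopv n x <= stopv n y.
Proof.
elim: n x y => //= n IH x y xy; case: ifPn => Gx.
  case: ifPn => // Gy; have := stopv_ge0 n.+1 y; rewrite /= (negbTE Gy) //.
rewrite ifN; last by apply: contra Gx; apply: Gd_mono.
apply: lerD; first exact: C_mono.
by apply: le_amin => a _; apply: Echan_le => // c _; apply/IH/nx_mono.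
Qed.

Lemma value_homo L n m x : (n <= m)%N -> value L n x <= value L m x.
Proof.
move=> nm; elim: L x => [|L IH] x /=; first exact: stopv_homo.
by rewrite lerD2l; apply: le_amin => a _; apply: Echan_le => // c _; apply: IH.
Qed.

Lemma value_mono L n x y : le x y -> value L n x <= value L n y.
Proof.
elim: L x y => [|L IH] x y xy /=; first exact: stopv_mono.
apply: lerD; first exact: C_mono.
by apply: le_amin => a _; apply: Echan_le => // c _; apply/IH/nx_mono.
Qed.

Variable M : R.
Hypothesis M_ge0 : 0 <= M.
Hypothesis C_ge : forall x, - M <= C x.

Lemma value_ge L n x : - (M * L%:R) <= value L n x.
Proof.
elim: L x => [|L IH] x /=; first by rewrite mulr0 oppr0 stopv_ge0.
rewrite -natr1 mulrDr mulr1 opprD addrC; apply: lerD => //.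
apply: amin_ge => a _; rewrite -(Echan_cst pr_sum1 (- (M * L%:R))).
by apply: Echan_le.
Qed.

(** An optimal play of [L + j] slots is stopped at the first visit to [Gd] after its [L] compulsory
    slots, or after [n] further slots. The part cut off is a play of at most [j] slots and so costs
    at least [- K]. *)
Lemma renewal_step K L n j : 0 <= K -> (n <= j)%N ->
  (forall i x, (i <= j)%N -> - K <= value i 0 x) ->
  forall x, value L n x - K <= value (L + j) 0 x.
Proof.
move=> K0 nj VK; elim: L => [|L IH] x; last first.
  rewrite addSn /= -addrA lerD2l; apply: amin_ge => a aF.
  apply: le_trans (lerB (amin_le _ aF) (lexx K)) _.
  rewrite EchanB_cst//.
  exact: Echan_le.
rewrite add0n /=; elim: n j nj VK x => [|n IH] j nj VK x /=.
  by rewrite sub0r VK.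
case: ifPn => Gx; first by rewrite sub0r VK.
case: j nj VK => // j nj VK /=; rewrite -addrA lerD2l; apply: amin_ge => a aF.
apply: le_trans (lerB (amin_le _ aF) (lexx K)) _.
rewrite EchanB_cst//.
apply: Echan_le => // c _; apply: IH => // i y ij.
by apply: VK; apply: leqW.
Qed.

(** If the optimal cycle from the least state has nonnegative cost, so has every cycle from any
    state, by monotonicity. A long play is a chain of cycles of at most [L + n] slots, and only the
    last, incomplete one can have a negative mean, of at most [M] per slot. Hence a bound that does
    not depend on [H]. *)
Lemma renewal L n : (0 < L)%N -> 0 <= value L n zero ->
  forall H x, - (M * (L + n)%:R) <= value H 0 x.
Proof.
move=> L0 V0 H; have [m] := ubnP H; elim: m H => // m IH H; rewrite ltnS => Hm x.
have [HLn|LnH] := ltnP H (L + n).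
  by apply: le_trans (value_ge _ _ _); rewrite lerN2 ler_wpM2l// ler_nat ltnW.
have {1}-> : H = (L + (H - L))%N by rewrite subnKC// (leq_trans _ LnH)// leq_addr.
have K0 : 0 <= M * (L + n)%:R by rewrite mulr_ge0.
apply: le_trans (renewal_step L K0 (n := n) _ _ x).
- rewrite lerBrDr addrC addrN; apply: le_trans V0 _.
  exact: value_mono (zero_le _).
- by rewrite leq_subRL// (leq_trans _ LnH)// leq_addr.
- by move=> i y iH; apply: IH; apply: leq_trans Hm; apply: leq_ltn_trans iH _; lia.
Qed.
End Values.

Lemma value0_Gd C Gd Gd' H x : value C Gd H 0 x = value C Gd' H 0 x.
Proof.
elim: H x => //= H IH x; congr (_ + _); apply: eq_amin => a _.
by apply: eq_Echan => c _.
Qed.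

Lemma value_shift C Gd v H x :
  value (fun y => C y - v) Gd H 0 x = value C Gd H 0 x - v * H%:R.
Proof.
elim: H x => [|H IH] x /=; first by rewrite mulr0 subr0.
transitivity (C x - v + (amin (fun a => Echan (fun c => value C Gd H 0 (nx a c x))) - v * H%:R)).
  congr (_ + _); apply/eqP; rewrite eq_le; apply/andP; split.
    have [a aF ->] := amin_ex (fun a => Echan (fun c => value C Gd H 0 (nx a c x))).
    apply: le_trans (amin_le _ aF) _.
    rewrite EchanB_cst//.
    by apply: Echan_le => // c _; rewrite IH.
  apply: amin_ge => a aF; apply: le_trans (lerB (amin_le _ aF) (lexx _)) _.
  rewrite EchanB_cst//.
  by apply: Echan_le => // c _; rewrite IH.
by rewrite -natr1; ring.
Qed.
End Dynamic_programming.

(** * Paths of a policy and the exponential lower-tail bound *)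

Section Trajectories.
Variables (R : realType) (Ch Act : Type) (X : Type) (nx : Act -> Ch -> X -> X).

Fixpoint traj (pol : seq Ch -> Act) (x : X) (h : seq Ch) : X :=
  if h is c :: h' then traj (fun k => pol (c :: k)) (nx (pol [::]) c x) h' else x.

Lemma traj_rcons pol x h c :
  traj pol x (rcons h c) = nx (pol h) c (traj pol x h).
Proof. by elim: h pol x => //= d h IH pol x; rewrite IH. Qed.

Variable C : X -> R.

(** The initial state is charged and the final one is not, whence the shifts between [T] and [T.+1]
    in later sums of age costs. *)
Fixpoint csum (pol : seq Ch -> Act) (x : X) (h : seq Ch) : R :=
  if h is c :: h' then C x + csum (fun k => pol (c :: k)) (nx (pol [::]) c x) h'
  else 0.

Lemma csum_rcons pol x h c :
  csum pol x (rcons h c) = csum pol x h + C (traj pol x h).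
Proof.
elim: h pol x => [|d h IH] pol x /=; first by rewrite addr0 add0r.
by rewrite IH addrA.
Qed.
End Trajectories.

(** [expR (- v)] is at most [(1 + v)^-1], and [1 + v] times the right-hand side exceeds 1 by
    [v ^+ 2 * (1 + 2 * v)]. *)
Lemma expRN_le (R : realType) (v : R) : - 2^-1 <= v -> expR (- v) <= 1 - v + 2 * v ^+ 2.
Proof.
move=> v2; rewrite expRN; have v1 : 0 < 1 + v by lra.
apply: (@le_trans _ _ (1 + v)^-1).
  by rewrite lef_pV2 ?posrE ?expR_gt0// expR_ge1Dx.
rewrite -div1r ler_pdivrMr//.
have : 0 <= v ^+ 2 * (1 + 2 * v) by rewrite mulr_ge0 ?sqr_ge0//; lra.
by move=> h; rewrite -subr_ge0; apply: le_trans h _; rewrite le_eqVlt; apply/orP; left; apply/eqP; ring.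
Qed.

Section Lower_tail.
Variables (R : realType) (Ch Act : finType) (pr : Ch -> R).
Hypothesis pr_ge0 : forall c, 0 <= pr c.
Hypothesis pr_sum1 : \sum_c pr c = 1.
Variables (F : {set Act}) (a0 : Act).
Hypothesis a0F : a0 \in F.
Local Notation Echan := (Echan pr).
Local Notation Ehist := (Ehist pr).
Variables (X : Type) (nx : Act -> Ch -> X -> X) (le : X -> X -> Prop) (zero : X).
Hypothesis zero_le : forall x, le zero x.
Hypothesis nx_mono : forall a c x y, le x y -> le (nx a c x) (nx a c y).
Variables (C : X -> R) (Gd : X -> bool).
Hypothesis C_mono : forall x y, le x y -> C x <= C y.

Section mgf.
Variable lam : R.
Hypothesis lam_ge0 : 0 <= lam.

Fixpoint mgfv (T : nat) (x : X) : R :=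
  if T is T'.+1 then
    expR (- (lam * C x)) * amax F a0 (fun a => Echan (fun c => mgfv T' (nx a c x)))
  else 1.

Lemma mgfv_ge0 T x : 0 <= mgfv T x.
Proof.
elim: T x => //= T IH x; apply: mulr_ge0; first exact: expR_ge0.
have [a aF ->] := amax_ex a0F (fun a => Echan (fun c => mgfv T (nx a c x))).
by rewrite -(Echan_cst pr_sum1 0); apply: Echan_le.
Qed.

Lemma amax_mgfv_ge0 T x : 0 <= amax F a0 (fun a => Echan (fun c => mgfv T (nx a c x))).
Proof.
have [a aF ->] := amax_ex a0F (fun a => Echan (fun c => mgfv T (nx a c x))).
by rewrite -(Echan_cst pr_sum1 0); apply: Echan_le => // c _; apply: mgfv_ge0.
Qed.

Lemma mgfv_anti T x y : le x y -> mgfv T y <= mgfv T x.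
Proof.
elim: T x y => //= T IH x y xy; apply: ler_pM; rewrite ?expR_ge0 ?amax_mgfv_ge0//.
  by rewrite ler_expR lerN2 ler_wpM2l// C_mono.
apply: le_amax => // a _; apply: Echan_le => // c _; apply: IH; exact: nx_mono.
Qed.

(** After [H] slots the state is at least [zero], and the moment decreases with the state, so the
    other [T] slots may be restarted from [zero]. This stands in for independence of the blocks,
    whatever the policy remembers. *)
Lemma mgfv_submul H T x : mgfv (H + T) x <= mgfv H x * mgfv T zero.
Proof.
elim: H x => [|H IH] x /=; first by rewrite mul1r mgfv_anti.
rewrite -mulrA ler_wpM2l ?expR_ge0//; apply: amax_le => // a aF.
apply: (@le_trans _ _ (Echan (fun c => mgfv H (nx a c x)) * mgfv T zero)).
  by rewrite mulrC -EchanZ; apply: Echan_le => // c _; rewrite mulrC.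
apply: ler_wpM2r; first exact: mgfv_ge0.
exact: (amax_ge a0F (fun a => Echan (fun c => mgfv H (nx a c x)))).
Qed.

Lemma mgf_le_mgfv T x pol : (forall h, pol h \in F) ->
  Ehist T (fun h => expR (- (lam * csum nx C pol x h))) <= mgfv T x.
Proof.
elim: T x pol => [|T IH] x pol polF /=; first by rewrite mulr0 oppr0 expR0.
apply: (@le_trans _ _ (expR (- (lam * C x)) * Echan (fun c => mgfv T (nx (pol [::]) c x)))).
  rewrite -EchanZ; apply: Echan_le => // c _.
  apply: le_trans (ler_wpM2l (expR_ge0 _) (IH (nx (pol [::]) c x) (fun k => pol (c :: k)) _)) => //.
  by rewrite -EhistZ; apply: Ehist_le => // s _ _; rewrite -expRD -opprD -mulrDr.
rewrite ler_wpM2l ?expR_ge0//.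
exact: (amax_ge a0F (fun a => Echan (fun c => mgfv T (nx a c x)))).
Qed.
End mgf.

(** The two factors bound the current slot and the future. The same [n] serves as second-order
    coefficient and, through [l * n <= 1], as range of [l], so that the induction carries a single
    constant. *)
Lemma mgf_product_le (l c u k : R) (n : nat) : 0 <= l -> l * n%:R <= 1 ->
  k + `|c| * `|u| + `|c| + 6 * c ^+ 2 + 2 * `|c| + `|u| + 1 <= n%:R -> 0 <= k ->
  (1 - l * c + 2 * (l * c) ^+ 2) * (1 - l * u + l ^+ 2 * k) <=
  1 - l * (c + u) + l ^+ 2 * n%:R.
Proof.
move=> l0 ln kn k0.
have ca := normr_ge0 c; have ua := normr_ge0 u.
have cu := mulr_ge0 ca ua; have c2 := sqr_ge0 c.
have l1 : l <= 1.
  apply: le_trans ln; rewrite ler_peMr//; lra.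
have lk : l * k <= 1 by apply: le_trans ln; rewrite ler_wpM2l//; lra.
have lu : l * `|u| <= 1 by apply: le_trans ln; rewrite ler_wpM2l//; lra.
have l2k : l ^+ 2 * k <= 1.
  by rewrite expr2 -mulrA -[leRHS]mul1r ler_pM// mulr_ge0.
have cule : c * u <= `|c| * `|u| by rewrite -normrM ler_norm.
have -> : (1 - l * c + 2 * (l * c) ^+ 2) * (1 - l * u + l ^+ 2 * k) =
  1 - l * (c + u) + l ^+ 2 *
   (k + c * u - c * (l * k) + 2 * c ^+ 2 * (1 - l * u + l ^+ 2 * k)) by ring.
rewrite lerD2l ler_wpM2l ?sqr_ge0//.
have h1 : - (c * (l * k)) <= `|c|.
  rewrite -mulNr; apply: le_trans (_ : `|c| * (l * k) <= _).
    by apply: ler_wpM2r; [exact: mulr_ge0|rewrite -normrN ler_norm].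
  by rewrite ler_piMr.
have h2 : 2 * c ^+ 2 * (1 - l * u + l ^+ 2 * k) <= 6 * c ^+ 2.
  rewrite (_ : 6 * c ^+ 2 = 2 * c ^+ 2 * 3); last by ring.
  apply: ler_wpM2l; first by rewrite mulr_ge0.
  have : - (l * u) <= l * `|u| by rewrite -mulrN ler_wpM2l// -normrN ler_norm.
  lra.
lra.
Qed.

(** To first order in [l], maximising the moment is minimising the expected cost, so the linear
    coefficient is the optimal value. The constant depends on [x], but finitely many actions and
    channel states make it uniform over the successors of [x]. *)
Lemma mgfv_expand j x : exists n : nat, forall l, 0 <= l -> l * n%:R <= 1 ->
  mgfv l j x <= 1 - l * value pr F a0 nx C Gd j 0 x + l ^+ 2 * n%:R.
Proof.
elim: j x => [|j IH] x; first by exists 0%N => l l0 _ /=; lra.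
have [k kP] : exists k, forall ac : Act * Ch, forall l, 0 <= l -> l * k%:R <= 1 ->
    mgfv l j (nx ac.1 ac.2 x) <=
    1 - l * value pr F a0 nx C Gd j 0 (nx ac.1 ac.2 x) + l ^+ 2 * k%:R.
  apply: (@finite_uniform _ (fun ac (k : nat) => forall l, 0 <= l -> l * k%:R <= 1 ->
    mgfv l j (nx ac.1 ac.2 x) <=
    1 - l * value pr F a0 nx C Gd j 0 (nx ac.1 ac.2 x) + l ^+ 2 * k%:R)).
    move=> ac m n mn mP l l0 ln; apply: le_trans (mP l l0 _) _.
      by apply: le_trans ln; rewrite ler_wpM2l// ler_nat.
    by rewrite lerD2l ler_wpM2l ?sqr_ge0// ler_nat.
  by move=> ac; apply: IH.
rewrite /=.
set u := amin _ _ _; set c := C x.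
pose B := k%:R + `|c| * `|u| + `|c| + 6 * c ^+ 2 + 2 * `|c| + `|u| + 1.
have cn := normr_ge0 c; have un := normr_ge0 u; have k0 := ler0n R k.
have cu := mulr_ge0 cn un; have c2 := sqr_ge0 c.
have B0 : 0 <= B by rewrite /B; lra.
exists (Num.bound B) => l l0 lB.
have nB : B <= (Num.bound B)%:R by apply/ltW/archi_boundP.
apply: le_trans (mgf_product_le l0 lB nB (ler0n _ _)).
have lk : l * k%:R <= 1.
  by apply: le_trans lB; rewrite ler_wpM2l//; apply: le_trans nB; rewrite /B; lra.
apply: ler_pM; rewrite ?expR_ge0 ?amax_mgfv_ge0//.
  apply: expRN_le.
  have : l * (2 * `|c|) <= 1.
    by apply: le_trans lB; rewrite ler_wpM2l//; apply: le_trans nB; rewrite /B; lra.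
  have : - (l * `|c|) <= l * c by rewrite -mulrN ler_wpM2l// lerNl -normrN ler_norm.
  lra.
apply: amax_le => // a aF.
apply: (@le_trans _ _ (Echan (fun c => 1 - l * value pr F a0 nx C Gd j 0 (nx a c x) + l ^+ 2 * k%:R))).
  by apply: Echan_le => // c' _; exact: (kP (a, c')).
have -> : Echan (fun c => 1 - l * value pr F a0 nx C Gd j 0 (nx a c x) + l ^+ 2 * k%:R) =
   1 - l * Echan (fun c => value pr F a0 nx C Gd j 0 (nx a c x)) + l ^+ 2 * k%:R.
  by rewrite !EchanD !Echan_cst// -mulNr -EchanZ; congr (_ + _ + _);
     apply: eq_Echan => c' _; rewrite mulNr.
rewrite lerD2r lerD2l lerN2 ler_wpM2l//.
exact: (amin_le a0F (fun a => Echan (fun c => value pr F a0 nx C Gd j 0 (nx a c x)))).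
Qed.

(* Over a block of [H] slots the exponential moment of [- l * cost], maximised
   over policies, is below 1 for small [l]; by submultiplicativity of [mgfv] the
   tail probabilities then decay geometrically. *)
Lemma lower_tail H : 0 < value pr F a0 nx C Gd H 0 zero ->
  exists B : R, forall N x pol, (forall h, pol h \in F) ->
    \sum_(T < N) Ehist T (fun h => (csum nx C pol x h <= 0)%R%:R) <= B.
Proof.
set u := value _ _ _ _ _ _ _ _ _ => u0.
have H0 : (0 < H)%N by case: H @u u0 => //; rewrite /= ltxx.
have [n nP] := mgfv_expand H zero; rewrite -/u in nP.
have [l l0 Z1] : exists2 l, 0 <= l & mgfv l H zero < 1.
  (* With [l = u / d] one has [l * n <= u / (u + 1)], which is below both 1 and [u]; hence
     [1 - l * u + l ^+ 2 * n < 1]. *)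
  pose d := (n%:R + 1) * (u + 1).
  have n0 := ler0n R n.
  have d0 : 0 < d by rewrite /d mulr_gt0//; lra.
  exists (u / d); first by rewrite divr_ge0// ltW.
  have un : u / d * n%:R <= u / (u + 1).
    have -> : u / d * n%:R = u / (u + 1) * (n%:R / (n%:R + 1)).
      by rewrite /d; field; apply/andP; split; lra.
    apply: ler_piMr; first by rewrite divr_ge0//; lra.
    by rewrite ler_pdivrMr; lra.
  have uu : u / (u + 1) < u by rewrite ltr_pdivrMr ?ltr_pMr//; lra.
  apply: le_lt_trans (nP _ _ _) _; first by rewrite divr_ge0// ltW.
    by apply: le_trans un _; rewrite ler_pdivrMr; lra.
  rewrite expr2 -mulrA -addrA -mulrN -mulrDr gtrDl pmulr_rlt0 ?divr_gt0//.
  by rewrite addrC subr_lt0; apply: le_lt_trans un uu.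
set rho := mgfv l H zero in Z1.
have rho0 : 0 <= rho by apply: mgfv_ge0.
pose B := \sum_(T < H) mgfv l T zero.
have B0 : 0 <= B by apply: sumr_ge0 => i _; apply: mgfv_ge0.
have SB q : \sum_(T < q * H) mgfv l T zero <= B / (1 - rho).
  elim: q => [|q IH]; first by rewrite mul0n big_ord0 divr_ge0//; lra.
  rewrite mulSn big_split_ord/=.
  have : \sum_(i < q * H) mgfv l (H + i) zero <= rho * (B / (1 - rho)).
    apply: le_trans (_ : \sum_(i < q * H) rho * mgfv l i zero <= _).
      by apply: ler_sum => i _; apply: mgfv_submul.
    by rewrite -mulr_sumr ler_wpM2l.
  rewrite -/B => h; apply: le_trans (lerD (lexx B) h) _.
  by rewrite le_eqVlt; apply/orP; left; apply/eqP; field; lra.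
exists (B / (1 - rho)) => N x pol polF; apply: le_trans (SB N).
apply: (@le_trans _ _ (\sum_(T < N) mgfv l T zero)).
  apply: ler_sum => T _; apply: le_trans (mgfv_anti l0 T (zero_le x)).
  apply: le_trans (mgf_le_mgfv l T x polF); apply: Ehist_le => // s _ _.
  (* A nonpositive cost makes the exponential at least 1, so its moment bounds the probability. *)
  case: (ltP 0 (csum nx C pol x s)) => /= [|S0]; first by rewrite expR_ge0.
  by rewrite -expR0 ler_expR oppr_ge0 mulr_ge0_le0.
have NH : (N <= N * H)%N by rewrite -{1}(muln1 N) leq_mul2l H0 orbT.
rewrite -(subnKC NH) big_split_ord/= lerDl; apply: sumr_ge0 => i _; exact: mgfv_ge0.
Qed.
End Lower_tail.

(** * A path of nearly optimal starting states *)

Section Good_path.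
Variables (R : realType) (Ch Act : finType) (pr : Ch -> R).
Hypothesis pr_ge0 : forall c, 0 <= pr c.
Hypothesis pr_sum1 : \sum_c pr c = 1.
Variables (F : {set Act}) (a0 : Act).
Hypothesis a0F : a0 \in F.
Local Notation Echan := (Echan pr).
Variables (X : Type) (nx : Act -> Ch -> X -> X) (le : X -> X -> Prop) (zero : X).
Hypothesis zero_le : forall x, le zero x.
Hypothesis nx_mono : forall a c x y, le x y -> le (nx a c x) (nx a c y).
Variables (C : X -> R) (Gd : X -> bool).
Hypothesis C_mono : forall x y, le x y -> C x <= C y.
Hypothesis Gd_mono : forall x y, le x y -> Gd y -> Gd x.
Hypothesis C_ge0 : forall x, ~~ Gd x -> 0 <= C x.
Variable M : R.
Hypothesis M_ge0 : 0 <= M.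
Hypothesis C_ge : forall x, - M <= C x.
Local Notation V := (value pr F a0 nx C Gd).
Hypothesis V_le0 : forall L n, (0 < L)%N -> V L n zero <= 0.
Variable c0 : Ch.
Hypothesis pr_c0 : 0 < pr c0.

(** [rho] is the lower limit, as [L] grows, of the supremum over [n] of [V L n zero / L]. Good
    horizons [L] are thus found infinitely often, while the lower bound holds for all large [L]. *)
Lemma rho_ex : exists rho : R, [/\ rho <= 0,
  forall eps : R, 0 < eps -> forall L0, exists2 L, (L0 <= L)%N &
    forall n, V L n zero <= (rho + eps) * L%:R &
  forall eps : R, 0 < eps -> exists L0, forall L, (L0 <= L)%N -> exists n,
    (rho - eps) * L%:R < V L n zero].
Proof.
pose E := [set r : R | forall L0, exists2 L, (L0 <= L)%N &
  forall n, V L n zero <= r * L%:R].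
have E0 : E 0.
  move=> L0; exists (maxn L0 1); first by rewrite leq_maxl.
  by move=> n; rewrite mul0r V_le0// leq_max orbT.
have lbE r : E r -> - M <= r.
  move=> /(_ 1%N)[L L1 /(_ 0%N) LP].
  have := le_trans (value_ge pr_ge0 pr_sum1 a0F nx C_ge0 C_ge L 0 zero) LP.
  by rewrite -mulNr ler_pM2r// ltr0n.
have iE : has_inf E by split; [exists 0|exists (- M) => r /lbE].
have ge_inf r : E r -> inf E <= r by move=> Er; apply: ge_inf => //; exists (- M) => s /lbE.
exists (inf E); split => [|eps e0 L0|eps e0]; first exact: ge_inf.
  have [r Er rE] := inf_adherent e0 iE.
  have [L L0L LP] := Er L0; exists L => // n; apply: le_trans (LP n) _.
  by rewrite ler_wpM2r// ltW.
apply: contrapT => /forallNP H.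
have : E (inf E - eps).
  move=> L0; have /existsNP[L /not_implyP[L0L /forallNP nP]] := H L0.
  by exists L => // n; rewrite leNgt; apply/negP/nP.
by move=> /ge_inf; lra.
Qed.

Section step.
Variable rho : R.
Hypothesis rho_up : forall eps : R, 0 < eps -> forall L0, exists2 L, (L0 <= L)%N &
    forall n, V L n zero <= (rho + eps) * L%:R.
Hypothesis rho_low : forall eps : R, 0 < eps -> exists L0, forall L, (L0 <= L)%N ->
  exists n, (rho - eps) * L%:R < V L n zero.

Definition rho_good (x : X) := forall eps : R, 0 < eps -> forall L0,
  exists2 L, (L0 <= L)%N & forall n, V L n x <= (rho + eps) * L%:R.

(** Suppose every action led through [c0] to a state that is not good. With probability [pr c0] the
    value would then grow at a rate of at least [rho + eps], and after any other channel state still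
    at nearly [rho], being at least the value from [zero]. The mixture exceeds the rate granted by
    [rho_good x]. *)
Lemma rho_good_step x : rho_good x ->
  exists2 a, a \in F & rho_good (nx a c0 x).
Proof.
move=> gx; apply: contrapT => H.
pose Bad (a : Act) (t : nat) := a \in F -> forall L, (t <= L)%N -> exists n,
  (rho + t.+1%:R^-1) * L%:R < V L n (nx a c0 x).
have [t tP] : exists t, forall a, Bad a t.
  apply: finite_uniform => [a m n mn mP aF L nL|a].
    have [k kP] := mP aF L (leq_trans mn nL); exists k; apply: le_lt_trans kP.
    by rewrite ler_wpM2r// lerD2l lef_pV2 ?posrE// ler_nat.
  have [aF|aF] := boolP (a \in F); last by exists 0%N => aF'; rewrite aF' in aF.
  have : ~ rho_good (nx a c0 x) by move=> g; apply: H; exists a.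
  move=> /existsNP[eps /not_implyP[e0 /existsNP[L0 LP]]].
  have [m meps] : exists m : nat, m.+1%:R^-1 < eps.
    exists (Num.bound eps^-1); rewrite invf_plt ?posrE//.
    apply: lt_trans (archi_boundP _) _; last by rewrite ltr_nat.
    by rewrite invr_ge0 ltW.
  exists (maxn m L0) => _ L; rewrite geq_max => /andP[mL L0L].
  have /existsNP[n nP] : ~ forall n, V L n (nx a c0 x) <= (rho + eps) * L%:R.
    by move=> VP; apply: LP; exists L.
  exists n; apply: le_lt_trans (_ : (rho + eps) * L%:R < _); last by rewrite ltNge; apply/negP.
  rewrite ler_wpM2r// lerD2l; apply: ltW; apply: le_lt_trans meps.
  by rewrite lef_pV2 ?posrE// ler_nat ltnS leq_maxl.
pose q := pr c0; have q0 : 0 < q := pr_c0; set eps : R := t.+1%:R^-1 in tP.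
have e0 : 0 < eps by rewrite invr_gt0.
have q1 : q <= 1.
  by rewrite -pr_sum1 (bigD1 c0)//= lerDl sumr_ge0.
(* The gain is [q * eps = 2 * e2] and the loss [(1 - q) * e2] is at most half of it. This leaves a
   rate of at least [rho + e2], against [rho + e2 / 8] for the horizon [L.+1]. *)
pose e2 := q * eps / 2.
have qe := mulr_gt0 q0 e0.
have e20 : 0 < e2 by rewrite /e2; lra.
have [L1 L1P] := rho_low e20.
pose L2 := Num.bound ((2 * M + `|rho| * 2 + 2) / (e2 / 4)).
have e40 : 0 < e2 / 8 by rewrite /e2; lra.
have [L' + LP] := gx _ e40 (maxn (maxn t L1) L2).+1.
case: L' LP => // L LP; rewrite ltnS !geq_max => /andP[/andP[tL L1L] L2L].
have [n0 n0P] := L1P _ L1L.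
have [n1 n1P] : exists n, forall a, a \in F -> (rho + eps) * L%:R < V L n (nx a c0 x).
  apply: (@finite_uniform _ (fun a n => a \in F -> (rho + eps) * L%:R < V L n (nx a c0 x))).
    by move=> a m n mn VP aF; apply: lt_le_trans (VP aF) _; exact: value_homo.
  move=> a; have [aF|aF] := boolP (a \in F); last by exists 0%N.
  by have [n nP] := tP a aF _ tL; exists n.
pose n := maxn n0 n1.
have := LP n; apply/negP; rewrite -ltNge /=.
have [a aF ->] := amin_ex a0F (fun a => Echan (fun c => V L n (nx a c x))).
have V0 : (rho - e2) * L%:R <= V L n zero.
  by apply: le_trans (ltW n0P) _; apply: value_homo => //; rewrite leq_maxl.
have V1 : (rho + eps) * L%:R <= V L n (nx a c0 x).
  by apply: le_trans (ltW (n1P _ aF)) _; apply: value_homo => //; rewrite leq_maxr.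
have : q * ((rho + eps) * L%:R) + (1 - q) * ((rho - e2) * L%:R) <=
       Echan (fun c => V L n (nx a c x)).
  rewrite /Echan (bigD1 c0)//=; apply: lerD; first by rewrite ler_wpM2l// ltW.
  have -> : 1 - q = \sum_(c | c != c0) pr c by rewrite -pr_sum1 (bigD1 c0)//= -/q addrAC subrr add0r.
  rewrite mulr_suml.
  apply: ler_sum => c _; rewrite ler_wpM2l//; apply: le_trans V0 _; apply: (value_mono pr_ge0 pr_sum1 a0F nx_mono C_mono Gd_mono C_ge0); exact: zero_le.
have -> : q * ((rho + eps) * L%:R) + (1 - q) * ((rho - e2) * L%:R) =
  (rho + q * eps - (1 - q) * e2) * L%:R by ring.
have : (rho + e2) * L%:R <= (rho + q * eps - (1 - q) * e2) * L%:R.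
  rewrite ler_wpM2r// -addrA lerD2l.
  have : 0 <= q * e2 by rewrite mulr_ge0// ltW.
  have : 2 * e2 = q * eps by rewrite /e2; field.
  lra.
have LM : 2 * M + `|rho| * 2 + 2 <= e2 / 4 * L%:R.
  have e44 : 0 < e2 / 4 by lra.
  rewrite -ler_pdivrMl// mulrC; apply: ltW; apply: lt_le_trans (archi_boundP _) _.
    by apply: divr_ge0; [rewrite !addr_ge0// mulr_ge0|exact: ltW].
  by rewrite ler_nat.
have := C_ge x; have := ler_norm rho; have := normr_ge0 rho.
have -> : (rho + e2 / 8) * L.+1%:R = (rho + e2 / 8) * L%:R + rho + e2 / 8.
  by rewrite -[L.+1%:R]natr1; ring.
have e1 : e2 <= 1.
  have eps1 : eps <= 1 by rewrite invf_le1// ler1n.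
  have : q * eps <= 1 by rewrite mulr_ile1// ltW.
  rewrite /e2; lra.
have : e2 * L%:R / 4 = e2 / 4 * L%:R by ring.
have : e2 / 8 * L%:R = e2 * L%:R / 8 by ring.
move=> h1 h2 r0 rr cx k1 k2; have k3 := le_trans k1 k2.
move: k3 cx r0 rr LM M_ge0 e1 h1 h2.
move: (Echan _) (C x) `|rho| (L%:R : R) => E Cx r l; clearbody e2.
rewrite [(rho + e2) * l]mulrDl [(rho + e2 / 8) * l]mulrDl => k3 cx r0 rr.
move=> LM M0 e1 -> h2; rewrite -h2 in LM; move: LM k3.
move: (e2 * l) (rho * l) => z w LM k3; lra.
Qed.
End step.

(** With the channel state frozen at [c0], the actions form a deterministic sequence that can be
    played open loop. *)
Lemma good_path : exists (xs : nat -> X) (acts : nat -> Act),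
  [/\ xs 0%N = zero, (forall i, acts i \in F),
      (forall i, xs i.+1 = nx (acts i) c0 (xs i)) &
      forall i (eps : R), 0 < eps -> forall L0, exists2 L, (L0 <= L)%N &
        forall n, V L n (xs i) <= eps * L%:R].
Proof.
have [rho [rho0 up low]] := rho_ex.
pose T := {x | rho_good rho x}.
have stepT (u : T) : {a : Act * T | a.1 \in F /\ sval a.2 = nx a.1 c0 (sval u)}.
  apply: cid; have [a aF ga] := rho_good_step low (svalP u).
  by exists (a, exist _ _ ga).
pose us := fix us i : T := if i is i'.+1 then (sval (stepT (us i'))).2 else exist _ zero up.
exists (fun i => sval (us i)), (fun i => (sval (stepT (us i))).1); split => //.
- by move=> i; have [] := svalP (stepT (us i)).
- by move=> i /=; have [] := svalP (stepT (us i)).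
move=> i eps e0 L0; have [L L0L LP] := svalP (us i) eps e0 L0.
by exists L => // n; apply: le_trans (LP n) _; rewrite ler_wpM2r//; lra.
Qed.
End Good_path.

(** * Domination between age configurations *)

Section Big_minn.
Variables (I : finType) (P : pred I) (f : I -> nat) (x : nat).

Lemma bigminn_attained : (\big[minn/x]_(i | P i) f i = x)%N \/
  exists2 i, P i & (\big[minn/x]_(i | P i) f i = f i)%N.
Proof.
elim/big_rec: _ => [|i y Pi IH]; first by left.
rewrite /minn; case: ltnP => _; last by [].
by right; exists i.
Qed.

Lemma bigminn_le_id : (\big[minn/x]_(i | P i) f i <= x)%N.
Proof. by elim/big_rec: _ => // i y _ h; rewrite geq_min h orbT. Qed.

Lemma bigminn_le_term i : P i -> (\big[minn/x]_(i | P i) f i <= f i)%N.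
Proof.
move=> Pi; have : i \in index_enum I by rewrite mem_index_enum.
elim: (index_enum I) => // j s IH; rewrite inE big_cons => /predU1P[<-|/IH h].
  by rewrite Pi geq_min leqnn.
by case: ifP => // _; rewrite geq_min h orbT.
Qed.
End Big_minn.

Section Network_dynamics.
Variables (N K : nat) (G : network N K).
Implicit Types (a : action G) (c : chan_state G) (r p : ages N K).

Definition le_ages r p := forall k i, (r k i <= p k i)%N.
Definition zero_ages : ages N K := fun _ _ => 0%N.

Lemma zero_ages_le p : le_ages zero_ages p.
Proof. by []. Qed.

Lemma next_ages_aging a c r k i : (next_ages a c r k i <= (r k i).+1)%N.
Proof. by rewrite /next_ages; case: ifP => // _; rewrite ltnS bigminn_le_id. Qed.

(* Entries of age at least [th] in the dominating configuration carry no
   information: this is how ages that are fictitiously infinite are handled. *)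
Lemma next_ages_dom th a c c' r p : c' \subset c ->
  (forall k i, (r k i <= p k i)%N \/ (th <= p k i)%N) ->
  forall k i, (next_ages a c r k i <= next_ages a c' p k i)%N \/
              (th.+1 <= next_ages a c' p k i)%N.
Proof.
move=> cc rp k i; rewrite /next_ages; case: ifP => _; first by left.
rewrite !ltnS.
pose P c (l : link G) :=
  [&& head l == i, (l, k) \in a, l \in c & tail l \in source G k |: comm G k].
rewrite -/(P c) -/(P c').
have [->|[l Pl ->]] := bigminn_attained (P c') (fun l => p k (tail l)) (p k i).
  by case: (rp k i) => h; [left|right] => //; apply: leq_trans h; apply: bigminn_le_id.
case: (rp k (tail l)) => h; [left|right] => //; apply: leq_trans h.
apply: (@bigminn_le_term _ (P c) (fun l => r k (tail l))).
by move: Pl => /and4P[h1 h2 /(fintype.subsetP cc) h3 h4]; apply/and4P.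
Qed.

Lemma next_ages_mono a c c' r p : c' \subset c -> le_ages r p ->
  le_ages (next_ages a c r) (next_ages a c' p).
Proof.
move=> cc rp k i.
(* With the entry itself as threshold, the second alternative is impossible. *)
have := @next_ages_dom (next_ages a c' p k i) a c c' r p cc.
by move=> /(_ (fun k i => or_introl (rp k i)) k i)[//|]; rewrite ltnn.
Qed.
End Network_dynamics.

(* Along a suitable infinite set of times each coordinate is constant or tends
   to infinity. *)
Lemma recurrent_pair (I : finType) (x : nat -> I -> nat) (c : nat) :
  exists n1 n2, (0 < n1)%N /\ forall i,
    ((x n1 i < n1)%N /\ (x n1 i <= x n2 i)%N) \/ (c + n1 <= x n2 i)%N.
Proof.
pose inf_often (P : nat -> Prop) := forall m, exists2 n, (m <= n)%N & P n.
pose Q (A : {set I}) := exists b : nat, inf_often (fun n => forall i, i \in A -> (x n i <= b)%N).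
have Q0 : `[< Q finset.set0 >] by apply/asboolP; exists 0%N => m; exists m => // i; rewrite inE.
(* [A] is a largest set of coordinates that are below a common bound at infinitely many times; by
   maximality every other coordinate tends to infinity along these times. *)
have [A /asboolP[b bP] Amax] :=
  @arg_maxnP _ finset.set0 (fun A => `[< Q A >]) (fun A : {set I} => #|A|) Q0.
pose S n := forall i, i \in A -> (x n i <= b)%N.
have out i : i \notin A -> forall B, exists m, forall n, (m <= n)%N -> S n -> (B < x n i)%N.
  move=> iA B; apply: contrapT => /forallNP H.
  have /Amax : `[< Q (i |: A) >].
    apply/asboolP; exists (maxn b B) => m.
    have /existsNP[n /not_implyP[mn /not_implyP[Sn /negP xB]]] := H m.
    exists n => // j; rewrite !inE => /predU1P[->|/Sn h].
      by rewrite leq_max orbC leqNgt xB.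
    by rewrite leq_max h.
  by rewrite /= cardsU1 iA ltnn.

have [v vP] : exists v : I -> nat, inf_often (fun n => S n /\ forall i, i \in A -> x n i = v i).
  pose V := {ffun I -> 'I_b.+1}.
  pose vec n : V := [ffun i => inord (x n i)].
  apply: contrapT => /forallNP H.
  have [m mP] : exists m, forall v : V, forall n, (m <= n)%N -> ~ (S n /\ vec n = v).
    apply: (@finite_uniform V (fun v m => forall n, (m <= n)%N -> ~ (S n /\ vec n = v))).
      by move=> v m n mn mP k nk; apply: mP; apply: leq_trans nk.
    move=> v; have /existsNP[m mP] := H (fun i => v i).
    exists m => n mn [Sn vn]; apply: mP; exists n => //; split => // i iA.
    by rewrite -vn ffunE inordK// ltnS Sn.
  have [n mn Sn] := bP m.
  exact: (mP (vec n) n mn).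
(* [n1] exceeds the bound on the coordinates in [A]; [n2] repeats their values at a time when all
   other coordinates have passed [c + n1]. *)
have [n1 bn1 [Sn1 v1]] := vP b.+1.
have [m mP] : exists m, forall i, i \notin A -> forall n, (m <= n)%N -> S n -> (c + n1 < x n i)%N.
  apply: (@finite_uniform _ (fun i m => i \notin A -> forall n, (m <= n)%N -> S n -> (c + n1 < x n i)%N)).
    by move=> i m n mn mP iA k nk; apply: mP => //; apply: leq_trans nk.
  move=> i; have [iA|iA] := boolP (i \in A); first by exists 0%N.
  by have [m mP] := out i iA (c + n1)%N; exists m.
have [n2 mn2 [Sn2 v2]] := vP m.
exists n1, n2; split=> [|i]; first by apply: leq_trans bn1.
have [iA|iA] := boolP (i \in A); last by right; apply/ltnW/mP.
left; rewrite v1// v2// leqnn; split => //.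
by apply: leq_trans bn1; rewrite ltnS -v1// Sn1.
Qed.

(** Monotone convergence for a finite weighted sum. Terms of weight 0 may be unbounded, as optimal
    values after null channel states can be. *)
Lemma sup_sum_le (R : realType) (I : finType) (w : I -> R) (f : I -> nat -> R) (B : R) :
  (forall i, 0 <= w i) ->
  (forall i m n, (m <= n)%N -> f i m <= f i n) ->
  (forall i, w i != 0 -> exists b, forall n, f i n <= b) ->
  (forall n, \sum_i w i * f i n <= B) ->
  \sum_i w i * sup (range (f i)) <= B.
Proof.
move=> w0 fm fb sB.
have cvi i : (w i * f i n) @[n --> \oo] --> w i * sup (range (f i)).
  have [->|wi] := eqVneq (w i) 0.
    by rewrite mul0r; under eq_fun do rewrite mul0r; exact: cvg_cst.
  apply: cvgMr; apply: nondecreasing_cvgn; first by move=> m n; exact: fm.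
  by have [b bP] := fb i wi; exists b => _ [n _ <-].
have cvs : (\sum_i w i * f i n) @[n --> \oo] --> \sum_i w i * sup (range (f i)).
  by apply: cvg_big => [|i _]; [exact: add_continuous|exact: cvi].
by apply: (ler_cvg_to cvs (cvg_cst B)); apply: nearW.
Qed.

(* A program drives the network during one cycle: a state machine fed with the
   channel states, [None] marking the end of the cycle, together with an upper
   bound [pcost] on the shifted cost of each destination pair. *)
Record prog (R : realType) (N K : nat) (G : network N K) (J : finType) := Prog {
  pst : Type;
  pini : pst;
  pact : pst -> action G;
  pnxt : pst -> chan_state G -> option pst;
  pcost : J -> pst -> R }.

(** * Cycle programs, their concatenation, and greedy play *)

Section Programs.
Variables (R : realType) (N K : nat) (G : network N K) (pr : chan_state G -> R).
Hypothesis pr_ge0 : forall c, 0 <= pr c.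
Hypothesis pr_sum1 : \sum_c pr c = 1.
Local Notation Echan := (Echan pr).

Section Cycle_cost.
Variables (J : finType) (b : prog R G J) (e : pst b -> R).

Fixpoint Ecost (n : nat) (s : pst b) : R :=
  if n is n'.+1 then
    e s + Echan (fun c => if pnxt s c is Some s' then Ecost n' s' else 0)
  else 0.

(** Verification principle: a nonnegative potential that pays for the current slot and for its own
    mean after the slot pays for any number of slots. *)
Lemma Ecost_supersolution (Ok : pst b -> Prop) (pot : pst b -> R) :
  (forall s, Ok s -> 0 <= pot s) ->
  (forall s c s', Ok s -> pr c != 0 -> pnxt s c = Some s' -> Ok s') ->
  (forall s, Ok s ->
    e s + Echan (fun c => if pnxt s c is Some s' then pot s' else 0) <= pot s) ->
  forall n s, Ok s -> Ecost n s <= pot s.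
Proof.
move=> pot0 Ok_nxt potS; elim=> [|n IH] s Oks /=; first exact: pot0.
apply: le_trans (potS _ Oks); rewrite lerD2l; apply: Echan_le => // c p0.
by case E: (pnxt s c) => [s'|] //; apply: IH; apply: Ok_nxt E.
Qed.

Hypothesis e_ge0 : forall s, 0 <= e s.

Lemma Ecost_ge0 n s : 0 <= Ecost n s.
Proof.
elim: n s => //= n IH s; rewrite addr_ge0//; apply: Echan_ge0 => // c _.
by case: (pnxt s c).
Qed.

Lemma Ecost_homo m n s : (m <= n)%N -> Ecost m s <= Ecost n s.
Proof.
elim: m n s => [|m IH] n s; first by move=> _; exact: Ecost_ge0.
case: n => // n mn /=; rewrite lerD2l; apply: Echan_le => // c _.
by case: (pnxt s c) => // s'; apply: IH.
Qed.
End Cycle_cost.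

Lemma Ecost_sum (J : finType) (b : prog R G J) (I : Type) (r : seq I)
    (w : I -> R) (e : I -> pst b -> R) n s :
  \sum_(i <- r) w i * Ecost (e i) n s =
  Ecost (fun s => \sum_(i <- r) w i * e i s) n s.
Proof.
elim: n s => [|n IH] s /=; first by rewrite big1// => i _; rewrite mulr0.
under eq_bigr do rewrite mulrDr -EchanZ.
rewrite big_split/= -Echan_sum; congr (_ + _); apply: eq_Echan => c _.
case: (pnxt s c) => [s'|]; first exact: IH.
by rewrite big1// => i _; rewrite mulr0.
Qed.

Variables (J : finType) (jk : J -> 'I_K) (ji : J -> 'I_N) (gj : J -> nat -> R).
Hypothesis gj_homo : forall j m n, (m <= n)%N -> gj j m <= gj j n.
Variables (al : J -> R) (Mc : R).
Hypothesis Mc_ge1 : 1 <= Mc.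
Hypothesis gj_al : forall j, 1 <= gj j 0%N - al j + Mc.

Definition unb j := forall B, exists n, B < gj j n.
(** A pair of bounded cost is left free, because its cost is nearly constant at large ages. *)
Definition small cc (r : ages N K) := forall j, unb j -> (r (jk j) (ji j) <= cc)%N.

(* [rem] certifies that a cycle lasts at least [L] slots, and [Inv] that [pcost]
   dominates the shifted cost of the actual ages. *)
Definition valid (cc : nat) (b : prog R G J) (L : nat) (E : J -> R) :=
  [/\ forall s : pst b, pact s \in feasible G,
      forall j (s : pst b), 1 <= pcost j s,
      exists rem : pst b -> nat, rem (pini b) = L /\
        forall s c, pr c != 0 ->
          if pnxt s c is Some s' then (rem s <= (rem s').+1)%N else (rem s <= 1)%N,
      exists Inv : pst b -> ages N K -> Prop,
        [/\ forall r, small cc r -> Inv (pini b) r,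
            forall s r, Inv s r -> forall j,
              gj j (r (jk j) (ji j)) - al j + Mc <= pcost j s &
            forall s r c, Inv s r -> pr c != 0 ->
              if pnxt s c is Some s' then Inv s' (next_ages (pact s) c r)
              else small cc (next_ages (pact s) c r)] &
      forall j n, Ecost (pcost (p:=b) j) n (pini b) <= E j].

(** The end of the first machine becomes the initial state of the second. Valid cycles fit together
    because [small cc] is both what a cycle guarantees at its end and all it requires at its
    start. *)
Definition cat_prog (b1 b2 : prog R G J) : prog R G J := {|
  pst := pst b1 + pst b2;
  pini := inl (pini b1);
  pact s := match s with inl s => pact s | inr s => pact s end;
  pnxt s c := match s with
    | inl s => Some (if pnxt s c is Some s' then inl s' else inr (pini b2))
    | inr s => omap inr (pnxt s c) end;
  pcost j s := match s with inl s => pcost j s | inr s => pcost j s end |}.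

Lemma Ecost_cat b1 b2 j n s1 E1 E2 :
  (forall n, Ecost (pcost (p:=b2) j) n (pini b2) <= E2) ->
  (forall n, Ecost (pcost (p:=b1) j) n s1 <= E1) ->
  (forall j (s : pst b1), 1 <= pcost j s) ->
  (forall j (s : pst b2), 1 <= pcost j s) ->
  Ecost (pcost (p:=cat_prog b1 b2) j) n (inl s1) <= E1 + E2.
Proof.
move=> h2 h1 p1 p2.
have Xinr m s : Ecost (pcost (p:=cat_prog b1 b2) j) m (inr s) = Ecost (pcost (p:=b2) j) m s.
  elim: m s => //= m IH s; congr (_ + _); apply: eq_Echan => c _.
  by case: (pnxt s c) => //= s'.
have E20 : 0 <= E2 by exact: (h2 0%N).
suff H m s : Ecost (pcost (p:=cat_prog b1 b2) j) m (inl s) <= Ecost (pcost (p:=b1) j) m s + E2.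
  by apply: le_trans (H n s1) _; rewrite lerD2r.
elim: m s => [|m IH] s /=; first by rewrite add0r.
rewrite -addrA lerD2l -[E2](Echan_cst pr_sum1) -EchanD; apply: Echan_le => // c _.
by case: (pnxt s c) => [s'|]; [exact: IH|rewrite Xinr add0r].
Qed.

Lemma valid_cat cc b1 L1 E1 b2 L2 E2 : valid cc b1 L1 E1 -> valid cc b2 L2 E2 ->
  valid cc (cat_prog b1 b2) (L1 + L2) (fun j => E1 j + E2 j).
Proof.
move=> [f1 p1 [r1 [r1i r1s]] [I1 [I1i I1c I1s]] X1]
  [f2 p2 [r2 [r2i r2s]] [I2 [I2i I2c I2s]] X2]; split.
- by case=> s; [exact: f1|exact: f2].
- by move=> j [s|s]; [exact: p1|exact: p2].
- exists (fun s => match s with inl s => (r1 s + L2)%N | inr s => r2 s end).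
  split; first by rewrite /= r1i.
  case=> [s|s] c p0 /=.
    have := r1s s c p0; case: (pnxt s c) => [s'|] h; first by rewrite -addSn leq_add2r.
    by rewrite r2i -add1n leq_add2r.
  by have := r2s s c p0; case: (pnxt s c).
- exists (fun s r => match s with inl s => I1 s r | inr s => I2 s r end); split.
  + exact: I1i.
  + by case=> s r Is j; [exact: I1c|exact: I2c].
  + case=> s r c Is p0 /=.
      have := I1s s r c Is p0; case: (pnxt s c) => [s'|] //=; exact: I2i.
    by have := I2s s r c Is p0; case: (pnxt s c).
- by move=> j n; apply: Ecost_cat.
Qed.

Lemma valid_iter cc b L E m : valid cc b L E ->
  exists b', valid cc b' (m.+1 * L) (fun j => m.+1%:R * E j).
Proof.
move=> v; elim: m => [|m [b' IH]].
  by exists b; rewrite mul1n (_ : (fun _ => _) = E)//; apply/funext => j; rewrite mul1r.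
exists (cat_prog b b'); rewrite mulSn.
rewrite (_ : (fun _ => _) = (fun j => E j + m.+1%:R * E j)); first exact: valid_cat.
by apply/funext => j; rewrite -[m.+2%:R]natr1; ring.
Qed.

Section Greedy.
Variables (c0 : chan_state G) (a0 : action G).
Hypothesis pr_c0 : 0 < pr c0.
Hypothesis c0_min : forall c, pr c != 0 -> c0 \subset c.
Hypothesis a0F : a0 \in feasible G.
Local Notation nx := (@next_ages N K G).
Local Notation zero := (@zero_ages N K).
Let nx_mono a c x y : le_ages x y -> le_ages (nx a c x) (nx a c y).
Proof. exact: next_ages_mono. Qed.

Section Value.
Variables (C : ages N K -> R) (Gd : ages N K -> bool).
Hypothesis C_mono : forall x y, le_ages x y -> C x <= C y.
Hypothesis Gd_mono : forall x y, le_ages x y -> Gd y -> Gd x.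
Hypothesis C_ge0 : forall x, ~~ Gd x -> 0 <= C x.
Variable M : R.
Hypothesis M_ge0 : 0 <= M.
Hypothesis C_ge : forall x, - M <= C x.
Local Notation V := (value pr (feasible G) a0 nx C Gd).

(** Without this bound the supremum [vs] over the truncations carries no information, so the bound
    is propagated along the greedy play. *)
Definition bdd l x := exists B, forall n, V l n x <= B.
Definition vs l x := sup (range (fun n => V l n x)).

Lemma vs_ub l x n : bdd l x -> V l n x <= vs l x.
Proof.
move=> [B BP]; apply: ub_le_sup; last by exists n.
by exists B => _ [m _ <-].
Qed.

Lemma vs_le l x B : (forall n, V l n x <= B) -> vs l x <= B.
Proof.
move=> BP; apply: ge_sup; first by exists (V l 0 x), 0%N.
by move=> _ [m _ <-].
Qed.

(** One action serves all truncations. Otherwise each of the finitely many feasible actions fails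
    for some [n], and all fail for a common one since values increase with [n]; there the best
    action contradicts [vs_ub]. *)
Lemma greedy_ex l x : bdd l x -> (0 < l)%N \/ ~~ Gd x ->
  exists2 a, a \in feasible G &
    forall n, C x + Echan (fun c => V l.-1 n (nx a c x)) <= vs l x.
Proof.
move=> bx lx; apply: contrapT => H.
have VE n : exists2 m, V l m x = C x + amin (feasible G) a0 (fun a => Echan (fun c => V l.-1 n (nx a c x))) & true.
  case: l bx lx H => [|l] bx [//|Gx] H; last by exists n.
    by exists n.+1; rewrite /= ?(negbTE Gx).
  by exists n.
have [n nP] : exists n, forall a, a \in feasible G -> vs l x < C x + Echan (fun c => V l.-1 n (nx a c x)).
  apply: (@finite_uniform _ (fun a n => a \in feasible G -> vs l x < C x + Echan (fun c => V l.-1 n (nx a c x)))).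
    move=> a m n mn lt aF; apply: lt_le_trans (lt aF) _; rewrite lerD2l.
    by apply: Echan_le => // c _; apply: value_homo.
  move=> a; have [aF|aF] := boolP (a \in feasible G); last by exists 0%N.
  apply: contrapT => /forallNP Hn; apply: H; exists a => // n.
  by rewrite leNgt; apply/negP => h; apply: (Hn n).
have [m mE _] := VE n.
have := vs_ub m bx; apply/negP; rewrite -ltNge mE.
by have [a aF ->] := amin_ex a0F (fun a => Echan (fun c => V l.-1 n (nx a c x))); apply: nP.
Qed.

Definition greedy l x : action G :=
  if pselect (exists2 a, a \in feasible G &
    forall n, C x + Echan (fun c => V l.-1 n (nx a c x)) <= vs l x) is left h
  then sval (cid2 h) else a0.

Lemma greedy_feasible l x : greedy l x \in feasible G.
Proof. by rewrite /greedy; case: pselect => // h; case: (cid2 h). Qed.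

(** A successor of positive probability inherits boundedness because the others, costing at least
    [- M] per compulsory slot, cannot cancel an infinite value. In the waiting phase [l.-1] stays at
    0. *)
Lemma greedyP l x : bdd l x -> (0 < l)%N \/ ~~ Gd x ->
  (forall c, pr c != 0 -> bdd l.-1 (nx (greedy l x) c x)) /\
  C x + Echan (fun c => vs l.-1 (nx (greedy l x) c x)) <= vs l x.
Proof.
move=> bx lx; have gP n : C x + Echan (fun c => V l.-1 n (nx (greedy l x) c x)) <= vs l x.
  by rewrite /greedy; case: pselect => [h|/(_ (greedy_ex bx lx))//]; case: (cid2 h).
set a := greedy l x in gP *.
have b c : pr c != 0 -> bdd l.-1 (nx a c x).
  move=> p0; have pc : 0 < pr c by rewrite lt_neqAle eq_sym p0 pr_ge0.
  exists ((vs l x - C x + M * l.-1%:R) / pr c) => n.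
  rewrite ler_pdivlMr// -lerBlDr; apply: le_trans (_ : Echan (fun c => V l.-1 n (nx a c x)) <= _); last first.
    by rewrite lerBrDl.
  rewrite /Echan (bigD1 c)//= mulrC lerD2l.
  apply: le_trans (_ : \sum_(i | i != c) pr i * - (M * l.-1%:R) <= _); last first.
    by apply: ler_sum => i _; rewrite ler_wpM2l//; apply: value_ge.
  rewrite -mulr_suml mulrN lerN2 ler_piMl ?mulr_ge0//.
  by rewrite -pr_sum1 [leRHS](bigD1 c)//= lerDr.
split=> //; rewrite -lerBrDl.
apply: (sup_sum_le (f := fun c n => V l.-1 n (nx a c x))) => //.
- by move=> c m n mn; apply: value_homo.
- by move=> n; rewrite lerBrDl; exact: gP.
Qed.
End Value.
End Greedy.
End Programs.

(** * Cycles for a fixed weight vector *)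

Section Scalar_program.
Variables (R : realType) (N K : nat) (G : network N K) (pr : chan_state G -> R).
Hypothesis pr_ge0 : forall c, 0 <= pr c.
Hypothesis pr_sum1 : \sum_c pr c = 1.
Variables (J : finType) (jk : J -> 'I_K) (ji : J -> 'I_N) (gj : J -> nat -> R).
Hypothesis gj_homo : forall j m n, (m <= n)%N -> gj j m <= gj j n.
Variables (al : J -> R) (Mc : R).
Hypothesis Mc_ge1 : 1 <= Mc.
Hypothesis gj_al : forall j, 1 <= gj j 0%N - al j + Mc.
Variables (c0 : chan_state G) (a0 : action G).
Hypothesis pr_c0 : 0 < pr c0.
Hypothesis c0_min : forall c, pr c != 0 -> c0 \subset c.
Hypothesis a0F : a0 \in feasible G.
Local Notation Echan := (Echan pr).
Local Notation nx := (@next_ages N K G).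
Local Notation zero := (@zero_ages N K).
Local Notation unb := (unb gj).
Local Notation small := (small jk ji gj).
Let cost j (x : ages N K) := gj j (x (jk j) (ji j)).
Hypothesis acceptable : forall y : J -> R, (forall j, 0 < y j) -> forall H,
  value pr (feasible G) a0 nx (fun x => \sum_j y j * cost j x) xpredT H 0 zero
  <= H%:R * \sum_j y j * al j.

Lemma cost_ge1 j x : 1 <= cost j x - al j + Mc.
Proof. by apply: le_trans (gj_al j) _; rewrite lerD2r lerD2r gj_homo. Qed.

Lemma unb_large (T : J -> R) : exists c1, forall cc, (c1 <= cc)%N ->
  forall j, unb j -> T j <= gj j cc.
Proof.
have [c1 c1P] : exists c1, forall j, unb j -> T j <= gj j c1.
  apply: (@finite_uniform _ (fun j c1 => unb j -> T j <= gj j c1)).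
    by move=> j m n mn h uj; apply: le_trans (h uj) (gj_homo _ mn).
  move=> j; have [uj|uj] := pselect (unb j); last by exists 0%N.
  by have [n nP] := uj (T j); exists n => _; apply: ltW.
exists c1 => cc ccP j uj; apply: le_trans (c1P j uj) (gj_homo _ ccP).
Qed.

Lemma bnd_ex j : ~ unb j -> exists B, forall n, gj j n <= B.
Proof.
move=> /existsNP[B /forallNP BP]; exists B => n; rewrite leNgt; apply/negP/BP.
Qed.

Lemma bnd_near (e : R) : 0 < e -> exists c1, forall j, ~ unb j ->
  forall m r, (c1 <= m)%N -> gj j r <= gj j m + e.
Proof.
move=> e0; apply: (@finite_uniform _ (fun j c1 => ~ unb j ->
  forall m r, (c1 <= m)%N -> gj j r <= gj j m + e)).
  by move=> j m n mn h uj k r nk; apply: h => //; apply: leq_trans nk.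
move=> j; have [uj|uj] := pselect (unb j); first by exists 0%N.
have [B BP] := bnd_ex uj.
have sE : has_sup (range (gj j)).
  by split; [exists (gj j 0%N), 0%N|exists B => _ [n _ <-]].
have [_ [n _ <-] nP] := sup_adherent e0 sE.
exists n => _ m r nm; rewrite -lerBlDr; apply: le_trans (gj_homo j nm).
apply: ltW; apply: le_lt_trans nP; rewrite lerD2r; apply: ub_le_sup; last by exists r.
by case: sE.
Qed.

Section Fixed_weights.
Variables (y : J -> R) (dl e1 e3 : R) (cc : nat).
Hypotheses (dl0 : 0 < dl) (e10 : 0 < e1) (e30 : 0 < e3).
Hypothesis y_ge : forall j, dl <= y j.
Hypothesis y_le : forall j, y j <= 1.
Let Y := \sum_j y j.
Let M2 := Mc * Y + e1 * Y + e1.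
Let C x := \sum_j y j * cost j x - (\sum_j y j * al j + e1).
Let Gd x := `[< small cc x >].
Hypothesis cc_unb : forall j, unb j -> (M2 / e3 + Mc * #|J|%:R + e1) / dl + al j <= gj j cc.
Hypothesis cc_bnd : forall j, ~ unb j -> forall m r, (cc <= m)%N -> gj j r <= gj j m + e1.

Let y0 j : 0 < y j. Proof. exact: lt_le_trans (y_ge j). Qed.
Let Mc0 : 0 <= Mc. Proof. by apply: le_trans Mc_ge1. Qed.
Let Y0 : 0 <= Y. Proof. by apply: sumr_ge0 => j _; apply: ltW. Qed.
Let M20 : 0 <= M2.
Proof. by rewrite /M2 !addr_ge0// ?mulr_ge0// ltW. Qed.

Let eE x : \sum_j y j * (cost j x - al j + Mc + e1) = C x + M2.
Proof.
have -> : \sum_j y j * (cost j x - al j + Mc + e1) =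
    \sum_j y j * cost j x - \sum_j y j * al j + Y * (Mc + e1).
  rewrite /Y mulr_suml -sumrB -big_split/=; apply: eq_bigr => j _; ring.
rewrite /C /M2; ring.
Qed.

Let C_geM x : - M2 <= C x.
Proof.
rewrite -subr_ge0 opprK -eE; apply: sumr_ge0 => j _; rewrite mulr_ge0 ?(ltW (y0 j))//.
have := cost_ge1 j x; have := ltW e10; lra.
Qed.

Let C_mono x x' : le_ages x x' -> C x <= C x'.
Proof.
by move=> h; rewrite lerD2r; apply: ler_sum => j _; rewrite ler_wpM2l// ?gj_homo// ltW.
Qed.

Let Gd_mono x x' : le_ages x x' -> Gd x' -> Gd x.
Proof.
by move=> h /asboolP s; apply/asboolP => j /s; apply: leq_trans.
Qed.

(** A pair of unbounded cost with age above [cc] outweighs all others, which lose at most [Mc] each.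
    The factor [e3^-1] makes the shift [M2] negligible against [C] in the slots spent waiting for
    [Gd], whose number is random. *)
Let C_out x : ~~ Gd x -> M2 / e3 <= C x.
Proof.
move=> /asboolPn /existsNP[j /not_implyP[uj /negP]]; rewrite -ltnNge => ccx.
have hj : M2 / e3 + Mc * #|J|%:R + e1 <= y j * (cost j x - al j).
  have : (M2 / e3 + Mc * #|J|%:R + e1) / dl <= cost j x - al j.
    by rewrite lerBrDr; apply: le_trans (cc_unb uj) (gj_homo _ (ltnW ccx)).
  set w := _ + e1; have w0 : 0 <= w.
    by rewrite /w !addr_ge0 ?divr_ge0 ?mulr_ge0 ?(ltW e30) ?(ltW e10).
  rewrite ler_pdivrMr// => h; apply: le_trans (h) _; rewrite mulrC ler_wpM2r//.
  by rewrite -(pmulr_lge0 _ dl0); apply: le_trans w0 _.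
have -> : C x = \sum_j y j * (cost j x - al j) - e1.
  by rewrite /C opprD addrA; under [in RHS]eq_bigr do rewrite mulrBr; rewrite sumrB.
rewrite (bigD1 j)//= lerBrDr.
have : - (Mc * #|J|%:R) <= \sum_(i | i != j) y i * (cost i x - al i).
  have -> : - (Mc * #|J|%:R) = \sum_(i : J) - Mc.
    by rewrite sumr_const mulNrn mulr_natr.
  rewrite (bigD1 j)//= -[leRHS]add0r; apply: lerD; first by rewrite oppr_le0.
  apply: ler_sum => i _; have h := cost_ge1 i x.
  apply: le_trans (_ : y i * (1 - Mc) <= _); last first.
    by rewrite ler_wpM2l ?(ltW (y0 i))//; lra.
  have h1 : (1 - y i) * (Mc - 1) >= 0.
    by rewrite mulr_ge0// subr_ge0.
  lra.
lra.
Qed.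

Let C_ge0 x : ~~ Gd x -> 0 <= C x.
Proof. by move=> /C_out; apply: le_trans; rewrite divr_ge0// ltW. Qed.

Local Notation V := (value pr (feasible G) a0 nx C Gd).

(** A positive cycle value would, by [renewal], bound the cost of [H] slots from below by a
    constant, whereas acceptability and the slack [e1] in [C] bound it by [- e1 * H]. *)
Let V_le0 L n : (0 < L)%N -> V L n zero <= 0.
Proof.
move=> L0; rewrite leNgt; apply/negP => /ltW V0.
have nxm a c r p : le_ages r p -> le_ages (nx a c r) (nx a c p) by exact: next_ages_mono.
pose H := Num.bound (M2 * (L + n)%:R / e1).
have := renewal pr_ge0 pr_sum1 a0F (@zero_ages_le N K) nxm C_mono Gd_mono C_ge0 M20 C_geM L0 V0 H zero.
rewrite (value_shift pr_ge0 pr_sum1 a0F) (value0_Gd pr a0F nx _ Gd xpredT).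
have := acceptable y0 H.
have : M2 * (L + n)%:R < e1 * H%:R.
  rewrite -ltr_pdivrMl// mulrC; apply: archi_boundP.
  by rewrite divr_ge0 ?mulr_ge0// ltW.
set s := value _ _ _ _ _ _ _ _ _; set t := \sum_j _.
rewrite mulrDl; lra.
Qed.

Variable ep : R.
Hypothesis ep0 : 0 < ep.
Hypothesis e3_le1 : e3 <= 1.
Hypothesis e1_small : e1 * (Y + 1) <= ep / 8.
Hypothesis e3_small : e3 * M2 <= ep / 8.

Section Cycle.
Variables (xs : nat -> ages N K) (acts : nat -> action G) (n1 : nat) (z : ages N K) (L : nat).
Hypothesis actsF : forall i, acts i \in feasible G.
Hypothesis xsS : forall i, xs i.+1 = nx (acts i) c0 (xs i).
Hypothesis n1_gt0 : (0 < n1)%N.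
Hypothesis z_dom : forall k i, ((xs n1 k i < n1)%N /\ (xs n1 k i <= z k i)%N) \/
  (cc + n1 <= z k i)%N.
Hypothesis L_gt0 : (0 < L)%N.
Hypothesis VL : forall n, V L n z <= ep / 8 * L%:R.
Variable tc : J -> R.
Hypothesis tcP : forall j r, (unb j -> (r <= cc + n1)%N) -> gj j r <= tc j.
Hypothesis tcL : n1%:R * (\sum_j (tc j - al j + Mc)) <= ep / 8 * L%:R.

Let gr l x := greedy pr a0 C Gd l x.

(** [inl i] is slot [i] of the open-loop phase, charged the worst cost [tc]. [inr (x, l)] holds the
    fictitious configuration and the number of compulsory slots left; its extra [e1] covers pairs of
    bounded cost whose real age may exceed that in [x]. *)
Let cyc : prog R G J := {|
  pst := nat + (ages N K * nat);
  pini := inl 0%N;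
  pact s := match s with inl i => acts i | inr (x, l) => gr l x end;
  pnxt s c := match s with
    | inl i => if (i.+1 < n1)%N then Some (inl i.+1) else Some (inr (z, L))
    | inr (x, l) => let x' := nx (gr l x) c x in
        if (l.-1 == 0)%N && Gd x' then None else Some (inr (x', l.-1)) end;
  pcost j s := match s with inl i => tc j - al j + Mc
    | inr (x, l) => cost j x - al j + Mc + e1 end |}.

Let tc_ge1 j : 1 <= tc j - al j + Mc.
Proof. by apply: le_trans (gj_al j) _; rewrite 2!lerD2r tcP. Qed.

Let cyc_ge1 j (s : pst cyc) : 1 <= pcost j s.
Proof.
case: s => [i|[x l]] /=; first exact: tc_ge1.
by have := cost_ge1 j x; have := ltW e10; lra.
Qed.

Let cyc_rem : exists rem : pst cyc -> nat, rem (pini cyc) = (n1 + L)%N /\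
  forall s c, pr c != 0 ->
    if pnxt s c is Some s' then (rem s <= (rem s').+1)%N else (rem s <= 1)%N.
Proof.
exists (fun s => match s with inl i => (n1 - i + L)%N | inr (x, l) => l end).
split; first by rewrite /= subn0.
case=> [i|[x l]] c _ /=.
  case: ifPn => /= [_|]; first by rewrite -addSn leq_add2r subnS leqSpred.
  by rewrite -leqNgt => h; rewrite -add1n leq_add2r leq_subLR addn1.
case: ifPn => /= [/andP[/eqP]|]; first by case: l => // -[].
by case: l.
Qed.

(** At the start the threshold 0 makes domination vacuous, and each slot raises the threshold by
    one. After [n1] slots the entries of [xs n1] below [n1] really dominate; [z] is at least as
    large there, and its remaining entries reach the new threshold [cc + n1]. *)
Let cyc_inv : exists Inv : pst cyc -> ages N K -> Prop,
  [/\ forall r, small cc r -> Inv (pini cyc) r,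
      forall s r, Inv s r -> forall j,
        gj j (r (jk j) (ji j)) - al j + Mc <= pcost j s &
      forall s r c, Inv s r -> pr c != 0 ->
        if pnxt s c is Some s' then Inv s' (nx (pact s) c r)
        else small cc (nx (pact s) c r)].
Proof.
pose dom th (r p : ages N K) := forall k i, (r k i <= p k i)%N \/ (th <= p k i)%N.
exists (fun s r => match s with
  | inl i => [/\ (i < n1)%N, dom i r (xs i) & small (cc + i) r]
  | inr (x, l) => exists th, [/\ (cc <= th)%N, dom th r x & small th r] end).
split.
- by move=> r sr /=; split => //; [move=> k i; right|rewrite addn0].
- case=> [i|[x l]] r /=.
    move=> [i1 _ sr] j; rewrite !lerD2r; apply: tcP => uj.
    by apply: leq_trans (sr j uj) _; rewrite leq_add2l ltnW.
  move=> [th [cth dr sr]] j.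
  have -> : cost j x - al j + Mc + e1 = cost j x + e1 - al j + Mc by ring.
  rewrite 2!lerD2r.
  have [uj|uj] := pselect (unb j).
    apply: le_trans (_ : cost j x <= _); last by rewrite lerDl ltW.
    by apply: gj_homo; case: (dr (jk j) (ji j)) => // h; apply: leq_trans (sr j uj) h.
  case: (dr (jk j) (ji j)) => h; last by apply: cc_bnd => //; apply: leq_trans h.
  by apply: le_trans (gj_homo _ h) _; rewrite lerDl ltW.
- case=> [i|[x l]] r c /=.
    move=> [i1 dr sr] p0.
    have dr' : dom i.+1 (nx (acts i) c r) (xs i.+1).
      by rewrite xsS; apply: next_ages_dom => //; apply: c0_min.
    have sr' : small (cc + i).+1 (nx (acts i) c r).
      by move=> j uj; apply: leq_trans (next_ages_aging _ _ _ _ _) _; rewrite ltnS sr.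
    case: ifPn => [i2|]; first by split => //; rewrite addnS.
    rewrite -leqNgt => i2; have n1E : n1 = i.+1 by apply/eqP; rewrite eqn_leq i2.
    exists (cc + n1)%N; split; rewrite ?leq_addr// n1E ?addnS//.
    move=> k i'; case: (z_dom k i') => [[h1 h2]|h]; last by right; rewrite -addnS -n1E.
    left; case: (dr' k i') => h; first by rewrite -n1E in h; apply: leq_trans h h2.
    by move: h1; rewrite n1E ltnNge h.
  move=> [th [cth dr sr]] p0.
  have dr' : dom th.+1 (nx (gr l x) c r) (nx (gr l x) c x) by exact: next_ages_dom.
  have sr' : small th.+1 (nx (gr l x) c r).
    by move=> j uj; apply: leq_trans (next_ages_aging _ _ _ _ _) _; rewrite ltnS sr.
  case: ifPn => [/andP[_ /asboolP G']|_]; last first.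
    by exists th.+1; split => //; apply: leqW.
  (* An uninformative fictitious entry is at least the threshold, which itself bounds the real
     age. *)
  move=> j uj; case: (dr' (jk j) (ji j)) => h; apply: leq_trans (G' j uj) => //.
  exact: leq_trans (sr' j uj) h.
Qed.

(** Each compulsory slot has its share [M2] of the shift. In the waiting phase, [l = 0], the factor
    [1 + e3] pays for the shift, as [M2 <= e3 * C] there. *)
Let pot (s : pst cyc) := match s with
  | inl i => (n1 - i)%:R * (\sum_j (tc j - al j + Mc)) + (1 + e3) * (vs pr a0 C Gd L z + M2 * L%:R)
  | inr (x, l) => (1 + e3) * (vs pr a0 C Gd l x + M2 * l%:R) end.

Let Ok (s : pst cyc) : Prop := match s with
  | inl i => is_true (i < n1)%N
  | inr (x, l) => bdd pr a0 C Gd l x /\ ((0 < l)%N \/ ~~ Gd x) end.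

Let Okz : Ok (inr (z, L)).
Proof. by split; [exists (ep / 8 * L%:R)|left]. Qed.

Let pot_run_ge0 x l : bdd pr a0 C Gd l x -> 0 <= (1 + e3) * (vs pr a0 C Gd l x + M2 * l%:R).
Proof.
move=> bx; apply: mulr_ge0; first by rewrite addr_ge0// ltW.
rewrite -lerBlDr sub0r; apply: le_trans (vs_ub 0 bx).
exact: (value_ge pr_ge0 pr_sum1 a0F nx C_ge0 C_geM).
Qed.

Let pot_ge0 s : Ok s -> 0 <= pot s.
Proof.
case: s => [i|[x l]] /= h; last by case: h => bx _; apply: pot_run_ge0.
apply: addr_ge0; last by apply: pot_run_ge0; case: Okz.
by rewrite mulr_ge0// sumr_ge0// => j _; apply: le_trans (tc_ge1 j).
Qed.

Let cyc_cost n : Ecost pr (b:=cyc) (fun s => \sum_j y j * pcost j s) n (pini cyc) <=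
  (Mc * Y + ep) * (n1 + L)%:R.
Proof.
have TC0 : 0 <= \sum_j (tc j - al j + Mc).
  by rewrite sumr_ge0// => j _; apply: le_trans (tc_ge1 j).
apply: (@le_trans _ _ (pot (pini cyc))); last first.
  rewrite /= subn0 natrD.
  have : (1 + e3) * (vs pr a0 C Gd L z + M2 * L%:R) <= (1 + e3) * (ep / 8 * L%:R + M2 * L%:R).
    by rewrite ler_wpM2l ?addr_ge0 ?(ltW e30)// lerD2r vs_le.
  have L0 := ler0n R L; have N0 := ler0n R n1.
  have h1 : e3 * (ep / 8 * L%:R) <= ep / 8 * L%:R.
    by rewrite ler_piMl// mulr_ge0// divr_ge0// ltW.
  have h2 : e3 * (M2 * L%:R) <= ep / 8 * L%:R by rewrite mulrA ler_wpM2r.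
  have h3 : M2 * L%:R <= Mc * Y * L%:R + ep / 8 * L%:R.
    rewrite -mulrDl ler_wpM2r// /M2 -addrA lerD2l; apply: le_trans e1_small.
    by rewrite mulrDr mulr1.
  have h4 : 0 <= (Mc * Y + ep) * n1%:R by rewrite mulr_ge0// addr_ge0 ?mulr_ge0// ltW.
  have h5 : 0 <= ep * L%:R by rewrite mulr_ge0// ltW.
  have := tcL; move: h1 h2 h3 h4; set u := ep / 8 * L%:R; set w := M2 * L%:R => h1 h2 h3 h4.
  have hu : ep * L%:R = 8 * u by rewrite /u; field.
  have -> : (1 + e3) * (u + w) = u + w + (e3 * u + e3 * w) by ring.
  have -> : (Mc * Y + ep) * (n1%:R + L%:R) = (Mc * Y + ep) * n1%:R + (Mc * Y * L%:R + ep * L%:R) by ring.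
  rewrite hu in h5 *; lra.
apply: (@Ecost_supersolution _ _ _ _ _ pr_ge0 _ cyc _ Ok pot pot_ge0 _ _) => //.
- case=> [i|[x l]] c s' /=.
    by move=> i1 p0; case: ifPn => i2 [<-].
  move=> [bx lx] p0; have [bx' _] := greedyP pr_ge0 pr_sum1 a0F C_ge0 M20 C_geM bx lx.
  case: ifPn => // h [<-] /=; split; first exact: bx'.
  by move: h; rewrite negb_and -lt0n => /orP.
- case=> [i|[x l]] /=.
    move=> i1.
    have yS : \sum_j y j * (tc j - al j + Mc) <= \sum_j (tc j - al j + Mc).
      by apply: ler_sum => j _; rewrite ler_piMl//; apply: le_trans (tc_ge1 j).
    have -> : (n1 - i)%:R * (\sum_j (tc j - al j + Mc)) =
        (n1 - i.+1)%:R * (\sum_j (tc j - al j + Mc)) + \sum_j (tc j - al j + Mc).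
      by rewrite -(subnSK i1) -natr1 mulrDl mul1r.
    case: ifPn => i2; rewrite Echan_cst//=.
      by rewrite addrA lerD2r addrC lerD2l.
    by rewrite -leqNgt -subn_eq0 in i2; rewrite (eqP i2) mul0r add0r lerD2r.
  move=> [bx lx]; have [_ vx] := greedyP pr_ge0 pr_sum1 a0F C_ge0 M20 C_geM bx lx.
  rewrite eE.
  have -> : Echan (fun c => if (if (l.-1 == 0)%N && Gd (nx (gr l x) c x) then None
        else Some (inr (nx (gr l x) c x, l.-1))) is Some s' then pot s' else 0) =
      (1 + e3) * (Echan (fun c => vs pr a0 C Gd l.-1 (nx (gr l x) c x)) + M2 * l.-1%:R).
    rewrite -(Echan_cst pr_sum1 (M2 * l.-1%:R)) -EchanD -EchanZ; apply: eq_Echan => c _.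
    case: ifPn => //= /andP[/eqP -> Gx]; rewrite mulr0 addr0.
    rewrite (_ : vs _ _ _ _ _ _ = 0) ?mulr0//.
    apply/eqP; rewrite eq_le; apply/andP; split.
      by apply: vs_le => -[|m] //=; rewrite Gx.
    apply: (@le_trans _ _ (V 0%N 0%N (nx (gr l x) c x))) => //.
    by apply: vs_ub; exists 0 => -[|m] //=; rewrite Gx.
  set E := Echan _ in vx *.
  apply: (@le_trans _ _ (C x + M2 + (1 + e3) * (vs pr a0 C Gd l x - C x + M2 * l.-1%:R))).
    by rewrite lerD2l ler_wpM2l ?addr_ge0 ?(ltW e30)// lerD2r lerBrDl.
  case: l bx lx @E vx => [|l] bx lx E vx /=.
    have [//|Gx] := lx; have := C_out Gx; rewrite ler_pdivrMr// => h.
    rewrite !mulr0 !addr0 mulrDr mulrN; lra.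
  have : 0 <= e3 * (C x + M2).
    by rewrite mulr_ge0 ?(ltW e30)// -lerBlDr sub0r.
  rewrite -natr1; lra.
Qed.

Lemma cycle_program : exists b E, valid pr jk ji gj al Mc cc b (n1 + L) E /\
  \sum_j y j * E j <= (Mc * Y + ep) * (n1 + L)%:R.
Proof.
have pge0 j (s : pst cyc) : 0 <= pcost j s by apply: le_trans (cyc_ge1 j s).
have tot n : \sum_j y j * Ecost pr (b:=cyc) (pcost j) n (pini cyc) <=
    (Mc * Y + ep) * (n1 + L)%:R.
  by rewrite Ecost_sum; apply: cyc_cost.
have bnd j : exists B, forall n, Ecost pr (b:=cyc) (pcost j) n (pini cyc) <= B.
  exists ((Mc * Y + ep) * (n1 + L)%:R / y j) => n; rewrite ler_pdivlMr// mulrC.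
  apply: le_trans (tot n); rewrite (bigD1 j)//= lerDl; apply: sumr_ge0 => i _.
  by apply: mulr_ge0; [exact: ltW (y0 i)|exact: (Ecost_ge0 pr_ge0 pr_sum1 (pge0 i))].
exists cyc, (fun j => sup (range (fun n => Ecost pr (b:=cyc) (pcost j) n (pini cyc)))).
split; last first.
  apply: sup_sum_le => // [j|j m n mn]; first exact: ltW (y0 j).
  exact: (Ecost_homo pr_ge0 pr_sum1 (pge0 j) _ mn).
split => //.
- by case=> [i|[x l]] //=; apply: greedy_feasible.
- move=> j n; apply: ub_le_sup; last by exists n.
  by have [B BP] := bnd j; exists B => _ [m _ <-].
Qed.
End Cycle.

Lemma fixed_weights_program : exists b L E, [/\ (0 < L)%N,
  valid pr jk ji gj al Mc cc b L E &
  \sum_j y j * E j <= (Mc * Y + ep) * L%:R].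
Proof.
have nxm a c r p : le_ages r p -> le_ages (nx a c r) (nx a c p) by exact: next_ages_mono.
have [xs [acts [_ actsF xsS VP]]] := good_path pr_ge0 pr_sum1 a0F
  (@zero_ages_le N K) nxm C_mono Gd_mono C_ge0 M20 C_geM V_le0 pr_c0.
have [n1 [n2 [n10 zP]]] := recurrent_pair (fun n (ki : 'I_K * 'I_N) => xs n ki.1 ki.2) cc.
have [tc tcP] : exists tc : J -> R, forall j r,
    (unb j -> (r <= cc + n1)%N) -> gj j r <= tc j.
  suff /choice[tc tcP] : forall j, exists t, forall r, (unb j -> (r <= cc + n1)%N) -> gj j r <= t.
    by exists tc.
  move=> j; have [uj|uj] := pselect (unb j).
    by exists (gj j (cc + n1)%N) => r /(_ uj); apply: gj_homo.
  by have [B BP] := bnd_ex uj; exists B.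
have ep8 : 0 < ep / 8 by rewrite divr_gt0.
pose TC := n1%:R * (\sum_j (tc j - al j + Mc)).
(* The cost [TC] of the open-loop phase is fixed before [L], so a large [L] makes it negligible. *)
have [L L0 LP] := VP n2 _ ep8 (maxn 1 (Num.bound (TC / (ep / 8)))).
move: L0; rewrite geq_max => /andP[L0 LT].
have TC0 : 0 <= TC.
  rewrite mulr_ge0// sumr_ge0// => j _; apply: le_trans (_ : 1 <= _) => //.
  by apply: le_trans (gj_al j) _; rewrite 2!lerD2r tcP.
have TL : TC <= ep / 8 * L%:R.
  rewrite mulrC -ler_pdivrMr//; apply: ltW; apply: lt_le_trans (archi_boundP _) _.
    by rewrite divr_ge0// ltW.
  by rewrite ler_nat.
have [b [E [v cE]]] := cycle_program actsF xsS n10 (fun k i => zP (k, i)) L0 LP tcP TL.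
by exists b, (n1 + L)%N, E; split => //; rewrite addn_gt0 n10.
Qed.
End Fixed_weights.

(** The threshold [c1] comes before the weights, since cycles for different weights must share [cc]
    to be concatenated. For this reason [MM] bounds the weight-dependent shift in terms of the
    number of pairs. *)
Lemma scalar_program (dl ep : R) : 0 < dl -> 0 < ep -> exists c1, forall cc,
  (c1 <= cc)%N -> forall y : J -> R, (forall j, dl <= y j <= 1) ->
  exists b L E, [/\ (0 < L)%N, valid pr jk ji gj al Mc cc b L E &
  \sum_j y j * E j <= (Mc * \sum_j y j + ep) * L%:R].
Proof.
move=> dl0 ep0; pose nJ : R := #|J|%:R; have nJ0 : 0 <= nJ by [].
have Mc0 : 0 <= Mc by apply: le_trans Mc_ge1.
pose e1 := ep / 8 / (nJ + 1); have ep8 : 0 < ep / 8 by rewrite divr_gt0.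
have e10 : 0 < e1 by rewrite /e1 divr_gt0//; lra.
pose MM := Mc * nJ + e1 * nJ + e1.
have MM0 : 0 <= MM.
  have e10' := ltW e10; apply: addr_ge0 => //.
  by apply: addr_ge0; apply: mulr_ge0.
pose e3 := Num.min 1 (ep / 8 / (MM + 1)).
have e30 : 0 < e3 by rewrite lt_min ltr01/= divr_gt0//; lra.
have [ca caP] := unb_large (fun j => (MM / e3 + Mc * nJ + e1) / dl + al j).
have [cb cbP] := bnd_near e10.
exists (maxn ca cb) => cc; rewrite geq_max => /andP[cac cbc] y yP.
have Yn : \sum_j y j <= nJ.
  rewrite /nJ -sumr_const; apply: ler_sum => j _.
  by have /andP[] := yP j.
have MY : Mc * (\sum_j y j) + e1 * (\sum_j y j) + e1 <= MM.
  by rewrite /MM lerD2r; apply: lerD; rewrite ler_wpM2l ?(ltW e10).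
apply: (@fixed_weights_program y dl e1 e3 cc dl0 e10 e30 _ _ _ _ ep ep0).
- by move=> j; have /andP[] := yP j.
- by move=> j; have /andP[] := yP j.
- move=> j uj; apply: le_trans (caP cc cac j uj); rewrite lerD2r.
  rewrite ler_wpM2r ?invr_ge0 ?(ltW dl0)// 2!lerD2r.
  by rewrite ler_wpM2r// invr_ge0 ltW.
- by move=> j uj m r cm; apply: cbP => //; apply: leq_trans cm.
- by rewrite ge_min lexx.
- apply: (@le_trans _ _ (e1 * (nJ + 1))); first by rewrite ler_wpM2l ?(ltW e10)// lerD2r.
  by rewrite /e1 divfK//; apply: lt0r_neq0; lra.
- apply: (@le_trans _ _ (ep / 8 / (MM + 1) * MM)).
    apply: ler_pM => //; first exact: ltW.
      have S0 : 0 <= \sum_j y j.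
        by apply: sumr_ge0 => j _; have /andP[h _] := yP j; apply: le_trans h; apply: ltW.
      have e10' := ltW e10; apply: addr_ge0 => //.
      by apply: addr_ge0; apply: mulr_ge0.
    by rewrite ge_min lexx orbT.
  rewrite -mulrA ler_piMr ?(ltW ep8)// mulrC ler_pdivrMr; lra.
Qed.
End Scalar_program.

(** * From weighted sums to all destinations at once *)

Section Approachability.
Variables (R : realType) (J : finType) (S : set (J -> R)) (Mc dl ep : R).
Hypotheses (Mc_ge0 : 0 <= Mc) (dl0 : 0 < dl) (dl1 : dl <= 1) (ep0 : 0 < ep).
Hypothesis S_ge : forall w, S w -> forall j, - Mc <= w j.
Hypothesis S_mix : forall w v (p : nat), S w -> S v -> (0 < p)%N ->
  S (fun j => (p%:R * w j + v j) / p.+1%:R).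
Hypothesis S_scalar : forall y, (forall j, dl <= y j <= 1) ->
  exists2 v, S v & \sum_j y j * v j <= ep.
Let nJ : R := #|J|%:R.
Let eta := ep + dl * (nJ * Mc).
Let nJ0 : 0 <= nJ. Proof. by []. Qed.
Let eta0 : 0 < eta.
Proof. by rewrite /eta ltr_wpDr// !mulr_ge0// ltW. Qed.
Let pos (w : J -> R) j := Num.max (w j) 0.
Let Phi w := \sum_j pos w j ^+ 2.
Let D := (ep + nJ * Mc) / dl + Mc.

Let Phi_ge0 w : 0 <= Phi w.
Proof. by apply: sumr_ge0 => j _; rewrite sqr_ge0. Qed.

Let pos_ge0 w j : 0 <= pos w j. Proof. by rewrite le_max lexx orbT. Qed.

(* Moving from [w] towards a vector that is good for the weights [w^+ / |w^+|]
   decreases the distance to the negative orthant. *)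
Let improve w : S w -> 4 * eta ^+ 2 < Phi w -> exists2 v, S v &
  forall t, 0 <= t <= 1 -> Phi (fun j => (1 - t) * w j + t * v j) <=
    Phi w * (1 - t + t ^+ 2) + t ^+ 2 * (nJ * D ^+ 2).
Proof.
move=> Sw Pw; have P0 : 0 < Phi w by apply: le_lt_trans Pw; rewrite mulr_ge0// sqr_ge0.
pose s := Num.sqrt (Phi w); have s0 : 0 < s by rewrite sqrtr_gt0.
have s2 : s ^+ 2 = Phi w by rewrite sqr_sqrtr// ltW.
have ws j : pos w j <= s.
  rewrite -[leLHS](ger0_norm (pos_ge0 w j)) -sqrtr_sqr; apply: ler_wsqrtr.
  by rewrite /Phi (bigD1 j)//= lerDl sumr_ge0// => i _; rewrite sqr_ge0.
pose d j := pos w j / s.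
have d0 j : 0 <= d j by rewrite divr_ge0// ltW.
have d1 j : d j <= 1 by rewrite ler_pdivrMr// mul1r.
(* Clipping at [dl] keeps the weights in the range of [S_scalar]; the error is at most
   [dl * (nJ * Mc)], the second term of [eta]. *)
pose y j := Num.max dl (d j).
have y1 j : dl <= y j <= 1 by rewrite le_max lexx ge_max dl1 d1.
have y0 j : 0 < y j by have /andP[h _] := y1 j; apply: lt_le_trans h.
have [v Sv yv] := S_scalar y1; exists v => // t /andP[t0 t1].
have vD j : v j ^+ 2 <= D ^+ 2.
  have vge := S_ge Sv j.
  have D0 : Mc <= D by rewrite /D lerDr divr_ge0 ?(ltW dl0)// addr_ge0 ?mulr_ge0 ?(ltW ep0).
  have vle : v j <= D.
    have [v0|v0] := leP (v j) 0; first by apply: le_trans v0 _; apply: le_trans D0.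
    apply: (@le_trans _ _ ((ep + nJ * Mc) / dl)); last by rewrite lerDl.
    rewrite ler_pdivlMr//; apply: (@le_trans _ _ (y j * v j)).
      by rewrite mulrC ler_wpM2r ?(ltW v0)//; have /andP[] := y1 j.
    move: yv; rewrite (bigD1 j)//=.
    have : - (nJ * Mc) <= \sum_(i | i != j) y i * v i.
      have -> : - (nJ * Mc) = \sum_(i : J) - Mc.
        by rewrite sumr_const mulNrn mulr_natl.
      rewrite (bigD1 j)//= -[leRHS]add0r; apply: lerD; first by rewrite oppr_le0.
      apply: ler_sum => i _; have /andP[_ yi] := y1 i.
      apply: (@le_trans _ _ (y i * - Mc)); last by rewrite ler_wpM2l ?(ltW (y0 i))// S_ge.
      by rewrite mulrN lerN2 ler_piMl.
    lra.
  have : 0 <= (D - v j) * (D + v j) by rewrite mulr_ge0//; lra.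
  by rewrite -subr_sqr subr_ge0.
have wv : \sum_j pos w j * v j <= s * eta.
  have -> : \sum_j pos w j * v j = s * \sum_j d j * v j.
    rewrite mulr_sumr; apply: eq_bigr => j _; rewrite /d; field.
    exact: lt0r_neq0.
  rewrite ler_wpM2l ?(ltW s0)//.
  have -> : \sum_j d j * v j = \sum_j y j * v j + \sum_j (y j - d j) * - v j.
    by rewrite -big_split/=; apply: eq_bigr => j _; ring.
  apply: lerD => //; rewrite mulrA /nJ mulr_natr.
  have -> : dl *+ #|J| * Mc = \sum_(j : J) dl * Mc.
    by rewrite sumr_const mulrnAl.
  apply: ler_sum => j _.
  have yd : 0 <= y j - d j by rewrite subr_ge0 le_max lexx orbT.
  have yd' : y j - d j <= dl by rewrite lerBlDr ge_max lerDl d0 lerDr ltW.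
  apply: (@le_trans _ _ ((y j - d j) * Mc)); first by rewrite ler_wpM2l// lerNl S_ge.
  by rewrite ler_wpM2r.
apply: (@le_trans _ _ (\sum_j ((1 - t) * pos w j + t * v j) ^+ 2)).
  apply: ler_sum => j _; rewrite /pos; case: (leP _ 0) => h.
    by rewrite expr0n sqr_ge0.
  rewrite ler_sqr ?nnegrE ?(ltW h)//.
    by rewrite lerD2r ler_wpM2l ?subr_ge0// le_max lexx.
  apply: le_trans (ltW h) _.
  by rewrite lerD2r ler_wpM2l ?subr_ge0// le_max lexx.
have -> : \sum_j ((1 - t) * pos w j + t * v j) ^+ 2 =
  (1 - t) ^+ 2 * Phi w + 2 * t * (1 - t) * (\sum_j pos w j * v j) + t ^+ 2 * \sum_j v j ^+ 2.
  rewrite !mulr_sumr -!big_split/=; apply: eq_bigr => j _; ring.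
have vv : \sum_j v j ^+ 2 <= nJ * D ^+ 2.
  by rewrite /nJ mulr_natl -sumr_const; apply: ler_sum.
have h1 : t ^+ 2 * (\sum_j v j ^+ 2) <= t ^+ 2 * (nJ * D ^+ 2) by rewrite ler_wpM2l// sqr_ge0.
have h2 : 2 * t * (1 - t) * (\sum_j pos w j * v j) <= 2 * t * (1 - t) * (s * eta).
  by rewrite ler_wpM2l// !mulr_ge0// subr_ge0.
have h3 : 2 * (s * eta) <= Phi w.
  have : 0 <= (s - 2 * eta) ^+ 2 by rewrite sqr_ge0.
  rewrite sqrrB s2 exprMn; have -> : (2 : R) ^+ 2 = 4 by ring.
  have -> : s * (2 * eta) *+ 2 = 4 * (s * eta) by ring.
  by move: Pw; lra.
have h4 : 2 * t * (1 - t) * (s * eta) <= t * Phi w.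
  apply: (@le_trans _ _ (t * (2 * (s * eta)))); last by rewrite ler_wpM2l.
  rewrite [2 * t]mulrC -!mulrA ler_wpM2l// ler_wpM2l// ler_piMl//; last by lra.
  by rewrite mulr_ge0// ltW.
have -> : Phi w * (1 - t + t ^+ 2) = (1 - t) ^+ 2 * Phi w + t * Phi w by ring.
lra.
Qed.

(** A near-minimiser of [Phi] over [S] cannot lie above [4 * eta ^+ 2], since one short step of
    [improve] would go below the infimum. [S_mix] provides the steps of length [1 / (p + 1)]. *)
Lemma approachability : exists2 w, S w & forall j, w j <= 3 * eta.
Proof.
have [w0 Sw0 _] := S_scalar (y := fun=> 1) (fun j => introT andP (conj dl1 (lexx 1))).
pose E := [set Phi w | w in S].
have iE : has_inf E.
  by split; [exists (Phi w0), w0|exists 0 => _ [w _ <-]].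
set m := inf E.
have m_le w : S w -> m <= Phi w.
  by move=> Sw; apply: ge_inf; [case: iE|exists w].
have m0 : 0 <= m by apply: lb_le_inf => [|_ [w _ <-]//]; case: iE.
suff m4 : m <= 4 * eta ^+ 2.
  have e2 : 0 < eta ^+ 2 by rewrite exprn_gt0.
  have [_ [w Sw <-] Pw] := inf_adherent e2 iE.
  exists w => // j; apply: le_trans (_ : pos w j <= _); first by rewrite le_max lexx.
  have : pos w j ^+ 2 <= (3 * eta) ^+ 2.
    apply: (@le_trans _ _ (Phi w)).
      by rewrite /Phi (bigD1 j)//= lerDl sumr_ge0// => i _; rewrite sqr_ge0.
    apply: ltW; apply: lt_le_trans Pw _; rewrite -/m exprMn; have -> : (3 : R) ^+ 2 = 9 by ring.
    lra.
  by rewrite ler_sqr ?nnegrE// mulr_ge0// ltW.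
rewrite leNgt; apply/negP => m4.
have mp : 0 < m by apply: le_lt_trans m4; rewrite mulr_ge0// sqr_ge0.
pose B := nJ * D ^+ 2; have B0 : 0 <= B by rewrite mulr_ge0// sqr_ge0.
(* With this [p] the quadratic terms cost at most half of the first-order gain [t * m]; [tau] is
   chosen to take at most another quarter. *)
pose k := 2 * (m + 1 + B) / m.
have k0 : 0 < k by rewrite /k divr_gt0//; lra.
pose p := Num.bound k.
have kp : k < p%:R by apply/archi_boundP/ltW.
have p0 : (0 < p)%N by rewrite -(ltr_nat R); apply: lt_trans kp.
pose t : R := p.+1%:R^-1.
have t0 : 0 < t by rewrite invr_gt0.
have t1 : t <= 1 by rewrite invf_le1// ler1n.
have tm : t * (m + 1 + B) <= m / 2.
  rewrite /t mulrC ler_pdivrMr//.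
  have : k <= p.+1%:R by apply: ltW; apply: lt_trans kp _; rewrite ltr_nat.
  rewrite /k ler_pdivrMr//; lra.
pose tau := Num.min 1 (t * m / 4).
have tau0 : 0 < tau by rewrite lt_min ltr01/= divr_gt0// mulr_gt0.
have [_ [w Sw <-] Pw] := inf_adherent tau0 iE.
have [v Sv vP] := improve Sw (lt_le_trans m4 (m_le w Sw)).
have Sw' := S_mix Sw Sv p0.
have := m_le _ Sw'; apply/negP; rewrite -ltNge.
have -> : (fun j => (p%:R * w j + v j) / p.+1%:R) = (fun j => (1 - t) * w j + t * v j).
  apply/funext => j; rewrite /t -natr1; field; rewrite natr1; exact: lt0r_neq0.
apply: le_lt_trans (vP t _) _; first by rewrite (ltW t0) t1.
have h1 : tau <= 1 by rewrite ge_min lexx.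
have h2 : tau <= t * m / 4 by rewrite ge_min lexx orbT.
rewrite -/B; rewrite -/m in Pw.
have h3 : t ^+ 2 * (Phi w + B) <= t * (m / 2).
  rewrite expr2 -mulrA ler_wpM2l ?(ltW t0)//; apply: le_trans tm.
  by rewrite ler_wpM2l ?(ltW t0)//; lra.
have h4 : (1 - t) * Phi w <= (1 - t) * (m + tau) by rewrite ler_wpM2l ?subr_ge0// ltW.
have h5 : t * tau >= 0 by rewrite mulr_ge0// ltW.
have tm0 := mulr_gt0 t0 mp.
have -> : Phi w * (1 - t + t ^+ 2) + t ^+ 2 * B = (1 - t) * Phi w + t ^+ 2 * (Phi w + B) by ring.
apply: le_lt_trans (lerD h4 h3) _.
lra.
Qed.
End Approachability.

Section Mixing.
Variables (R : realType) (N K : nat) (G : network N K) (pr : chan_state G -> R).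
Hypothesis pr_ge0 : forall c, 0 <= pr c.
Hypothesis pr_sum1 : \sum_c pr c = 1.
Variables (J : finType) (jk : J -> 'I_K) (ji : J -> 'I_N) (gj : J -> nat -> R).
Variables (al : J -> R) (Mc : R).
Hypothesis Mc_ge1 : 1 <= Mc.
Hypothesis scalar : forall dl ep : R, 0 < dl -> 0 < ep -> exists c1, forall cc,
  (c1 <= cc)%N -> forall y : J -> R, (forall j, dl <= y j <= 1) ->
  exists b L E, [/\ (0 < L)%N, valid pr jk ji gj al Mc cc b L E &
  \sum_j y j * E j <= (Mc * \sum_j y j + ep) * L%:R].

Lemma vector_program (ep : R) : 0 < ep -> exists c1, forall cc, (c1 <= cc)%N ->
  exists b L E, [/\ (0 < L)%N, valid pr jk ji gj al Mc cc b L E &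
    forall j, E j <= (Mc + ep) * L%:R].
Proof.
move=> ep0; pose nJ : R := #|J|%:R.
have Mc0 : 0 <= Mc by apply: le_trans Mc_ge1.
have nM : 0 <= nJ * Mc by rewrite mulr_ge0.
(* This makes [dl * (nJ * Mc)] at most [ep / 6], so that three times the sum of both errors is at
   most [ep]. *)
pose dl := Num.min 1 (ep / 6 / (nJ * Mc + 1)).
have dl0 : 0 < dl by rewrite lt_min ltr01/= !divr_gt0//; lra.
have dl1 : dl <= 1 by rewrite ge_min lexx.
have ep6 : 0 < ep / 6 by rewrite divr_gt0.
have [c1 c1P] := scalar dl0 ep6; exists c1 => cc /c1P {}c1P.
pose S := [set w : J -> R | exists b L E, [/\ (0 < L)%N,
  valid pr jk ji gj al Mc cc b L E & w = fun j => E j / L%:R - Mc]].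
have [|w v p [b1 [L1 [E1 [L10 v1 ->]]]] [b2 [L2 [E2 [L20 v2 ->]]]] p0|y yP|] :=
    @approachability R J S Mc dl (ep / 6) Mc0 dl0 dl1 ep6.
- move=> _ [b [L [E [L0 [_ _ _ _ XE] ->]]]] j; rewrite -[leLHS]add0r lerD2r.
  by rewrite divr_ge0//; exact: (XE j 0%N).
(* Mixing is by time: [p * L2] copies of the first cycle and [L1] copies of the second have
   certified lengths in the ratio [p] to 1. *)
- have [m1 m1E] : exists m, (p * L2)%N = m.+1.
    by exists (p * L2).-1; rewrite prednK// muln_gt0 p0.
  have [m2 m2E] : exists m, L1 = m.+1 by exists L1.-1; rewrite prednK.
  have [b1' v1'] := valid_iter pr_ge0 pr_sum1 m1 v1.
  have [b2' v2'] := valid_iter pr_ge0 pr_sum1 m2 v2.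
  have := valid_cat pr_ge0 pr_sum1 v1' v2'; rewrite -m1E -m2E => v12.
  do 3 eexists; split; [|exact: v12|].
    by rewrite addn_gt0 !muln_gt0 p0 L10 L20.
  apply/funext => j; rewrite !natrD !natrM -natr1; field.
  have p1 : p%:R + 1 != 0 :> R by rewrite natr1 pnatr_eq0.
  have l1 : L1%:R != 0 :> R by rewrite pnatr_eq0 -lt0n.
  have l2 : L2%:R != 0 :> R by rewrite pnatr_eq0 -lt0n.
  rewrite l1 l2 p1 /= andbT.
  have -> : p%:R * L2%:R * L1%:R + L1%:R * L2%:R = (p%:R + 1) * (L1%:R * L2%:R) :> R by ring.
  by rewrite mulf_neq0// mulf_neq0.
- have [b [L [E [L0 v yE]]]] := c1P y yP.
  exists (fun j => E j / L%:R - Mc); first by exists b, L, E.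
  have Lp : 0 < L%:R :> R by rewrite ltr0n.
  have -> : \sum_j y j * (E j / L%:R - Mc) = (\sum_j y j * E j) / L%:R - Mc * \sum_j y j.
    by rewrite mulr_suml mulr_sumr -sumrB; apply: eq_bigr => j _; ring.
  by rewrite lerBlDr ler_pdivrMr// [ep / 6 + _]addrC.
- move=> _ [b [L [E [L0 v ->]]]] wP; exists b, L, E; split => // j.
  have Lp : 0 < L%:R :> R by rewrite ltr0n.
  have := wP j; rewrite lerBlDr ler_pdivrMr// => h; apply: le_trans h _.
  rewrite ler_wpM2r// addrC lerD2l.
  have : dl * (nJ * Mc) <= ep / 6.
    apply: (@le_trans _ _ (ep / 6 / (nJ * Mc + 1) * (nJ * Mc))).
      by rewrite ler_wpM2r// ge_min lexx orbT.
    by rewrite -mulrA ler_piMr ?(ltW ep6)// mulrC ler_pdivrMr; lra.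
  rewrite /nJ; lra.
Qed.
End Mixing.

(** * Costs of a sequence of cycles *)

Section Debt_recursion.
Variable R : realType.

(* A queue fed by the truncated cycle costs; its weighted squares plus the
   truncation events have a convergent sum of expectations, which replaces the
   strong law of large numbers for the dependent cycle costs. *)
Fixpoint debt (m u : nat -> R) (n : nat) : R :=
  if n is n'.+1 then Num.max 0 (debt m u n' + Num.min (u n') n'.+1%:R - m n') else 0.

Lemma eq_debt m u v n : (forall k, (k < n)%N -> u k = v k) -> debt m u n = debt m v n.
Proof.
elim: n => //= n IH uv; rewrite uv// IH// => k kn; apply: uv; exact: ltnW.
Qed.

Definition energy (w m u : nat -> R) (n : nat) : R :=
  \sum_(k < n) (w k * debt m u k ^+ 2 + (k.+1%:R < u k)%R%:R).

Lemma eq_energy w m u v n : (forall k, (k < n)%N -> u k = v k) ->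
  energy w m u n = energy w m v n.
Proof.
move=> uv; apply: eq_bigr => k _; rewrite uv//; congr (_ * _ ^+ 2 + _).
by apply: eq_debt => i ik; apply: uv; apply: ltn_trans ik _.
Qed.
End Debt_recursion.

Section Cycle_functionals.
Variables (R : realType) (N K : nat) (G : network N K) (pr : chan_state G -> R).
Hypothesis pr_ge0 : forall c, 0 <= pr c.
Hypothesis pr_sum1 : \sum_c pr c = 1.
Local Notation Echan := (Echan pr).
Variables (J : finType) (b : prog R G J) (e : pst b -> R).
Hypothesis e_ge0 : forall s, 0 <= e s.

(* Expected value of [f] at the cost accumulated when the cycle ends or after
   [n] slots. *)
Fixpoint Eend (n : nat) (f : R -> R) (s : pst b) (u : R) : R :=
  if n is n'.+1 then
    Echan (fun c => if pnxt s c is Some s' then Eend n' f s' (u + e s) else f (u + e s))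
  else f u.

Lemma Eend_le n f h s u : (forall v, 0 <= v -> f v <= h v) -> 0 <= u ->
  Eend n f s u <= Eend n h s u.
Proof.
move=> fh; elim: n s u => [|n IH] s u u0 /=; first exact: fh.
apply: Echan_le => // c _; case: (pnxt s c) => [s'|]; first by rewrite IH// addr_ge0.
by rewrite fh// addr_ge0.
Qed.

Lemma EendD n f h s u : Eend n (fun v => f v + h v) s u = Eend n f s u + Eend n h s u.
Proof.
elim: n s u => //= n IH s u; rewrite -EchanD; apply: eq_Echan => c _.
by case: (pnxt s c).
Qed.

Lemma EendZ n k f s u : Eend n (fun v => k * f v) s u = k * Eend n f s u.
Proof.
elim: n s u => //= n IH s u; rewrite -EchanZ; apply: eq_Echan => c _.
by case: (pnxt s c).
Qed.

Lemma Eend_cst n k s u : Eend n (fun=> k) s u = k.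
Proof.
elim: n s u => //= n IH s u; rewrite -[RHS](Echan_cst pr_sum1); apply: eq_Echan => c _.
by case: (pnxt s c).
Qed.

Lemma Eend_sum n (I : Type) (r : seq I) (f : I -> R -> R) s u :
  Eend n (fun v => \sum_(i <- r) f i v) s u = \sum_(i <- r) Eend n (f i) s u.
Proof.
elim: r => [|i r IH].
  rewrite big_nil -[RHS](Eend_cst n 0 s u); congr Eend.
  by apply/funext => v; rewrite big_nil.
rewrite big_cons -IH -EendD; congr Eend.
by apply/funext => v; rewrite big_cons.
Qed.

Lemma Eend_id n s u : Eend n id s u = u + Ecost pr e n s.
Proof.
elim: n s u => [|n IH] s u /=; first by rewrite addr0.
rewrite addrA -[X in _ = X + _](Echan_cst pr_sum1) -EchanD; apply: eq_Echan => c _.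
by case: (pnxt s c) => [s'|]; rewrite ?IH ?addr0.
Qed.

Lemma Eend_homo m n f s u : (forall v v', 0 <= v -> v <= v' -> f v <= f v') ->
  0 <= u -> (m <= n)%N -> Eend m f s u <= Eend n f s u.
Proof.
move=> fm; elim: m n s u => [|m IH] n s u u0; last first.
  case: n => // n mn /=; apply: Echan_le => // c _; case: (pnxt s c) => // s'.
  by apply: IH => //; rewrite addr_ge0.
move=> _; elim: n s u u0 => // n IHn s u u0 /=.
rewrite -[f u](Echan_cst pr_sum1); apply: Echan_le => // c _.
have fu : f u <= f (u + e s) by rewrite fm// lerDl.
case: (pnxt s c) => // s'; apply: le_trans fu _; apply: IHn; exact: addr_ge0.
Qed.
End Cycle_functionals.

Section Program_sequence.
Variables (R : realType) (N K : nat) (G : network N K) (pr : chan_state G -> R).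
Hypothesis pr_ge0 : forall c, 0 <= pr c.
Hypothesis pr_sum1 : \sum_c pr c = 1.
Local Notation Echan := (Echan pr).
Local Notation Ehist := (Ehist pr).
Variables (J : finType) (be : nat -> prog R G J).

Definition cfg := {i : nat & pst (be i)}.
Definition cinit : cfg := existT _ 0%N (pini (be 0%N)).
Definition cstep (q : cfg) (c : chan_state G) : cfg :=
  if pnxt (projT2 q) c is Some s' then existT _ (projT1 q) s'
  else existT _ (projT1 q).+1 (pini (be (projT1 q).+1)).
Definition crun := foldl cstep cinit.
Definition seq_policy (h : seq (chan_state G)) : action G := pact (projT2 (crun h)).

Variable j : J.
Definition ccost (q : cfg) : R := pcost j (projT2 q).

(* [us] lists the costs of the completed cycles, [cur] is the running cost *)
Record xcfg := Xcfg { xq : cfg; us : seq R; cur : R }.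
Definition xinit := Xcfg cinit [::] 0.
Definition xstep (x : xcfg) c :=
  let u := cur x + ccost (xq x) in
  if pnxt (projT2 (xq x)) c is Some _ then Xcfg (cstep (xq x) c) (us x) u
  else Xcfg (cstep (xq x) c) (rcons (us x) u) 0.
Definition xrun := foldl xstep xinit.
Definition xidx (x : xcfg) := projT1 (xq x).
Definition xok x := size (us x) = xidx x /\ 0 <= cur x.
Definition cyc_cost (n : nat) (x : xcfg) : R :=
  if (n < size (us x))%N then nth 0 (us x) n else if n == xidx x then cur x else 0.

Hypothesis cost_ge1 : forall i (s : pst (be i)), 1 <= pcost j s.

Lemma ccost_ge1 q : 1 <= ccost q.
Proof. exact: cost_ge1. Qed.

Lemma ccost_ge0 q : 0 <= ccost q.
Proof. exact: le_trans (ccost_ge1 q). Qed.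

Lemma xok_step x c : xok x -> xok (xstep x c).
Proof.
move=> [sx c0]; rewrite /xok /xidx /xstep /cstep.
case: (pnxt _ _) => [s'|] /=; first by rewrite sx addr_ge0// ccost_ge0.
by rewrite size_rcons sx.
Qed.

Lemma xok_run h : xok (xrun h).
Proof.
rewrite /xrun; elim/last_ind: h => [|h c IH]; first by [].
by rewrite foldl_rcons; apply: xok_step.
Qed.

Lemma xq_run h : xq (xrun h) = crun h.
Proof.
rewrite /xrun /crun; elim/last_ind: h => //= h c IH.
by rewrite !foldl_rcons /xstep; case: (pnxt _ _) => [s'|] /=; rewrite IH.
Qed.

Variable Eb : nat -> R.
Hypothesis Ecost_le : forall i n, Ecost pr (pcost (p:=be i) j) n (pini (be i)) <= Eb i.

Let Eb_ge0 i : 0 <= Eb i. Proof. exact: Ecost_le i 0%N. Qed.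

(** The guess is the budget [Eb n] before cycle [n] starts, the running cost plus the expected rest
    during it, and the final cost afterwards. *)
Lemma cyc_cost_mean n T : Ehist T (fun h => cyc_cost n (xrun h)) <= Eb n.
Proof.
pose Pi T (x : xcfg) := if (n < size (us x))%N then nth 0 (us x) n else
  if xidx x == n then cur x + Ecost pr (pcost (p:=be (xidx x)) j) T (projT2 (xq x)) else Eb n.
apply: le_trans (_ : Pi T xinit <= _); last first.
  by rewrite /Pi /=; case: ifPn => [/eqP <-|//]; rewrite add0r.
apply: (@Ehist_supermartingale _ _ _ pr_ge0 _ xstep xok (cyc_cost n) Pi) => //.
- by move=> q c; apply: xok_step.
- move=> x [sx c0]; rewrite /cyc_cost /Pi; case: ifPn => // _.
  by rewrite eq_sym; case: ifPn => // _ /=; rewrite addr0.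
- move=> {}T x [sx c0]; rewrite {2}/Pi; case: ifPn => [nx|nx].
    rewrite -[leRHS](Echan_cst pr_sum1); apply: Echan_le => // c _.
    rewrite /Pi /xstep; case: (pnxt _ _) => [s'|] /=; first by rewrite nx.
    by rewrite size_rcons ltnS ltnW// nth_rcons nx.
  rewrite -leqNgt sx in nx.
  case: ifPn => [/eqP nE|nE].
    rewrite /= addrA -[X in X + _](Echan_cst pr_sum1) -EchanD; apply: Echan_le => // c _.
    rewrite /Pi /xstep /xidx /cstep; case: (pnxt _ _) => [s'|] /=.
      by rewrite sx nE ltnn -nE eqxx.
    by rewrite size_rcons sx nE ltnSn nth_rcons sx nE ltnn eqxx addr0.
  have {}nx : (xidx x < n)%N by rewrite ltn_neqAle nE nx.
  rewrite -[leRHS](Echan_cst pr_sum1); apply: Echan_le => // c _.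
  rewrite /Pi /xstep /cstep; case: (pnxt _ _) => [s'|] /=.
    by rewrite sx ltnNge (ltnW nx) /= /xidx /= -/(xidx x) (negbTE nE).
  rewrite size_rcons sx ltnNge nx /= /xidx /= -/(xidx x).
  by case: eqP => [<-|//]; rewrite add0r.
Qed.

Variables (a r : nat -> R) (B : R).
Hypothesis a_ge : forall i, i.+1%:R <= a i.
Hypothesis a_homo : forall i, a i <= a i.+1.
Hypothesis r_ge : forall i T,
  2 * Eend pr (pcost (p:=be i) j) T (fun u => Num.min u i.+1%:R ^+ 2) (pini (be i)) 0 / i.+1%:R ^+ 2
   + Eb i ^+ 2 / i.+1%:R ^+ 2 <= r i.
Hypothesis r_sum : forall n, \sum_(i < n) r i <= B.
(** Summation by parts: passing from [a i] to [a i.+1] lowers [D ^+ 2 / a i ^+ 2] by [w i * D ^+ 2],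
    and these drops feed the energy. *)
Let w i := (a i ^+ 2)^-1 - (a i.+1 ^+ 2)^-1.

Let a0 i : 0 < a i. Proof. by apply: lt_le_trans (a_ge i). Qed.

Let w_ge0 i : 0 <= w i.
Proof.
by rewrite subr_ge0 lef_pV2 ?posrE ?exprn_gt0// ler_pXn2r// nnegrE ltW.
Qed.

Definition xenergy (x : xcfg) := energy w Eb (nth 0 (us x)) (size (us x)).

Let next_debt i D u := Num.max 0 (D + Num.min u i.+1%:R - Eb i).
Let fcyc i D u := next_debt i D u ^+ 2 / a i.+1 ^+ 2 + (i.+1%:R < u)%R%:R.

(** Taking the positive part does not increase the square. The cross term has nonpositive mean
    because the truncated cost has mean at most [Eb i]. The truncation event is bounded by the
    truncated second moment once more, whence the factor 2 in [r_ge]. *)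
Let fcyc_mean i D T : 0 <= D ->
  Eend pr (pcost (p:=be i) j) T (fcyc i D) (pini (be i)) 0 <= D ^+ 2 / a i.+1 ^+ 2 + r i.
Proof.
move=> D0; set A := a i.+1 ^+ 2; set b2 : R := i.+1%:R ^+ 2.
have A0 : 0 < A by rewrite exprn_gt0.
have b20 : 0 < b2 by rewrite exprn_gt0.
have bA : b2 <= A.
  rewrite ler_pXn2r// ?nnegrE// ?(ltW (a0 _))//; apply: le_trans (a_ge i.+1).
  by rewrite ler_nat.
pose mn u := Num.min u (i.+1%:R : R).
apply: (@le_trans _ _ (Eend pr (pcost (p:=be i) j) T (fun u =>
   ((D ^+ 2 + Eb i ^+ 2) / A - 2 * D * Eb i / A) + (2 * D / A * u + 2 / b2 * mn u ^+ 2 + Eb i ^+ 2 * 0))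
   (pini (be i)) 0)).
  apply: Eend_le => // [s|u u0]; first exact: le_trans (cost_ge1 s).
  have mu : mn u <= u by rewrite ge_min lexx.
  have m0 : 0 <= mn u by rewrite le_min u0 ler0n.
  have h1 : next_debt i D u ^+ 2 <= (D + mn u - Eb i) ^+ 2.
    rewrite /next_debt -/(mn u); case: (leP 0) => // _; by rewrite expr0n sqr_ge0.
  have h2 : (i.+1%:R < u)%R%:R <= mn u ^+ 2 / b2.
    case: ltP => [iu|_]; last by rewrite divr_ge0 ?sqr_ge0// ltW.
    have b2n : b2 != 0 by apply: lt0r_neq0.
    by rewrite /mn min_r ?(ltW iu)// -/b2 divff.
  have h3 : (D + mn u - Eb i) ^+ 2 / A <=
     (D ^+ 2 + Eb i ^+ 2) / A - 2 * D * Eb i / A + 2 * D / A * u + mn u ^+ 2 / b2.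
    have h5 : mn u ^+ 2 / A <= mn u ^+ 2 / b2.
      by rewrite ler_wpM2l ?sqr_ge0// lef_pV2.
    have h6 : 2 * D / A * mn u <= 2 * D / A * u.
      by rewrite ler_wpM2l// divr_ge0 ?mulr_ge0// ltW.
    have h7 : 0 <= 2 * mn u * Eb i / A by rewrite divr_ge0 ?mulr_ge0// ltW.
    have -> : (D + mn u - Eb i) ^+ 2 / A = (D ^+ 2 + Eb i ^+ 2) / A - 2 * D * Eb i / A
       + 2 * D / A * mn u + mn u ^+ 2 / A - 2 * mn u * Eb i / A by ring.
    lra.
  have h4 : next_debt i D u ^+ 2 / A <= (D + mn u - Eb i) ^+ 2 / A.
    by rewrite ler_wpM2r// invr_ge0 ltW.
  have -> : 2 / b2 * mn u ^+ 2 = mn u ^+ 2 / b2 + mn u ^+ 2 / b2 by ring.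
  rewrite /fcyc -/A; lra.
rewrite EendD Eend_cst// EendD EendD !EendZ Eend_cst// mulr0 addr0.
have Xi : Eend pr (pcost (p:=be i) j) T (fun u => u) (pini (be i)) 0 <= Eb i.
  by have := Eend_id pr_sum1 (pcost (p:=be i) j) T (pini (be i)) 0; rewrite add0r => ->.
set X := Eend _ _ _ _ _ _ in Xi *; set Y := Eend _ _ _ _ _ _.
have h1 : 2 * D / A * X <= 2 * D / A * Eb i.
  by rewrite ler_wpM2l// divr_ge0 ?mulr_ge0// ltW.
have h2 : Eb i ^+ 2 / A <= Eb i ^+ 2 / b2 by rewrite ler_wpM2l ?sqr_ge0// lef_pV2.
have := r_ge i T; rewrite -/Y -/b2.
have -> : 2 * Y / b2 = 2 / b2 * Y by ring.
have -> : (D ^+ 2 + Eb i ^+ 2) / A = D ^+ 2 / A + Eb i ^+ 2 / A by ring.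
have -> : 2 * D * Eb i / A = 2 * D / A * Eb i by ring.
lra.
Qed.

(** The potential consists of the energy so far, the pending term of the current cycle, the mean of
    its outcome and the unspent part [Rest] of [B]; [fcyc_mean] carries it from one cycle to the
    next. *)
Lemma energy_mean T : Ehist T (fun h => xenergy (xrun h)) <= B.
Proof.
pose Rest i := B - \sum_(k < i) r k.
have Rest0 i : 0 <= Rest i by rewrite subr_ge0.
have RestS i : Rest i = Rest i.+1 + r i by rewrite /Rest big_ord_recr/=; ring.
pose D x := debt Eb (nth 0 (us x)) (size (us x)).
pose Pi T (x : xcfg) := xenergy x + w (xidx x) * D x ^+ 2 +
  Eend pr (pcost (p:=be (xidx x)) j) T (fcyc (xidx x) (D x)) (projT2 (xq x)) (cur x)
  + Rest (xidx x).+1.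
have f0 i d u : 0 <= fcyc i d u.
  by rewrite addr_ge0// divr_ge0 ?sqr_ge0// ltW// exprn_gt0.
apply: le_trans (_ : Pi T xinit <= _); last first.
  rewrite /Pi /xenergy /energy big_ord0 /D /= expr0n mulr0 !add0r.
  have := @fcyc_mean 0%N 0 T (lexx 0); rewrite expr0n mul0r add0r => h.
  by have := RestS 0%N; rewrite {1}/Rest big_ord0 subr0; rewrite /xidx /=; lra.
apply: (@Ehist_supermartingale _ _ _ pr_ge0 _ xstep xok xenergy Pi) => //.
- by move=> q c; apply: xok_step.
- move=> x _; rewrite /Pi -addrA -addrA lerDl; apply: addr_ge0.
    exact: (mulr_ge0 (w_ge0 _) (sqr_ge0 _)).
  exact: (addr_ge0 (f0 _ _ _) (Rest0 _)).
- move=> {}T x [sx c0]; rewrite {2}/Pi.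
  set i := xidx x; set d := D x.
  rewrite /= addrAC -[X in X + _](Echan_cst pr_sum1) -EchanD.
  apply: Echan_le => // c _.
  rewrite /Pi /xstep /cstep.
  case: (pnxt _ _) => [s'|] /=; first by rewrite -/i /xenergy /D /= -/(D x) -/d; lra.
  rewrite /xidx /= -/(xidx x) -/i.
  set u := cur x + ccost (xq x).
  have nthE k : (k < size (us x))%N -> nth 0 (rcons (us x) u) k = nth 0 (us x) k.
    by move=> kx; rewrite nth_rcons kx.
  have nthi : nth 0 (rcons (us x) u) i = u by rewrite nth_rcons sx ltnn eqxx.
  have DE k : (k <= size (us x))%N -> debt Eb (nth 0 (rcons (us x) u)) k = debt Eb (nth 0 (us x)) k.
    by move=> kx; apply: eq_debt => l lk; apply: nthE; apply: leq_trans lk kx.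
  have -> : D (Xcfg (existT _ i.+1 (pini (be i.+1))) (rcons (us x) u) 0) = next_debt i d u.
    by rewrite /D /= size_rcons sx /= -/i nthi DE ?sx// /next_debt /d /D sx.
  have -> : xenergy (Xcfg (existT _ i.+1 (pini (be i.+1))) (rcons (us x) u) 0) =
     xenergy x + w i * d ^+ 2 + (i.+1%:R < u)%R%:R.
    rewrite /xenergy /energy /= size_rcons big_ord_recr /= -addrA; congr (_ + _).
      by apply: eq_energy => k kx; exact: nthE.
    by rewrite DE// sx -/i nthi /d /D sx.
  have := @fcyc_mean i.+1 (next_debt i d u) T _.
  rewrite /next_debt le_max lexx => /(_ isT); rewrite -/(next_debt i d u).
  set Kv := Eend _ _ _ _ _ _ => KvP.
  have wE : w i.+1 * next_debt i d u ^+ 2 =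
    next_debt i d u ^+ 2 / a i.+1 ^+ 2 - next_debt i d u ^+ 2 / a i.+2 ^+ 2.
    by rewrite /w mulrBl mulrC [_^-1 * _]mulrC.
  rewrite /fcyc (RestS i.+1) wE; lra.
Qed.
End Program_sequence.

(** * From bounded energy to pathwise averages *)

Section Debt_asymptotics.
Variables (R : realType) (m u a : nat -> R) (B C : R).
Hypothesis a_ge : forall i, i.+1%:R <= a i.
Hypothesis a_homo : forall i, a i <= a i.+1.
Hypothesis C0 : 0 < C.
Hypothesis mC : forall i, m i <= C * (a i.+1 - a i).
Let w i := (a i ^+ 2)^-1 - (a i.+1 ^+ 2)^-1.
Hypothesis energyB : forall n, energy w m u n <= B.
Local Notation D := (debt m u).

Let a0 i : 0 < a i. Proof. by apply: lt_le_trans (a_ge i). Qed.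

Let w_ge0 i : 0 <= w i.
Proof. by rewrite subr_ge0 lef_pV2 ?posrE ?exprn_gt0// ler_pXn2r// nnegrE ltW. Qed.

Let t k := w k * D k ^+ 2 + (k.+1%:R < u k)%R%:R.
Let t_ge0 k : 0 <= t k.
Proof. by rewrite addr_ge0// mulr_ge0 ?sqr_ge0. Qed.

Let tail (d : R) : 0 < d -> exists n0, forall n p, (n0 <= n)%N ->
  \sum_(n <= k < p) t k < d.
Proof.
move=> d0; pose S := range (fun n => energy w m u n).
have sS : has_sup S by split; [exists (energy w m u 0), 0%N|exists B => _ [n _ <-]].
have [_ [n0 _ <-] Hn0] := sup_adherent d0 sS.
exists n0 => n p n0n.
have [np|pn] := leqP n p; last by rewrite big_geq// ltnW.
have Ep : energy w m u p <= sup S by apply: ub_le_sup; [case: sS|exists p].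
have Ehist q : energy w m u q = \sum_(0 <= k < q) t k by rewrite big_mkord.
have : energy w m u n0 + \sum_(n <= k < p) t k <= energy w m u p.
  have n0p : (n0 <= p)%N by apply: leq_trans np.
  rewrite !Ehist [leRHS](big_cat_nat (leq0n n0) n0p)/= lerD2l.
  by rewrite [leRHS](big_cat_nat n0n np)/= lerDr sumr_ge0.
by move: Hn0 Ep; lra.
Qed.

Hypothesis u_ge0 : forall n, 0 <= u n.

Let debt_slow n p : (n <= p)%N -> D n - C * (a p - a n) <= D p.
Proof.
elim: p => [|p IH]; first by rewrite leqn0 => /eqP ->; rewrite subrr mulr0 subr0.
rewrite leq_eqVlt => /predU1P[->|]; first by rewrite subrr mulr0 subr0.
rewrite ltnS => /IH h; rewrite /= le_max; apply/orP; right.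
have h1 := mC p.
have h2 : 0 <= Num.min (u p) p.+1%:R by rewrite le_min u_ge0 ler0n.
have : C * (a p.+1 - a n) = C * (a p.+1 - a p) + C * (a p - a n) by ring.
lra.
Qed.

Let a_le n p : (n <= p)%N -> a n <= a p.
Proof. by apply: (homo_leq (r := fun x y => x <= y)) => // x y z; apply: le_trans. Qed.

(** The debt falls by at most [C] times the growth of [a]. If it exceeded [e * a n], it would stay
    above half of that until [a] has grown by the factor [th]; over this stretch the weights [w] sum
    to a fixed fraction of [(a n ^+ 2)^-1], and the energy would gain at least [d], which its tail
    forbids. *)
Lemma debt_small (e : R) : 0 < e -> exists n0, forall n, (n0 <= n)%N -> D n <= e * a n.
Proof.
move=> e0; pose th := 1 + e / (2 * C).
have th1 : 1 < th by rewrite ltrDl divr_gt0// mulr_gt0.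
have th0 : 0 < th by apply: lt_trans th1.
pose d := e ^+ 2 / 4 * (1 - (th ^+ 2)^-1).
have d0 : 0 < d.
  rewrite mulr_gt0 ?divr_gt0 ?exprn_gt0// subr_gt0 invf_lt1 ?exprn_gt0//.
  by rewrite expr_gt1// ltW.
have [n0 n0P] := tail d0; exists n0 => n n0n; rewrite leNgt; apply/negP => Dn.
have ex : exists p, th * a n < a p.
  exists (Num.bound (th * a n)); apply: lt_le_trans (a_ge _).
  apply: lt_trans (archi_boundP _) _; first by rewrite mulr_ge0// ltW.
  by rewrite ltr_nat.
case: (ex_minnP ex) => p pP pmin.
have np : (n <= p)%N.
  rewrite leqNgt; apply/negP => pn; have := a_le (ltnW pn).
  apply/negP; rewrite -ltNge; apply: le_lt_trans pP.
  by rewrite ler_peMl// ltW.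
have := n0P n p n0n; apply/negP; rewrite -leNgt.
have wk k : (n <= k < p)%N -> (e * a n / 2) ^+ 2 * w k <= t k.
  move=> /andP[nk kp]; rewrite /t -[leLHS]addr0 lerD// mulrC ler_wpM2l//.
  have ak : a k <= th * a n.
    by rewrite leNgt; apply/negP => /pmin; rewrite leqNgt kp.
  have Dk : e * a n / 2 <= D k.
    apply: le_trans (debt_slow nk).
    have : C * (a k - a n) <= C * (e / (2 * C) * a n).
      by rewrite ler_wpM2l ?(ltW C0)//; move: ak; rewrite /th mulrDl mul1r; lra.
    have -> : C * (e / (2 * C) * a n) = e * a n / 2.
      by field; exact: lt0r_neq0.
    lra.
  have ea : 0 <= e * a n / 2 by rewrite divr_ge0// mulr_ge0// ltW.
  by rewrite ler_sqr// nnegrE// (le_trans ea).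
apply: (@le_trans _ _ (\sum_(n <= k < p) (e * a n / 2) ^+ 2 * w k)); last first.
  by rewrite big_nat_cond [leRHS]big_nat_cond; apply: ler_sum => k; rewrite andbT; apply: wk.
rewrite -mulr_sumr.
have -> : \sum_(n <= k < p) w k = (a n ^+ 2)^-1 - (a p ^+ 2)^-1.
  have := telescope_sumr (fun k => - (a k ^+ 2)^-1) np.
  by rewrite opprK addrC => <-; apply: eq_bigr => k _; rewrite opprK addrC.
have -> : (e * a n / 2) ^+ 2 * ((a n ^+ 2)^-1 - (a p ^+ 2)^-1) =
   e ^+ 2 / 4 * (1 - (a n / a p) ^+ 2).
  by field; rewrite !lt0r_neq0.
rewrite /d ler_wpM2l ?divr_ge0 ?sqr_ge0// lerD2l lerN2 -exprVn.
have q : a n / a p <= th^-1.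
  by rewrite ler_pdivrMr// -ler_pdivrMl ?invr_gt0// invrK ltW.
have q0 : 0 <= a n / a p by apply: divr_ge0; apply: ltW.
by rewrite ler_sqr// nnegrE (le_trans q0).
Qed.

Lemma eventually_small_cost : exists n0, forall k, (n0 <= k)%N -> u k <= k.+1%:R.
Proof.
have [n0 n0P] := tail (@ltr01 R); exists n0 => k n0k.
rewrite leNgt; apply/negP => uk; have := n0P k k.+1 n0k.
by rewrite big_nat1 /t uk /= gtrDr ltNge mulr_ge0// sqr_ge0.
Qed.

Lemma sum_trunc_le_debt n :
  \sum_(k < n) Num.min (u k) k.+1%:R <= D n + \sum_(k < n) m k.
Proof.
elim: n => [|n IH]; first by rewrite !big_ord0 addr0.
rewrite !big_ord_recr/=.
have : D n + Num.min (u n) n.+1%:R - m n <= D n.+1 by rewrite /= le_max lexx orbT.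
by move: IH => /=; lra.
Qed.

(** Truncation matters in finitely many cycles only, and truncated costs are at most debt plus
    budgets. Of the four quarters of [e], two pay for the debt, as [a n.+1 <= 2 * a n], one for the
    budgets and one for the exceptional cycles. *)
Lemma path_bound (Mc e : R) :
  (forall e : R, 0 < e -> exists n0, forall n, (n0 <= n)%N ->
    \sum_(k < n.+1) m k <= (Mc + e) * a n) ->
  (exists n0, forall n, (n0 <= n)%N -> a n.+1 <= 2 * a n) ->
  0 < e -> exists n0, forall n, (n0 <= n)%N -> \sum_(k < n.+1) u k <= (Mc + e) * a n.
Proof.
move=> Hm [na naP] e0; have e4 : 0 < e / 4 by rewrite divr_gt0.
have [nm nmP] := Hm _ e4; have [nd ndP] := debt_small e4.
have [nu nuP] := eventually_small_cost.
pose Cst := \sum_(k < nu) u k; have Cst0 : 0 <= Cst by apply: sumr_ge0.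
have uC n : \sum_(k < n) u k <= \sum_(k < n) Num.min (u k) k.+1%:R + Cst.
  have mu k : 0 <= Num.min (u k) k.+1%:R by rewrite le_min u_ge0 ler0n.
  have [nnu|nun] := leqP n nu.
    rewrite /Cst -(subnKC nnu) big_split_ord/= addrCA lerDl addr_ge0//; apply: sumr_ge0 => k _ //.
  rewrite -(subnKC (ltnW nun)) !big_split_ord/= -/Cst [leLHS]addrC lerD2r.
  apply: (@le_trans _ _ (\sum_(i < n - nu) Num.min (u (nu + i)%N) (nu + i).+1%:R)).
    by apply: ler_sum => i _; rewrite le_min lexx nuP// leq_addr.
  by rewrite lerDr; apply: sumr_ge0.
pose nc := Num.bound (Cst / (e / 4)).
exists (maxn (maxn na nm) (maxn nd nc)) => n; rewrite !geq_max => /andP[/andP[h1 h2] /andP[h3 h4]].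
have hc : Cst <= e / 4 * a n.
  rewrite -ler_pdivrMl// mulrC; apply: le_trans (a_ge n).
  apply: ltW; apply: lt_trans (archi_boundP _) _; first by rewrite divr_ge0// ltW.
  by rewrite ltr_nat ltnS.
have h5 := uC n.+1; have h6 := sum_trunc_le_debt n.+1.
have h7 := ndP n.+1 (leqW h3); have h8 := nmP n h2.
have h9 : e / 4 * a n.+1 <= e / 4 * (2 * a n) by rewrite ler_wpM2l ?(ltW e4)// naP.
lra.
Qed.
End Debt_asymptotics.

(** * Series estimates and the slowly improving schedule *)

Section Series_tools.
Variable R : realType.

Lemma bounded_series_tail (f : nat -> R) (B : R) : (forall i, 0 <= f i) ->
  (forall n, \sum_(i < n) f i <= B) -> forall d, 0 < d ->
  exists n0, forall n p, (n0 <= n)%N -> \sum_(n <= k < p) f k < d.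
Proof.
move=> f0 fB d d0; pose S := range (fun n => \sum_(i < n) f i).
have sS : has_sup S.
  by split; [exists (\sum_(i < 0) f i), 0%N|exists B => _ [n _ <-]].
have [_ [n0 _ <-] Hn0] := sup_adherent d0 sS.
exists n0 => n p n0n.
have [np|pn] := leqP n p; last by rewrite big_geq// ltnW.
have Ep : \sum_(i < p) f i <= sup S by apply: ub_le_sup; [case: sS|exists p].
have n0p : (n0 <= p)%N by apply: leq_trans np.
have : \sum_(i < n0) f i + \sum_(n <= k < p) f k <= \sum_(i < p) f i.
  rewrite -!(big_mkord xpredT) [leRHS](big_cat_nat (leq0n n0) n0p)/= lerD2l.
  by rewrite [leRHS](big_cat_nat n0n np)/= lerDr sumr_ge0.
by move: Hn0 Ep; lra.
Qed.

Lemma geometric_half n : \sum_(k < n) (2^-1 : R) ^+ k <= 2.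
Proof.
suff -> : \sum_(k < n) (2^-1 : R) ^+ k = 2 - 2 * 2^-1 ^+ n.
  by rewrite gerBl mulr_ge0// exprn_ge0.
elim: n => [|n IH]; first by rewrite big_ord0 expr0; ring.
by rewrite big_ord_recr/= IH exprS; field.
Qed.

Lemma inv_sq_sum n : \sum_(k < n) (k.+1%:R ^+ 2)^-1 <= 2 :> R.
Proof.
suff : \sum_(k < n.+1) (k.+1%:R ^+ 2)^-1 <= 2 - n.+1%:R^-1 :> R.
  rewrite big_ord_recr/= => h; apply: le_trans (_ : _ <= 2 - n.+1%:R^-1) _.
    by apply: le_trans h; rewrite lerDl invr_ge0 exprn_ge0.
  by rewrite gerBl invr_ge0.
elim: n => [|n IH]; first by rewrite big_ord1 expr1n invr1; lra.
rewrite big_ord_recr/=; apply: le_trans (lerD IH (lexx _)) _.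
have n1 : 0 < n.+1%:R :> R by [].
have n2 : n.+2%:R = n.+1%:R + 1 :> R by rewrite natr1.
rewrite n2; set x : R := n.+1%:R in n1 *.
have : (x + 1)^-1 + ((x + 1) ^+ 2)^-1 <= x^-1.
  rewrite -subr_ge0.
  have -> : x^-1 - ((x + 1)^-1 + ((x + 1) ^+ 2)^-1) = (x * (x + 1) ^+ 2)^-1.
    by field; apply/andP; split; apply: lt0r_neq0; lra.
  by rewrite invr_ge0 mulr_ge0 ?sqr_ge0// ltW.
by move: (x + 1)^-1 ((x + 1) ^+ 2)^-1 x^-1 => p q r; lra.
Qed.

(** [Num.min u x] is at most [2 * u * x / (u + x)], which compares the terms with increments of a
    telescoping sum. *)
Lemma trunc_sq_sum (u : R) n : 0 <= u ->
  \sum_(k < n) Num.min u k.+1%:R ^+ 2 / k.+1%:R ^+ 2 <= 4 * u.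
Proof.
rewrite le_eqVlt => /predU1P[<-|u0].
  by rewrite mulr0 big1// => k _; rewrite min_l// expr0n mul0r.
suff : \sum_(k < n) Num.min u k.+1%:R ^+ 2 / k.+1%:R ^+ 2 <=
    4 * u ^+ 2 * (u^-1 - (u + n%:R)^-1).
  move=> h; apply: le_trans h _; rewrite mulrBr.
  apply: (@le_trans _ _ (4 * u ^+ 2 / u)).
    rewrite gerBl; apply: mulr_ge0; first by rewrite mulr_ge0 ?sqr_ge0.
    by rewrite invr_ge0 addr_ge0// ltW.
  by rewrite expr2 mulrA mulfK// lt0r_neq0.
elim: n => [|n IH]; first by rewrite big_ord0 addr0 subrr mulr0.
rewrite big_ord_recr/=; apply: le_trans (lerD IH (lexx _)) _.
have n0 : 0 <= n%:R :> R by [].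
rewrite -[n.+1%:R]natr1; set x : R := n%:R in n0 *.
have ux : 0 < u + x by lra.
have ux1 : 0 < u + x + 1 by lra.
have x1 : 0 < x + 1 by lra.
have -> : u + (x + 1) = u + x + 1 by ring.
suff : Num.min u (x + 1) ^+ 2 / (x + 1) ^+ 2 <= 4 * u ^+ 2 / ((u + x) * (u + x + 1)).
  have -> : 4 * u ^+ 2 / ((u + x) * (u + x + 1)) = 4 * u ^+ 2 * ((u + x)^-1 - (u + x + 1)^-1).
    by field; rewrite !lt0r_neq0.
  lra.
rewrite ler_pdivrMr ?exprn_gt0// mulrAC ler_pdivlMr ?mulr_gt0//.
case: (leP u (x + 1)) => h.
  have -> : 4 * u ^+ 2 * (x + 1) ^+ 2 = u ^+ 2 * ((2 * (x + 1)) * (2 * (x + 1))) by ring.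
  by rewrite ler_wpM2l ?sqr_ge0//; apply: ler_pM; lra.
have -> : 4 * u ^+ 2 * (x + 1) ^+ 2 = (x + 1) ^+ 2 * ((2 * u) * (2 * u)) by ring.
by rewrite ler_wpM2l ?sqr_ge0//; apply: ler_pM; lra.
Qed.

Lemma slow_schedule (f : nat -> nat -> R) (B : nat -> R) :
  (forall k i, 0 <= f k i) -> (forall k n, \sum_(i < n) f k i <= B k) ->
  exists k : nat -> nat, [/\ forall i j, (i <= j)%N -> (k i <= k j)%N,
    forall m, exists n, forall i, (n <= i)%N -> (m <= k i)%N &
    exists C, forall n, \sum_(i < n) f (k i) i <= C].
Proof.
move=> f0 fB.
have /choice[T TP] k : exists n0, forall n p, (n0 <= n)%N ->
    \sum_(n <= i < p) f k i < 2^-1 ^+ k.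
  by apply: bounded_series_tail (f0 k) (fB k) _ _; rewrite exprn_gt0.
pose kk i := (\max_(k < i.+1 | T k <= i) k)%N.
have kkT i : (0 < kk i)%N -> (T (kk i) <= i)%N.
  rewrite /kk; elim/big_ind: _ => // x y hx hy.
  by rewrite /maxn; case: ifP.
exists kk; split.
- move=> i j ij; apply/bigmax_leqP => k Tk.
  have kj : (k < j.+1)%N by apply: leq_trans (ltn_ord k) _; rewrite ltnS.
  apply: (@leq_bigmax_cond _ (fun k : 'I_j.+1 => T k <= j)%N (fun k => val k) (Ordinal kj)).
  exact: leq_trans Tk ij.
- move=> m; exists (maxn m (T m)) => i; rewrite geq_max => /andP[mi Tm].
  have mi' : (m < i.+1)%N by rewrite ltnS.
  exact: (@leq_bigmax_cond _ (fun k : 'I_i.+1 => T k <= i)%N (fun k => val k) (Ordinal mi')).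
exists (B 0%N + 2) => n.
have kn i : (i < n)%N -> (kk i < n)%N.
  by move=> i_n; apply: leq_ltn_trans i_n; apply/bigmax_leqP => k _; rewrite -ltnS.
have -> : \sum_(i < n) f (kk i) i = \sum_(k < n) \sum_(i < n | kk i == k) f k i.
  rewrite [RHS](exchange_big_dep xpredT)//=; apply: eq_bigr => i _.
  rewrite (big_pred1 (Ordinal (kn i (ltn_ord i))))//.
have hk (k : nat) : (0 < k)%N -> \sum_(i < n | kk i == k) f k i <= 2^-1 ^+ k.
  move=> k0; apply: le_trans (ltW (TP k (T k) n (leqnn _))).
  have [Tn|nT] := leqP (T k) n; last first.
    rewrite big_geq ?(ltnW nT)// big_pred0// => i; apply/negP => /eqP ki.
    have := kkT i; rewrite ki => /(_ k0); rewrite leqNgt => /negP; apply.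
    exact: ltn_trans (ltn_ord i) nT.
  rewrite -(big_mkord (fun i => kk i == k) (f k)) (big_cat_nat (leq0n (T k)) Tn)/=.
  rewrite big_nat_cond big_pred0 ?add0r.
    by rewrite big_mkcond/=; apply: ler_sum => i _; case: ifP.
  move=> i; apply/negP => /andP[/andP[_ iT] /eqP ki].
  by have := kkT i; rewrite ki => /(_ k0); rewrite leqNgt iT.
case: n kn hk => [|n] kn hk; first by have := fB 0%N 0%N; rewrite !big_ord0 => B0; rewrite addr_ge0.
rewrite big_ord_recl/=; apply: lerD.
  apply: le_trans (fB 0%N n.+1); rewrite [leLHS]big_mkcond/=.
  by apply: ler_sum => i _; case: ifP.
apply: le_trans (geometric_half n.+1); rewrite big_ord_recl/= expr0.
apply: le_trans (_ : \sum_(i < n) 2^-1 ^+ i.+1 <= _); last by rewrite lerDr.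
by apply: ler_sum => i _; apply: hk.
Qed.
End Series_tools.

Section Schedule.
Variables (R : realType) (N K : nat) (G : network N K) (pr : chan_state G -> R).
Hypothesis pr_ge0 : forall c, 0 <= pr c.
Hypothesis pr_sum1 : \sum_c pr c = 1.
Variables (J : finType) (jk : J -> 'I_K) (ji : J -> 'I_N) (gj : J -> nat -> R).
Variables (al : J -> R) (Mc : R).
Hypothesis Mc_ge1 : 1 <= Mc.
Hypothesis vector : forall ep : R, 0 < ep -> exists c1, forall cc, (c1 <= cc)%N ->
  exists b L E, [/\ (0 < L)%N, valid pr jk ji gj al Mc cc b L E &
    forall j, E j <= (Mc + ep) * L%:R].

Definition trunc_sq i u : R := Num.min u i.+1%:R ^+ 2.
Definition kap (b : prog R G J) j i :=
  sup (range (fun T => Eend pr (pcost (p:=b) j) T (trunc_sq i) (pini b) 0)).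

Lemma trunc_sq_homo i u v : 0 <= u -> u <= v -> trunc_sq i u <= trunc_sq i v.
Proof.
move=> u0 uv; have v0 := le_trans u0 uv.
have h x : 0 <= x -> 0 <= Num.min x (i.+1%:R : R) by move=> x0; rewrite le_min x0 ler0n.
rewrite /trunc_sq ler_sqr ?nnegrE; [|exact: h|exact: h].
by rewrite le_min !ge_min uv lexx orbT.
Qed.

Lemma trunc_sq_le i u : 0 <= u -> trunc_sq i u <= i.+1%:R ^+ 2.
Proof.
move=> u0; rewrite /trunc_sq ler_sqr ?nnegrE ?ler0n//.
  by rewrite ge_min lexx orbT.
by rewrite le_min u0 ler0n.
Qed.

Section One_program.
Variables (b : prog R G J) (j : J) (E : R).
Hypothesis cost0 : forall s : pst b, 0 <= pcost j s.
Hypothesis XE : forall n, Ecost pr (pcost (p:=b) j) n (pini b) <= E.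

Lemma kap_ge T i : Eend pr (pcost (p:=b) j) T (trunc_sq i) (pini b) 0 <= kap b j i.
Proof.
apply: ub_le_sup; last by exists T.
exists (i.+1%:R ^+ 2) => _ [n _ <-].
rewrite -[leRHS](Eend_cst pr_sum1 (pcost (p:=b) j) n _ (pini b) 0).
by apply: Eend_le => // v; apply: trunc_sq_le.
Qed.

(** The classical estimate behind the strong law: truncation at [i.+1] makes the weighted second
    moments summable under a finite mean alone. *)
Lemma kap_sum n : \sum_(i < n) kap b j i / i.+1%:R ^+ 2 <= 4 * E.
Proof.
have -> : \sum_(i < n) kap b j i / i.+1%:R ^+ 2 =
    \sum_(i < n) (i.+1%:R ^+ 2)^-1 * kap b j i.
  by apply: eq_bigr => i _; rewrite mulrC.
apply: (sup_sum_le (f := fun (i : 'I_n) T => Eend pr (pcost (p:=b) j) T (trunc_sq i) (pini b) 0)).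
- by move=> i; rewrite invr_ge0 exprn_ge0.
- move=> i m p mp; apply: Eend_homo => // v v'; exact: trunc_sq_homo.
- move=> i _; exists (kap b j i) => T; exact: kap_ge.
move=> T; under eq_bigr do rewrite -EendZ.
rewrite -Eend_sum//; apply: (@le_trans _ _ (Eend pr (pcost (p:=b) j) T (fun v => 4 * v) (pini b) 0)).
  apply: Eend_le => // v v0; apply: le_trans (trunc_sq_sum n v0).
  by apply: ler_sum => i _; rewrite mulrC.
rewrite EendZ ler_wpM2l//.
by have := Eend_id pr_sum1 (pcost (p:=b) j) T (pini b) 0; rewrite add0r => ->.
Qed.
End One_program.

Lemma program_schedule (c : nat) : exists (be : nat -> prog R G J) (cs Ls : nat -> nat)
    (E : nat -> J -> R) (r : nat -> R) (B : R),
  [/\ forall i, (0 < Ls i)%N /\ valid pr jk ji gj al Mc (cs i) (be i) (Ls i) (E i),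
      (c <= cs 0)%N /\ forall i, (cs i <= cs i.+1)%N,
      forall ep : R, 0 < ep -> exists n, forall i, (n <= i)%N -> forall j,
        E i j <= (Mc + ep) * (Ls i)%:R,
      forall i j T, 2 * Eend pr (pcost (p:=be i) j) T (trunc_sq i) (pini (be i)) 0 / i.+1%:R ^+ 2
        + E i j ^+ 2 / i.+1%:R ^+ 2 <= r i /\ E i j <= (Mc + 1) * (Ls i)%:R &
      (forall n, \sum_(i < n) r i <= B) /\
      forall ep : R, 0 < ep -> exists n, forall i, (n <= i)%N -> (Ls i)%:R <= ep * i.+1%:R].
Proof.
have /choice[c1 c1P] k : exists c1, forall cc, (c1 <= cc)%N -> exists b L E, [/\ (0 < L)%N,
    valid pr jk ji gj al Mc cc b L E & forall j, E j <= (Mc + k.+1%:R^-1) * L%:R].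
  by apply: vector; rewrite invr_gt0.
(* [cc] increases with [k], so that the ages left by one program are admissible for the next. *)
pose cc k := (c + \sum_(l < k.+1) c1 l)%N.
have /choice[bLE bLEP] k : exists x : prog R G J * nat * (J -> R), [/\ (0 < x.1.2)%N,
    valid pr jk ji gj al Mc (cc k) x.1.1 x.1.2 x.2 &
    forall j, x.2 j <= (Mc + k.+1%:R^-1) * x.1.2%:R].
  have [|b [L [E h]]] := c1P k (cc k); last by exists (b, L, E).
  by rewrite /cc big_ord_recr/= addnA leq_addl.
pose b k := (bLE k).1.1; pose L k := (bLE k).1.2; pose E k := (bLE k).2.
have cost0 k j (s : pst (b k)) : 0 <= pcost j s.
  by have [_ [_ h _ _ _] _] := bLEP k; apply: le_trans (h j s).
have XE k j n : Ecost pr (pcost (p:=b k) j) n (pini (b k)) <= E k j.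
  by have [_ [_ _ _ _ h] _] := bLEP k; apply: h.
have E0 k j : 0 <= E k j by exact: (XE k j 0%N).
(* The term in [L k] turns boundedness of the scheduled sum into cycle lengths that are small
   against their index. *)
pose f k i := \sum_j (2 * (kap (b k) j i / i.+1%:R ^+ 2) + E k j ^+ 2 / i.+1%:R ^+ 2)
   + (L k)%:R ^+ 2 / i.+1%:R ^+ 2.
have kap0 k j i : 0 <= kap (b k) j i.
  by apply: le_trans (kap_ge (@cost0 k j) 0 i); rewrite /= /trunc_sq sqr_ge0.
have t0 k j i : 0 <= 2 * (kap (b k) j i / i.+1%:R ^+ 2) + E k j ^+ 2 / i.+1%:R ^+ 2.
  by rewrite addr_ge0// ?mulr_ge0// ?divr_ge0 ?sqr_ge0// invr_ge0 sqr_ge0.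
have f0 k i : 0 <= f k i by rewrite addr_ge0 ?sumr_ge0// divr_ge0 ?sqr_ge0.
have sq_sum x n : 0 <= x -> \sum_(i < n) x / i.+1%:R ^+ 2 <= x * 2 :> R.
  by move=> x0; rewrite -mulr_sumr ler_wpM2l// inv_sq_sum.
have fB k n : \sum_(i < n) f k i <=
    \sum_j (2 * (4 * E k j) + E k j ^+ 2 * 2) + (L k)%:R ^+ 2 * 2.
  rewrite /f big_split/= lerD ?sq_sum ?sqr_ge0// exchange_big/=.
  apply: ler_sum => j _; rewrite big_split/= lerD ?sq_sum ?sqr_ge0//.
  by rewrite -mulr_sumr ler_wpM2l// kap_sum.
have [k [kmono kinf [B fkB]]] := slow_schedule f0 fB.
exists (fun i => b (k i)), (fun i => cc (k i)), (fun i => L (k i)), (fun i => E (k i)),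
  (fun i => f (k i) i), B; split.
- by move=> i; have [? ? _] := bLEP (k i).
- split=> [|i]; first by rewrite leq_addr.
  rewrite leq_add2l -(big_mkord xpredT c1) -(big_mkord xpredT c1).
  rewrite [X in (_ <= X)%N](@big_cat_nat _ _ _ (k i).+1)//= ?leq_addr//.
  by rewrite ltnS kmono.
- move=> ep ep0; have [n nP] := kinf (Num.bound ep^-1); exists n => i /nP ki j.
  have [_ _ h] := bLEP (k i); apply: le_trans (h j) _.
  rewrite ler_wpM2r// lerD2l -[leRHS]invrK lef_pV2 ?posrE ?invr_gt0//.
  apply: ltW; apply: lt_le_trans (archi_boundP _) _; first by rewrite invr_ge0 ltW.
  by rewrite ler_nat; apply: leq_trans ki _.
- move=> i j T; split; last first.
    have [_ _ h] := bLEP (k i); apply: le_trans (h j) _.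
    by rewrite ler_wpM2r// lerD2l invf_le1// ler1n.
  rewrite /f (bigD1 j)//= -addrA -[leLHS]addr0; apply: lerD; last first.
    by rewrite addr_ge0 ?sumr_ge0// divr_ge0 ?sqr_ge0.
  rewrite lerD2r -mulrA ler_wpM2l// ler_wpM2r ?invr_ge0 ?sqr_ge0//.
  exact: kap_ge.
- split=> // ep ep0.
  have [|n nP] := bounded_series_tail (fun i => f0 (k i) i) fkB (_ : 0 < ep ^+ 2).
    by rewrite exprn_gt0.
  exists n => i ni; have := nP i i.+1 ni; rewrite big_nat1 => fi.
  have : (L (k i))%:R ^+ 2 / i.+1%:R ^+ 2 <= ep ^+ 2.
    by apply: le_trans (ltW fi); rewrite /f lerDr sumr_ge0.
  have e1 : 0 <= ep * i.+1%:R by rewrite mulr_ge0// ltW.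
  by rewrite ler_pdivrMr ?exprn_gt0// -exprMn ler_sqr ?nnegrE.
Qed.
End Schedule.

(** * Measure theory and the law of the channel history *)

Section Measure_tools.
Context d (X : measurableType d) (R : realType) (mu : probability X R).

Lemma measurable_discrete d' (Y : measurableType d') (U : countType) (g : X -> U) (F : U -> Y) :
  (forall u, measurable [set x | g x = u]) -> measurable_fun setT (fun x => F (g x)).
Proof.
move=> mg _ A mA; rewrite setTI.
rewrite (_ : _ @^-1` A = \bigcup_u [set x | g x = u /\ A (F u)]).
  apply: countable_bigcupT_measurable => [|u]; first exact: countableP.
  have [Au|Au] := pselect (A (F u)).
    by rewrite (_ : [set _ | _] = [set x | g x = u])//; apply/seteqP; split=> x //= [].
  by rewrite (_ : [set _ | _] = set0)//; apply/seteqP; split=> x //= [].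
by apply/seteqP; split => [x /= Ax|x [u _ /= [<-]]//]; exists (g x).
Qed.

Lemma ae_bounded (f : nat -> X -> R) (B : R) :
  (forall n, measurable_fun setT (f n)) -> (forall n x, 0 <= f n x) ->
  (forall n m x, (n <= m)%N -> f n x <= f m x) ->
  (forall n, (\int[mu]_x (f n x)%:E <= B%:E)%E) ->
  {ae mu, forall x, exists b, forall n, f n x <= b}.
Proof.
move=> mf f0 fm fB.
have mfE n : measurable_fun setT (EFin \o f n) by apply/measurable_EFinP.
have cvf := cvg_monotone_convergence (mu := mu) measurableT
  (g' := fun n => EFin \o f n) mfE (fun n x _ => f0 n x) (fun x _ n m nm => fm n m x nm).
set g := fun x => limn (fun n => (f n x)%:E) in cvf.
have gB : (\int[mu]_x g x <= B%:E)%E.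
  rewrite -(cvg_lim _ cvf)//; apply: lime_le; first by apply/cvg_ex; eexists; exact: cvf.
  by apply: nearW => n; exact: fB.
have ndf x : nondecreasing_seq (fun n => (f n x)%:E) by move=> n m nm; rewrite lee_fin fm.
have fg n x : ((f n x)%:E <= g x)%E.
  apply: lime_ge; first exact: ereal_nondecreasing_is_cvgn.
  by exists n => // m /= nm; rewrite lee_fin fm.
have g0 x : (0 <= g x)%E by apply: le_trans (fg 0%N x); rewrite lee_fin.
have mg : measurable_fun setT g.
  apply: (emeasurable_fun_cvg (fun n => EFin \o f n)) => // x _.
  by rewrite /g; apply: (@ereal_nondecreasing_is_cvgn _ (fun n => (f n x)%:E)); exact: ndf.
have ig : mu.-integrable setT g.
  apply/integrableP; split => //.
  under eq_integral do rewrite gee0_abs//.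
  by apply: le_lt_trans gB _; rewrite ltry.
have := integrable_ae measurableT ig; apply: filterS => x /(_ I) gx.
by exists (fine (g x)) => n; rewrite -lee_fin fineK.
Qed.

Lemma ae_nonempty (Q : X -> Prop) : {ae mu, forall x, Q x} -> exists x, Q x.
Proof.
move=> aeQ; apply: contrapT => /forallNP nQ.
have [A [mA A0 QA]] := aeQ.
have : mu setT = 0%E.
  apply/eqP; rewrite eq_le measure_ge0 andbT -A0 le_measure ?inE// => x _.
  by apply: QA; exact: nQ.
by rewrite probability_setT => -[] /eqP; rewrite oner_eq0.
Qed.

(* Replaces dominated convergence: age costs may grow so fast that [q] has no
   integrable majorant, but the means of [Y] are controlled. *)
Lemma sandwiched_mean (q Y : nat -> X -> R) (M : R) : 0 <= M ->
  (forall T, measurable_fun setT (q T)) -> (forall T, measurable_fun setT (Y T)) ->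
  (forall T x, 0 <= q T x) -> (forall T x, 0 <= Y T x) ->
  {ae mu, forall x, (forall T, q T x <= Y T x) /\
    forall e : R, 0 < e -> exists T0, forall T, (T0 <= T)%N -> q T x <= e /\ M - e <= Y T x} ->
  (forall e : R, 0 < e -> exists T0, forall T, (T0 <= T)%N ->
    (\int[mu]_x (Y T x)%:E <= (M + e)%:E)%E) ->
  forall e : R, 0 < e -> exists T0, forall T, (T0 <= T)%N ->
    (\int[mu]_x (q T x)%:E <= e%:E)%E.
Proof.
move=> M0 mq mY q0 Y0 qY intY e e0.
(* Clipped to values between 0 and [M], the difference converges boundedly to [M]. The mean of [q]
   is then at most the mean of [Y] minus that of [h], which is nearly [M - M]. *)
pose h T x : R := Num.max 0 (Num.min M (Y T x - q T x)).
have h0 T x : 0 <= h T x by rewrite le_max lexx.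
have hM T x : h T x <= M by rewrite ge_max M0 ge_min lexx.
have mh T : measurable_fun setT (h T).
  apply: measurable_maxr; first exact: measurable_cst.
  apply: measurable_minr; first exact: measurable_cst.
  exact: measurable_funB.
have mhE T : measurable_fun setT (EFin \o h T) by apply/measurable_EFinP.
have ae_cvg : {ae mu, forall x, setT x -> (EFin \o h n) x @[n --> \oo] --> cst M%:E x}.
  apply: filterS qY => x [qY lims] _ /=; apply: cvg_EFin; first exact: nearW.
  apply/cvgrPdist_le => /= v v0; have v20 : 0 < v / 2 by rewrite divr_gt0.
  have [T0 T0P] := lims _ v20; exists T0 => // T /= /T0P[h1 h2].
  rewrite ger0_norm ?subr_ge0// lerBlDl -lerBlDr le_max; apply/orP; right.
  by rewrite le_min; apply/andP; split; lra.
have ae_dom : {ae mu, forall x n, setT x -> (`|(EFin \o h n) x| <= cst M%:E x)%E}.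
  by apply: aeW => x n _; rewrite /= lee_fin ger0_norm.
have intc : mu.-integrable setT (cst M%:E) by exact: finite_measure_integrable_cst.
have [_ _ cv] := dominated_convergence measurableT mhE (measurable_cst _) ae_cvg intc ae_dom.
have intM : (\int[mu]_(x in setT) (cst M%:E x) = M%:E)%E.
  by rewrite integral_cst// [X in (_ * X)%E]probability_setT mule1.
rewrite {}intM in cv.
have e20 : 0 < e / 2 by rewrite divr_gt0.
have [T1 _ T1P] : \forall T \near \oo, ((M - e / 2)%:E < \int[mu]_x (h T x)%:E)%E.
  by apply: (cv [set z | ((M - e / 2)%:E < z)%E]); apply: open_ereal_gt'; rewrite lte_fin; lra.
have [T2 T2P] := intY _ e20.
exists (maxn T1 T2) => T; rewrite geq_max => /andP[/T1P/= h1 /T2P h2].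
have : (\int[mu]_x (q T x)%:E + \int[mu]_x (h T x)%:E <= (M + e / 2)%:E)%E.
  apply: le_trans h2; rewrite -ge0_integralD//; last 4 first.
  - by move=> x _; rewrite lee_fin.
  - exact/measurable_EFinP.
  - by move=> x _; rewrite lee_fin.
  - exact/measurable_EFinP.
  apply: ae_ge0_le_integral => //.
  - by move=> x _; rewrite -EFinD lee_fin addr_ge0.
  - by apply: emeasurable_funD; exact/measurable_EFinP.
  - by move=> x _; rewrite lee_fin.
  - exact/measurable_EFinP.
  apply: filterS qY => x [qY _] _; rewrite -EFinD lee_fin.
  have := qY T; have : h T x <= Y T x - q T x; last by lra.
  by rewrite ge_max subr_ge0 qY ge_min lexx orbT.
move: h1; have : (0 <= \int[mu]_x (q T x)%:E)%E by apply: integral_ge0 => x _; rewrite lee_fin.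
case: (\int[mu]_x (q T x)%:E)%E => [u| |] // u0.
case: (\int[mu]_x (h T x)%:E)%E => [v| |] //.
rewrite -EFinD !lee_fin lte_fin; lra.
by case: (\int[mu]_x (h T x)%:E)%E => [v| |].
Qed.
End Measure_tools.

Section History_law.
Context d (X : measurableType d) (R : realType) (mu : probability X R).
Variables (Ch : finType) (pr : Ch -> R) (ch : nat -> X -> Ch).
Hypothesis pr_ge0 : forall c, 0 <= pr c.

Definition hist T x := mkseq (fun s => ch s x) T.
Definition cyl (p : seq Ch) := [set x | hist (size p) x = p].

Hypothesis cyl_measurable : forall p, measurable (cyl p).
Hypothesis cyl_law : forall p, mu (cyl p) = (\prod_(c <- p) pr c)%:E.

Lemma size_hist T x : size (hist T x) = T. Proof. by rewrite size_mkseq. Qed.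

Lemma histS T x : hist T.+1 x = rcons (hist T x) (ch T x).
Proof. by rewrite /hist mkseqS. Qed.

Lemma measurable_hist T p : measurable [set x | hist T x = p].
Proof.
have [<-|pT] := eqVneq (size p) T; first exact: cyl_measurable.
rewrite (_ : [set _ | _] = set0)//; apply/seteqP; split => // x /= h.
by move: pT; rewrite -h size_hist eqxx.
Qed.

Lemma measurable_hist_fun d' (Y : measurableType d') (F : seq Ch -> Y) T :
  measurable_fun setT (fun x => F (hist T x)).
Proof. by apply: measurable_discrete => p; exact: measurable_hist. Qed.

(** The prefix [p] is general because [Ehist] unfolds from the first slot: each step splits the
    cylinder by the next channel state. *)
Lemma integral_cyl (f : seq Ch -> R) T p : (forall h, 0 <= f h) ->
  (\int[mu]_(x in cyl p) (f (hist (size p + T) x))%:E =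
   ((\prod_(c <- p) pr c) * Ehist pr T (fun h => f (p ++ h)))%:E)%E.
Proof.
move=> f0; elim: T p => [|T IH] p.
  rewrite addn0 /= cats0 (eq_integral (fun=> (f p)%:E)); last first.
    by move=> x; rewrite inE => ->.
  transitivity ((f p)%:E * mu (cyl p))%E; first exact: integral_cst.
  by rewrite cyl_law -EFinM mulrC.
have -> : cyl p = \big[setU/set0]_(c <- enum Ch) cyl (rcons p c).
  rewrite -bigcup_seq; apply/seteqP; split => x.
    move=> xp; exists (ch (size p) x); first by rewrite /= mem_enum.
    by rewrite /cyl /= size_rcons histS xp.
  by case=> c _ /=; rewrite /cyl /= size_rcons histS => /rcons_inj[].
rewrite ge0_integral_bigsetU//=.
- rewrite big_enum /= (eq_bigr (fun c => ((\prod_(c <- p) pr c) *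
     (pr c * Ehist pr T (fun h => f (p ++ c :: h))))%:E)); last first.
    move=> c _; have := IH (rcons p c); rewrite size_rcons addSnnS => ->.
    rewrite big_rcons/= -mulrA; congr (_ * (_ * _))%:E.
    by congr Ehist; apply/funext => h; rewrite cat_rcons.
  by rewrite sumEFin -mulr_sumr.
- exact: enum_uniq.
- move=> c c' _ _ [x []]; rewrite /cyl /= !size_rcons histS.
  by move=> /rcons_inj[_ <-] /rcons_inj[].
- apply: measurable_funTS; apply/measurable_EFinP; exact: measurable_hist_fun.
- by move=> x _; rewrite lee_fin.
Qed.

Lemma integral_hist (f : seq Ch -> R) T : (forall h, 0 <= f h) ->
  (\int[mu]_x (f (hist T x))%:E = (Ehist pr T f)%:E)%E.
Proof.
move=> f0; have := integral_cyl T [::] f0; rewrite big_nil mul1r add0n /= => <-.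
by congr integral; apply/seteqP; split.
Qed.

Lemma ae_positive : {ae mu, forall x, forall t, pr (ch t x) != 0}.
Proof.
(* Bounded in [T] exactly when no null state ever occurs, and of mean 0 for every [T]. *)
pose f T x : R := if all (fun c => pr c != 0) (hist T x) then 0 else T%:R.
have : {ae mu, forall x, exists b, forall n, f n x <= b}.
  apply: (@ae_bounded _ _ _ mu f 0).
  - move=> n; exact: (measurable_hist_fun (fun h => (if all (fun c => pr c != 0) h then 0 else n%:R) : R)).
  - by move=> n x; rewrite /f; case: ifP.
  - move=> n m x nm; rewrite /f.
    have hnm : hist n x = take n (hist m x).
      by rewrite /hist -map_take take_iota (minn_idPl nm).
    case: ifP => [|hn]; first by case: ifP.
    rewrite ifF ?ler_nat//; apply: contraFF hn => hm; rewrite hnm.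
    by apply/allP => c /mem_take; apply: (allP hm).
  - move=> n; rewrite /f.
    rewrite (integral_hist n (f := fun h => if all (fun c => pr c != 0) h then 0 else n%:R)); last first.
      by move=> h; case: ifP.
    rewrite lee_fin -(eq_Ehist (f := fun=> 0)).
      by rewrite le_eqVlt; apply/orP; left; apply/eqP; elim: n => //= n IH; rewrite /Echan big1// => c _; rewrite IH mulr0.
    by move=> s _ sp; rewrite ifT//; apply/allP.
apply: filterS => x [b bP] t; apply/negP => pt.
pose n := maxn t.+1 (Num.bound `|b|).
have := bP n; rewrite /f ifF.
  have : b < n%:R.
    apply: le_lt_trans (ler_norm b) _; apply: lt_le_trans (archi_boundP (normr_ge0 b)) _.
    by rewrite ler_nat leq_maxr.
  by move=> h1 h2; have := lt_le_trans h1 h2; rewrite ltxx.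
apply/negP => /allP /(_ (ch t x)); rewrite pt => h; have : false; last by [].
by apply: h; rewrite /hist; apply/mapP; exists t => //; rewrite mem_iota /= add0n leq_maxl.
Qed.
End History_law.

Section Channel_law.
Context d (Omega : measurableType d) (R : realType) (P : probability Omega R).
Variables (N K : nat) (G : network N K) (gamma : link G -> R).
Variable S : nat -> link G -> {RV P >-> bool}.
Hypothesis S_channel : channel_process gamma S.

Definition chan_pr (c : chan_state G) : R :=
  \prod_(l : link G) (if l \in c then gamma l else 1 - gamma l).

Let SB_meas t l (B : set bool) : measurable (S t l @^-1` B).
Proof. by rewrite -[X in measurable X]setTI; apply: measurable_funP. Qed.

Lemma gamma_bounds l : 0 <= gamma l <= 1.
Proof.
have [Sg _] := S_channel; rewrite -!lee_fin -(Sg 0%N l) measure_ge0/=.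
by apply: probability_le1; exact: (@SB_meas 0%N l [set true]).
Qed.

Lemma chan_pr_ge0 c : 0 <= chan_pr c.
Proof.
apply: prodr_ge0 => l _; have /andP[h0 h1] := gamma_bounds l.
by case: ifP => // _; rewrite subr_ge0.
Qed.

Lemma chan_pr_sum1 : \sum_c chan_pr c = 1.
Proof.
have -> : 1 = \prod_(l : link G) \sum_(b : bool) (if b then gamma l else 1 - gamma l).
  by rewrite big1// => l _; rewrite big_bool/= addrC subrK.
rewrite bigA_distr_bigA/=.
rewrite (reindex (fun f : {ffun link G -> bool} => [set l | f l]%SET))/=.
  by apply: eq_bigr => f _; apply: eq_bigr => l _; rewrite inE.
exists (fun c : chan_state G => [ffun l => l \in c]) => [f _|c _].
  by apply/ffunP => l; rewrite ffunE inE.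
by apply/setP => l; rewrite inE ffunE.
Qed.

(** The least channel state of positive probability, which plays the role of [c0]. *)
Definition sure_links : chan_state G := [set l | gamma l == 1]%SET.

Lemma chan_pr_sure_links : 0 < chan_pr sure_links.
Proof.
apply: prodr_gt0 => l _; rewrite inE; have /andP[h0 h1] := gamma_bounds l.
case: eqP => [->//|/eqP g1]; by rewrite subr_gt0 lt_neqAle g1.
Qed.

Lemma sure_links_sub c : chan_pr c != 0 -> sure_links \subset c.
Proof.
move=> p0; apply/fintype.subsetP => l; rewrite inE => /eqP g1.
apply: contraNT p0 => lc; rewrite /chan_pr (bigD1 l)//= (negbTE lc) g1 subrr mul0r.
exact: eqxx.
Qed.

Local Notation ch := (fun s w => chan_at S s w).

Let J T := [seq (t, l) | t <- iota 0 T, l <- enum {: link G}].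
Let Bh (h : seq (chan_state G)) (tl : nat * link G) : set bool :=
  [set tl.2 \in nth finset.set0 h tl.1].

Let cylE h : cyl ch h =
  \bigcap_(i in [set` J (size h)]) ((fun tl => S tl.1 tl.2) i @^-1` Bh h i).
Proof.
apply/seteqP; split => w.
  rewrite /cyl /hist /= => hw [t l] /= /allpairsP[[t' l'] /= [tT _ [-> ->]]].
  rewrite /Bh /= -hw nth_mkseq; last by move: tT; rewrite mem_iota.
  by rewrite inE.
move=> H; rewrite /cyl /hist /=; apply: (@eq_from_nth _ finset.set0).
  by rewrite size_mkseq.
rewrite size_mkseq => t tT; rewrite nth_mkseq//; apply/setP => l; rewrite inE.
apply: (H (t, l)); apply/allpairsP; exists (t, l); split => //=.
  by rewrite mem_iota.
by rewrite mem_enum.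
Qed.

Lemma chan_cyl_measurable h : measurable (cyl ch h).
Proof.
by rewrite cylE; apply: fin_bigcap_measurable => // -[t l] _; exact: SB_meas.
Qed.

Lemma chan_cyl_law h : P (cyl ch h) = (\prod_(c <- h) chan_pr c)%:E.
Proof.
have [Sg ind] := S_channel.
rewrite cylE ind//; last first.
  by apply: allpairs_uniq; rewrite ?iota_uniq ?enum_uniq// => -[? ?] [? ?].
have PB t l : P (S t l @^-1` Bh h (t, l)) =
    (if l \in nth finset.set0 h t then gamma l else 1 - gamma l)%:E.
  rewrite /Bh /=; case: ifP => lh.
    by rewrite -(Sg t l).
  rewrite (_ : _ @^-1` _ = ~` [set w | S t l w = true]).
    rewrite probability_setC ?Sg ?EFinB//.
    exact: (@SB_meas t l [set true]).
  by apply/seteqP; split => w /=; case: (S t l w).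
rewrite (eq_bigr (fun i => (if i.2 \in nth finset.set0 h i.1 then gamma i.2 else 1 - gamma i.2)%:E)); last first.
  by move=> [t l] _; rewrite PB.
rewrite prodEFin big_allpairs/=; congr _%:E.
rewrite (big_nth finset.set0) /index_iota subn0; apply: eq_bigr => t _.
by rewrite big_enum.
Qed.

Section With_seed.
Context d' (Z : measurableType d') (nu : probability Z R).

Lemma seed_cyl_measurable h : measurable (cyl (fun s (x : Omega * Z) => chan_at S s x.1) h).
Proof.
rewrite (_ : cyl _ h = cyl ch h `*` setT); first by apply: measurableX => //; exact: chan_cyl_measurable.
by apply/seteqP; split => x //= [].
Qed.

Lemma seed_cyl_law h :
  (P \x nu)%E (cyl (fun s (x : Omega * Z) => chan_at S s x.1) h) = (\prod_(c <- h) chan_pr c)%:E.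
Proof.
rewrite (_ : cyl _ h = cyl ch h `*` setT); last by apply/seteqP; split => x //= [].
transitivity (P (cyl ch h) * nu setT)%E.
  by apply: product_measure1E => //; exact: chan_cyl_measurable.
by rewrite chan_cyl_law probability_setT mule1.
Qed.
End With_seed.
End Channel_law.

(** * Ages under a policy, and necessity of acceptability *)

Section Policy_run.
Context d (Omega : measurableType d) (R : realType) (P : probability Omega R).
Variables (N K : nat) (G : network N K) (gamma : link G -> R).
Variable S : nat -> link G -> {RV P >-> bool}.
Hypothesis S_channel : channel_process gamma S.
Variable A0 : ages N K.
Local Notation pr := (chan_pr gamma).
Local Notation nx := (@next_ages N K G).
Local Notation ch := (fun s w => chan_at S s w).

Section Run.
Variable pi : policy G R.
Local Notation mu := (P \x seed_law pi)%E.

Lemma age_traj T (x : Omega * seed pi) :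
  age S A0 T x = traj nx (fun h => act h x.2) (init_ages G A0) (hist ch T x.1).
Proof.
by elim: T => [//|T IH]; rewrite histS traj_rcons -IH.
Qed.

Lemma csum_age (C : ages N K -> R) T (x : Omega * seed pi) :
  csum nx C (fun h => act h x.2) (init_ages G A0) (hist ch T x.1) =
  \sum_(t < T) C (age S A0 t x).
Proof.
elim: T => [|T IH]; first by rewrite big_ord0.
by rewrite histS csum_rcons IH big_ord_recr/= age_traj.
Qed.

Let meas_hist T h : measurable [set x : Omega * seed pi | hist ch T x.1 = h].
Proof.
apply: (measurable_hist (ch := fun s (x : Omega * seed pi) => chan_at S s x.1)) => p.
exact: seed_cyl_measurable.
Qed.

Let meas_action t a : measurable [set x : Omega * seed pi | action_at S t x = a].
Proof.
rewrite (_ : [set _ | _] = \bigcup_(h : seq (chan_state G))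
   ([set x : Omega * seed pi | hist ch t x.1 = h] `&` (setT `*` [set z | act h z = a]))).
  apply: countable_bigcupT_measurable => [|h]; first exact: countableP.
  apply: measurableI; first exact: meas_hist.
  by apply: measurableX => //; exact: act_measurable.
apply/seteqP; split => x /=.
  by move=> xa; exists (hist ch t x.1).
by move=> [h _ [hx [_ /= ha]]]; rewrite /action_at -/(hist ch t x.1) hx.
Qed.

Let meas_chan t c : measurable [set x : Omega * seed pi | chan_at S t x.1 = c].
Proof.
rewrite (_ : [set _ | _] = \bigcup_(h : seq (chan_state G))
   [set x : Omega * seed pi | hist ch t.+1 x.1 = rcons h c]).
  apply: countable_bigcupT_measurable => [|h]; first exact: countableP.
  exact: meas_hist.
apply/seteqP; split => x /=.
  by move=> xc; exists (hist ch t x.1) => //=; rewrite histS xc.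
by move=> [h _ /=]; rewrite histS => /rcons_inj[].
Qed.

(** Age configurations carry no sigma-algebra, so measurability is stated after an arbitrary [F]. It
    holds for any [F] since each slot splits into countably many cases of action and channel
    state. *)
Lemma age_measurable d' (Y : measurableType d') (F : ages N K -> Y) t :
  measurable_fun setT (fun x : Omega * seed pi => F (age S A0 t x)).
Proof.
elim: t F => [|t IH] F /=; first exact: measurable_cst.
move=> _ A mA; rewrite setTI.
rewrite (_ : _ @^-1` A = \bigcup_(ac : action G * chan_state G)
  ([set x : Omega * seed pi | action_at S t x = ac.1] `&`
   ([set x : Omega * seed pi | chan_at S t x.1 = ac.2] `&`
    [set x : Omega * seed pi | A (F (next_ages ac.1 ac.2 (age S A0 t x)))]))).
  apply: countable_bigcupT_measurable => [|[a c]]; first exact: countableP.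
  apply: measurableI; first exact: meas_action.
  apply: measurableI; first exact: meas_chan.
  by rewrite -[X in measurable X]setTI; apply: (IH (fun x => F (next_ages a c x))).
apply/seteqP; split => x /=.
  by move=> h; exists (action_at S t x, chan_at S t x.1).
by move=> [[a c] _ /= [-> [-> h]]].
Qed.

Lemma age_sum_measurable (C : ages N K -> R) T :
  measurable_fun setT (fun x : Omega * seed pi => \sum_(t < T) C (age S A0 t x)).
Proof. by apply: measurable_sum => t; exact: age_measurable. Qed.

Lemma age_debt_measurable (g : 'I_K -> 'I_N -> nat -> R) al k j T :
  measurable_fun setT (fun x : Omega * seed pi => age_debt S A0 g al k j T x).
Proof.
elim: T => [|T IH] /=; first exact: measurable_cst.
apply: measurable_maxr; last exact: measurable_cst.
apply: measurable_funB; last exact: measurable_cst.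
apply: measurable_funD => //.
exact: (age_measurable (fun A => g k j (A k j)) T.+1).
Qed.

Section Lower_bound.
Variables (a0 : action G) (C : ages N K -> R).
Hypothesis a0F : a0 \in feasible G.
Hypothesis C_mono : forall x y, le_ages x y -> C x <= C y.

Definition nonpos_count n (x : Omega * seed pi) : R :=
  \sum_(T < n) (\sum_(t < T) C (age S A0 t x) <= 0)%R%:R.

Lemma nonpos_measurable (f : Omega * seed pi -> R) : measurable_fun setT f ->
  measurable_fun setT (fun x => (f x <= 0)%R%:R : R).
Proof.
move=> mf; apply: (measurableT_comp (f := fun b : bool => b%:R : R)) => //.
by apply: measurable_fun_ler => //; exact: measurable_cst.
Qed.

Lemma nonpos_count_measurable n : measurable_fun setT (nonpos_count n).
Proof.
apply: measurable_sum => T; apply: nonpos_measurable; exact: age_sum_measurable.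
Qed.

(** For a fixed seed the policy is a function of the channel history, so [lower_tail] applies with a
    bound that is the same for all policies; the seed is then integrated out. *)
Lemma lower_tail_policy H :
  0 < value pr (feasible G) a0 nx C xpredT H 0 (@zero_ages N K) ->
  exists B, forall n, (\int[mu]_x (nonpos_count n x)%:E <= B%:E)%E.
Proof.
move=> V0.
have nxm a c r p : le_ages r p -> le_ages (nx a c r) (nx a c p) by exact: next_ages_mono.
have [B BP] := lower_tail (chan_pr_ge0 S_channel) (chan_pr_sum1 gamma) a0F
  (@zero_ages_le N K) nxm C_mono V0.
exists B => n.
have nc0 x : 0 <= nonpos_count n x by apply: sumr_ge0.
rewrite fubini_tonelli2//; last first.
  by apply/measurable_EFinP; exact: nonpos_count_measurable.
apply: (@le_trans _ _ (\int[seed_law pi]_z B%:E)%E); last first.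
  by rewrite integral_cst//= probability_setT mule1.
apply: ge0_le_integral => //.
- by move=> z _; apply: integral_ge0 => w _; rewrite lee_fin.
- apply: (measurable_fun_fubini_tonelli_G (fun x => (nonpos_count n x)%:E)) => //.
  by apply/measurable_EFinP; exact: nonpos_count_measurable.
move=> z _; rewrite /fubini_G /nonpos_count /=.
pose f h : R := (csum nx C (fun h => act h z) (init_ages G A0) h <= 0)%R%:R.
have fE w : (\sum_(T < n) (\sum_(t < T) C (age S A0 t (w, z)) <= 0)%R%:R)%:E =
    (\sum_(T < n) (f (hist ch T w))%:E)%E.
  by rewrite sumEFin; congr _%:E; apply: eq_bigr => T _; rewrite /f -(csum_age C T (w, z)).
under eq_integral do rewrite fE.
have cylm h := chan_cyl_measurable S h.
rewrite ge0_integral_sum//; last 2 first.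
- by move=> T; apply/measurable_EFinP; exact: (measurable_hist_fun cylm).
- by move=> T w _; rewrite lee_fin.
rewrite (eq_bigr (fun T : 'I_n => (Ehist pr T f)%:E)).
  by rewrite sumEFin lee_fin; apply: BP => h; exact: act_feasible.
by move=> T _; apply: (integral_hist cylm (chan_cyl_law S_channel)).
Qed.

Lemma lower_tail_ae H :
  0 < value pr (feasible G) a0 nx C xpredT H 0 (@zero_ages N K) ->
  {ae mu, forall x, exists n0, forall T, (n0 <= T)%N ->
    0 < \sum_(t < T) C (age S A0 t x)}.
Proof.
move=> /lower_tail_policy[B BP].
have : {ae mu, forall x, exists b, forall n, nonpos_count n x <= b}.
  apply: (@ae_bounded _ _ _ mu nonpos_count B) => //.
  - exact: nonpos_count_measurable.
  - by move=> n x; apply: sumr_ge0.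
  - move=> n m x nm; rewrite /nonpos_count -(subnKC nm) big_split_ord/= lerDl.
    exact: sumr_ge0.
apply: filterS => x [b bP].
have [n0 n0P] := bounded_series_tail (f := fun T => (\sum_(t < T) C (age S A0 t x) <= 0)%R%:R) (fun T => ler0n _ _) bP (@ltr01 R).
exists n0 => T nT; rewrite ltNge; apply/negP => S0.
by have := n0P T T.+1 nT; rewrite big_nat1 S0 ltxx.
Qed.
End Lower_bound.
End Run.
Section Necessity.
Variables (J : finType) (jk : J -> 'I_K) (ji : J -> 'I_N) (gj : J -> nat -> R).
Hypothesis gj_homo : forall j m n, (m <= n)%N -> gj j m <= gj j n.
Variable a0 : action G.
Hypothesis a0F : a0 \in feasible G.
Local Notation cost j x := (gj j (x (jk j) (ji j))).
Local Notation V := (value pr (feasible G) a0 nx).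

(* A lower bound on any achievable [al]: by monotonicity the all-zero ages are
   the cheapest initial state. *)
Definition acceptable (al : J -> R) := forall y : J -> R, (forall j, 0 < y j) -> forall H,
  V (fun x => \sum_j y j * cost j x) xpredT H 0 (@zero_ages N K) <= H%:R * \sum_j y j * al j.

Definition excess (al y : J -> R) e (x : ages N K) := \sum_j y j * cost j x - (\sum_j y j * al j + e).

Lemma excess_mono al y e : (forall j, 0 < y j) -> forall x x', le_ages x x' ->
  excess al y e x <= excess al y e x'.
Proof.
move=> y0 x x' h; rewrite lerD2r; apply: ler_sum => j _.
by rewrite ler_wpM2l ?gj_homo// ltW.
Qed.

Lemma excessE al y e x : excess al y e x = \sum_j y j * (cost j x - al j) - e.
Proof.
rewrite /excess opprD addrA; congr (_ - _).
by rewrite -sumrB; apply: eq_bigr => j _; rewrite mulrBr.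
Qed.

Lemma not_acceptable_excess al : ~ acceptable al -> exists (y : J -> R) (e : R) H,
  [/\ forall j, 0 < y j, 0 < e & 0 < V (excess al y e) xpredT H 0 (@zero_ages N K)].
Proof.
move=> /existsNP[y /not_implyP[y0 /existsNP[H /negP]]]; rewrite -ltNge => lt.
set v := V _ _ _ _ _ in lt; set s := \sum_j _ in lt.
have H0 : (0 < H)%N.
  by case: H @v lt => // v; rewrite /v /= mul0r ltxx.
have Hp : 0 < H%:R :> R by rewrite ltr0n.
(* Half of the gap per slot becomes the slack [e]; the other half keeps the value positive. *)
exists y, ((v - H%:R * s) / (2 * H%:R)), H; split => //.
  by rewrite divr_gt0 ?subr_gt0// mulr_gt0.
rewrite (value_shift (chan_pr_ge0 S_channel) (chan_pr_sum1 gamma) a0F) -/v -/s.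
have -> : v - (s + (v - H%:R * s) / (2 * H%:R)) * H%:R = (v - H%:R * s) / 2.
  by field; exact: lt0r_neq0.
by rewrite divr_gt0// subr_gt0.
Qed.

Variables (pi : policy G R) (al : J -> R).
Local Notation mu := (P \x seed_law pi)%E.
Local Notation A x t := (age S A0 (pi := pi) t x).

Definition excess_sum j T (x : Omega * seed pi) := \sum_(1 <= t < T.+1) (cost j (A x t) - al j).

Lemma sum_excess (y : J -> R) e T x :
  \sum_(t < T.+1) excess al y e (A x t) =
  excess al y e (init_ages G A0) + \sum_j y j * excess_sum j T x - e * T%:R.
Proof.
rewrite big_ord_recl -[RHS]addrA; congr (_ + _).
rewrite (eq_bigr _ (fun t _ => excessE _ _ _ _)).
rewrite sumrB sumr_const card_ord mulr_natr; congr (_ - _).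
rewrite exchange_big/=; apply: eq_bigr => j _.
by rewrite -mulr_sumr /excess_sum big_add1/= big_mkord.
Qed.

Lemma small_excess_nonpos (y : J -> R) e : (forall j, 0 < y j) -> 0 < e ->
  exists2 de : R, 0 < de & exists n0, forall T x, (n0 <= T)%N ->
  (forall j, excess_sum j T x <= de * T%:R) -> \sum_(t < T.+1) excess al y e (A x t) <= 0.
Proof.
move=> y0 e0; pose Y := \sum_j y j; have Y0 : 0 <= Y by apply: sumr_ge0 => j _; apply: ltW.
pose de := e / 2 / (Y + 1); have de0 : 0 < de by rewrite /de !divr_gt0//; lra.
exists de => //; set c := excess al y e (init_ages G A0).
have e20 : 0 < e / 2 by rewrite divr_gt0.
have [n0 n0P] := le_linear c e20; exists n0 => T x /n0P cT h; rewrite sum_excess -/c.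
have : \sum_j y j * excess_sum j T x <= Y * (de * T%:R).
  by rewrite mulr_suml; apply: ler_sum => j _; rewrite ler_wpM2l// ltW.
have : Y * (de * T%:R) <= e / 2 * T%:R.
  rewrite mulrA ler_wpM2r//; apply: (@le_trans _ _ ((Y + 1) * de)).
    by rewrite ler_wpM2r ?(ltW de0)// lerDl.
  rewrite /de mulrC divfK//; apply: lt0r_neq0; lra.
have -> : e * T%:R = e / 2 * T%:R + e / 2 * T%:R by field.
lra.
Qed.

Lemma achieved_acceptable :
  {ae mu, forall x, forall j (de : R), 0 < de -> exists n0, forall T, (n0 <= T)%N ->
    excess_sum j T x <= de * T%:R} -> acceptable al.
Proof.
move=> ach; apply: contrapT => /not_acceptable_excess[y [e [H [y0 e0 V0]]]].
have lt := @lower_tail_ae pi a0 _ a0F (excess_mono al e y0) _ V0.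
have : {ae mu, forall x, False}.
  apply: filterS2 ach lt => x ach [n1 lt].
  have [de de0 [n0 small]] := small_excess_nonpos y0 e0.
  have [n2 n2P] : exists n, forall j, forall T, (n <= T)%N -> excess_sum j T x <= de * T%:R.
    apply: (@finite_uniform _ (fun j n => forall T, (n <= T)%N -> excess_sum j T x <= de * T%:R)).
      by move=> j m n mn h T nT; apply: h; apply: leq_trans nT.
    by move=> j; apply: ach.
  pose T := maxn n0 (maxn n1 n2).
  have := lt T.+1 (leqW (leq_trans (leq_maxl _ _) (leq_maxr _ _))).
  rewrite ltNge small//; first by rewrite leq_maxl.
  by move=> j; apply: n2P; rewrite !leq_max leqnn !orbT.
by move=> /ae_nonempty[].
Qed.

(** Only means are controlled here. By Markov's inequality a small mean of [W T] makes the
    cumulative excess nonpositive with probability at least one half at every late time, so the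
    expected number of such times would be infinite, against [lower_tail_policy]. *)
Lemma stabilized_acceptable (W : nat -> Omega * seed pi -> R) :
  (forall T, measurable_fun setT (W T)) -> (forall T x, 0 <= W T x) ->
  (forall T x j, (0 < T)%N -> excess_sum j T x <= W T x * T%:R) ->
  (fun T => (\int[mu]_x (W T x)%:E)%E) @ \oo --> 0%E -> acceptable al.
Proof.
move=> mW W0 excW W_cvg; apply: contrapT => /not_acceptable_excess[y [e [H [y0 e0 V0]]]].
have [B BP] := @lower_tail_policy pi a0 _ a0F (excess_mono al e y0) _ V0.
have [de de0 [n0 small]] := small_excess_nonpos y0 e0.
have de2 : (0 < (de / 2)%:E)%E by rewrite lte_fin divr_gt0.
have [n1 _ n1P] : \forall T \near \oo, (\int[mu]_x (W T x)%:E < (de / 2)%:E)%E.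
  by apply: (W_cvg [set z | (z < (de / 2)%:E)%E]); exact: open_ereal_lt'.
pose E T (x : Omega * seed pi) : R := (\sum_(t < T) excess al y e (A x t) <= 0)%R%:R.
have mE T : measurable_fun setT (E T).
  apply: nonpos_measurable; exact: age_sum_measurable.
have mEE T : measurable_fun setT (EFin \o E T) by apply/measurable_EFinP.
have E0 T x : (0 <= (E T x)%:E)%E by rewrite lee_fin.
have half_le T : (maxn (maxn n0 n1) 1 <= T)%N -> (2^-1%:E <= \int[mu]_x (E T.+1 x)%:E)%E.
  rewrite !geq_max => /andP[/andP[h0 h1] h2].
  have mW' : measurable_fun setT (EFin \o W T) by apply/measurable_EFinP.
  have mdW : measurable_fun setT (fun x => (de^-1)%:E * (W T x)%:E)%E.
    under eq_fun do rewrite -EFinM.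
    by apply/measurable_EFinP; apply: measurable_funM => //; exact: measurable_cst.
  have dV0 : 0 <= de^-1 by rewrite invr_ge0 ltW.
  have : (1 <= \int[mu]_x ((E T.+1 x)%:E + (de^-1)%:E * (W T x)%:E))%E.
    have <- : (\int[mu]_x (cst 1%E x) = 1)%E.
      by rewrite integral_cst// mul1e; exact: probability_setT.
    apply: ge0_le_integral => //.
    - apply: emeasurable_funD; [exact: mEE|exact: mdW].
    - move=> x _; rewrite -EFinM -EFinD lee_fin /E.
      have [Wd|Wd] := leP (W T x) de.
        rewrite small// ?lerDl ?mulr_ge0// => j.
        by apply: le_trans (excW T x j h2) _; rewrite ler_wpM2r.
      apply: (@le_trans _ _ (de^-1 * W T x)); last by rewrite lerDr.
      by rewrite ler_pdivlMl// mulr1 ltW.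
  rewrite (ge0_integralD _ _ _ (mEE T.+1) _ mdW)//; last 2 first.
  - by move=> x _; apply: E0.
  - by move=> x _; rewrite -EFinM lee_fin mulr_ge0.
  rewrite (ge0_integralZl _ _ mW')//; last by move=> x _; rewrite lee_fin.
  have := n1P T h1.
  have : (0 <= \int[mu]_x (W T x)%:E)%E by apply: integral_ge0 => x _; rewrite lee_fin.
  have : (0 <= \int[mu]_x (E T.+1 x)%:E)%E by apply: integral_ge0 => x _.
  case: (\int[mu]_x (W T x)%:E)%E => [w| |] // + w0.
  case: (\int[mu]_x (E T.+1 x)%:E)%E => [v| |] // v0; last by move=> _ _; rewrite leey.
  rewrite -EFinM -EFinD !lee_fin lte_fin => wd.
  have : de^-1 * w <= 2^-1 by rewrite ler_pdivrMl// ltW.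
  lra.
pose m := (maxn (maxn n0 n1) 1).+1; pose p := Num.bound (2 * `|B|).
suff : (B%:E < \int[mu]_x (nonpos_count (pi:=pi) (excess al y e) (m + p) x)%:E)%E by rewrite ltNge BP.
apply: (@lt_le_trans _ _ (\sum_(T < p) (2^-1)%:E)%E).
  rewrite sumEFin lte_fin sumr_const card_ord -mulr_natl.
  have : 2 * `|B| < p%:R by apply: archi_boundP; rewrite mulr_ge0.
  have := ler_norm B; lra.
apply: (@le_trans _ _ (\int[mu]_x \sum_(T < p) (E (m + T)%N x)%:E)%E).
  rewrite ge0_integral_sum//; last by move=> i; apply: mEE.
  apply: lee_sum => i _.
  by apply: (half_le (maxn (maxn n0 n1) 1 + i)%N); rewrite leq_addr.
apply: ge0_le_integral => //.
- by move=> x _; apply: sume_ge0.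
- by apply: emeasurable_sum => i; exact: mEE.
- by apply/measurable_EFinP; exact: nonpos_count_measurable.
move=> x _; rewrite sumEFin lee_fin /nonpos_count big_split_ord/= lerDr.
exact: sumr_ge0.
Qed.
End Necessity.
End Policy_run.

(** * Minimal acceptable targets *)

Section Minimal_target.
Variables (R : realType) (J : finType).

Definition bump (al : J -> R) (j : J) (v : R) i := al i + (if i == j then v else 0).

(** Coordinates are lowered one after the other, each to its infimum. One treated earlier stays
    minimal, since lowering others only makes [Q] harder to satisfy. *)
Lemma minimal_below (Q : (J -> R) -> Prop) (lb : J -> R) :
  (forall al, Q al -> forall j, lb j <= al j) ->
  (forall al be, Q al -> (forall j, al j <= be j) -> Q be) ->
  (forall al j, (forall v : R, 0 < v -> Q (bump al j v)) -> Q al) ->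
  forall al, Q al -> exists be, [/\ forall j, be j <= al j, Q be &
    forall j (v : R), 0 < v -> ~ Q (bump be j (- v))].
Proof.
move=> Qlb Qup Qcl al Qal.
suff [be [h1 h2 h3]] : exists be, [/\ forall j, be j <= al j, Q be &
    forall j, j \in enum J -> forall v : R, 0 < v -> ~ Q (bump be j (- v))].
  by exists be; split => // j; apply: h3; rewrite mem_enum.
elim: (enum J) => [|j s [be [h1 h2 h3]]]; first by exists al; split.
pose D := [set v : R | Q (bump be j v)].
have D0 : D 0.
  by apply: Qup h2 _ => i; rewrite /bump; case: ifP; rewrite addr0.
have Dlb : has_lbound D.
  exists (lb j - be j) => v /Qlb /(_ j); rewrite /bump eqxx; lra.
have Di : has_inf D by split => //; exists 0.
pose m := inf D.
have m0 : m <= 0 by apply: ge_inf.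
have mle i : bump be j m i <= be i.
  by rewrite /bump; case: ifP => _; [lra|rewrite addr0].
exists (bump be j m); split.
- by move=> i; apply: le_trans (mle i) (h1 i).
- apply: (@Qcl _ j) => v v0.
  have [u Du] := @inf_adherent _ D v v0 Di; rewrite -/m => um.
  by apply: Qup Du _ => i; rewrite /bump; case: eqP => // _; lra.
move=> i; rewrite inE => /predU1P[->|si] v v0 Qv.
  have : D (m - v).
    by apply: Qup Qv _ => k; rewrite /bump; case: eqP => // _; lra.
  by move=> /(ge_inf Dlb); rewrite -/m; lra.
apply: (h3 i si v v0); apply: Qup Qv _ => k.
by rewrite {1}/bump [leRHS]/bump lerD2r.
Qed.
End Minimal_target.

Section Acceptable.
Variables (R : realType) (N K : nat) (G : network N K) (gamma : link G -> R).
Hypothesis pr_ge0 : forall c, 0 <= chan_pr gamma c.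
Hypothesis pr_sum1 : \sum_c chan_pr gamma c = 1.
Variables (J : finType) (jk : J -> 'I_K) (ji : J -> 'I_N) (gj : J -> nat -> R).
Variable a0 : action G.
Hypothesis a0F : a0 \in feasible G.
Local Notation acceptable := (acceptable gamma jk ji gj a0).

(** One slot from all-zero ages costs [gj j 0]. As weights must be positive, [j] is isolated by
    weight 1 against a tiny weight [e] elsewhere. *)
Lemma acceptable_ge al : acceptable al -> forall j, gj j 0%N <= al j.
Proof.
move=> AAal j; rewrite leNgt; apply/negP => lt.
pose d := gj j 0%N - al j; have d0 : 0 < d by rewrite subr_gt0.
pose S := \sum_i `|al i - gj i 0%N|; have S0 : 0 <= S by apply: sumr_ge0.
pose e := d / 2 / (S + 1).
have e0 : 0 < e by rewrite /e !divr_gt0//; lra.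
have yP i : 0 < (if i == j then 1 else e) by case: ifP.
have := AAal _ yP 1%N.
rewrite mul1r /= (_ : amin _ _ _ = 0); last first.
  have [a _ ->] := amin_ex a0F (fun a => Echan (chan_pr gamma) (fun c => 0)).
  by rewrite (Echan_cst pr_sum1).
have split f : \sum_i (if i == j then 1 else e) * f i = f j + \sum_(i | i != j) e * f i.
  rewrite (bigD1 j)//= eqxx mul1r; congr (_ + _).
  by apply: eq_bigr => i /negbTE ->.
rewrite addr0 (split (fun i => gj i 0%N)) split.
move=> h.
have : \sum_(i | i != j) e * al i - \sum_(i | i != j) e * gj i 0%N <= e * S.
  rewrite -sumrB mulr_sumr [leRHS](bigID (fun i => i != j))/=.
  apply: (@le_trans _ _ (\sum_(i | i != j) e * `|al i - gj i 0%N|)).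
    apply: ler_sum => i _; rewrite -mulrBr ler_wpM2l ?ler_norm//; exact: ltW.
  by rewrite lerDl; apply: sumr_ge0 => i _; rewrite mulr_ge0 // ltW.
have : e * S <= d / 2.
  apply: (@le_trans _ _ (e * (S + 1))); first by rewrite ler_wpM2l ?(ltW e0)// lerDl.
  rewrite /e divfK//; apply: lt0r_neq0; lra.
rewrite /d in d0 *; lra.
Qed.

Lemma acceptable_up al be : acceptable al -> (forall j, al j <= be j) -> acceptable be.
Proof.
move=> AAal h y y0 H; apply: le_trans (AAal y y0 H) _; apply: ler_wpM2l => //.
by apply: ler_sum => j _; rewrite ler_wpM2l// ltW.
Qed.

Lemma acceptable_closed al j : (forall v : R, 0 < v -> acceptable (bump al j v)) -> acceptable al.
Proof.
move=> h y y0 H; apply/ler_addgt0Pr => v v0.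
have p0 : 0 < H%:R * y j + 1 by apply: ltr_wpDl => //; rewrite mulr_ge0// ltW.
apply: le_trans (h (v / (H%:R * y j + 1)) (divr_gt0 v0 p0) y y0 H) _.
rewrite /bump (eq_bigr (fun i => y i * al i + (if i == j then y j * (v / (H%:R * y j + 1)) else 0))).
  rewrite big_split/= -big_mkcond big_pred1_eq mulrDr lerD2l mulrA mulrA.
  rewrite ler_pdivrMr// [leRHS]mulrC ler_wpM2r// ?(ltW v0)//.
  by rewrite lerDl.
by move=> i _; case: eqP => [->|_]; rewrite mulrDr ?mulr0.
Qed.

Lemma acceptable_minimal al : acceptable al -> exists be, [/\ forall j, be j <= al j, acceptable be &
  forall j (v : R), 0 < v -> ~ acceptable (bump be j (- v))].
Proof.
move: al; apply: (@minimal_below _ _ _ (fun j => gj j 0%N)).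
- by move=> al; exact: acceptable_ge.
- by move=> al be; exact: acceptable_up.
- by move=> al j; exact: acceptable_closed.
Qed.
End Acceptable.

(** * Running the schedule of cycles *)

Section Schedule_run.
Variables (R : realType) (N K : nat) (G : network N K) (pr : chan_state G -> R).
Hypothesis pr_ge0 : forall c, 0 <= pr c.
Hypothesis pr_sum1 : \sum_c pr c = 1.
Local Notation Ehist := (Ehist pr).
Variables (J : finType) (jk : J -> 'I_K) (ji : J -> 'I_N) (gj : J -> nat -> R).
Variables (al : J -> R) (Mc : R).
Hypothesis Mc_ge1 : 1 <= Mc.
Variables (be : nat -> prog R G J) (cs Ls : nat -> nat) (E : nat -> J -> R).
Variables (r : nat -> R) (B : R).
Hypothesis be_valid : forall i, (0 < Ls i)%N /\ valid pr jk ji gj al Mc (cs i) (be i) (Ls i) (E i).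
Hypothesis cs_homo : forall i, (cs i <= cs i.+1)%N.
Hypothesis E_good : forall ep : R, 0 < ep -> exists n, forall i, (n <= i)%N -> forall j,
  E i j <= (Mc + ep) * (Ls i)%:R.
Hypothesis r_good : forall i j T,
  2 * Eend pr (pcost (p:=be i) j) T (trunc_sq i) (pini (be i)) 0 / i.+1%:R ^+ 2
   + E i j ^+ 2 / i.+1%:R ^+ 2 <= r i /\ E i j <= (Mc + 1) * (Ls i)%:R.
Hypothesis r_sum : forall n, \sum_(i < n) r i <= B.
Hypothesis L_slow : forall ep : R, 0 < ep -> exists n, forall i, (n <= i)%N ->
  (Ls i)%:R <= ep * i.+1%:R.

Lemma Ehist_sum T n (f : nat -> seq (chan_state G) -> R) :
  Ehist T (fun h => \sum_(i < n) f i h) = \sum_(i < n) Ehist T (f i).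
Proof.
elim: n => [|n IH].
  by rewrite big_ord0 (eq_Ehist (h := fun=> 0)) ?Ehist_cst// => s _ _; rewrite big_ord0.
rewrite big_ord_recr/= -IH -EhistD; apply: eq_Ehist => s _ _; exact: big_ord_recr.
Qed.

(** Certified earliest start of cycle [i]. Real starts are random and can only be later, while
    budgets are proportional to certified lengths. *)
Let tm i := (\sum_(k < i) Ls k)%N.
Let a i : R := (tm i).+1%:R.
Let w i := (a i ^+ 2)^-1 - (a i.+1 ^+ 2)^-1.

Let tmS i : tm i.+1 = (tm i + Ls i)%N. Proof. by rewrite /tm big_ord_recr. Qed.

Let tm_ge i : (i <= tm i)%N.
Proof.
elim: i => // i IH; rewrite tmS -addn1; apply: leq_add IH _.
by have [] := be_valid i.
Qed.

Let tm_homo i k : (i <= k)%N -> (tm i <= tm k)%N.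
Proof.
elim: k => [|k IH]; first by rewrite leqn0 => /eqP ->.
rewrite leq_eqVlt => /orP[/eqP -> //|/IH h]; apply: leq_trans h _.
by rewrite tmS leq_addr.
Qed.

Let a_ge i : i.+1%:R <= a i. Proof. by rewrite ler_nat ltnS. Qed.
Let a_homo i : a i <= a i.+1. Proof. by rewrite ler_nat ltnS tm_homo. Qed.
Let aS i : a i.+1 = a i + (Ls i)%:R. Proof. by rewrite /a tmS -addSn natrD. Qed.
Let a_gt0 i : 0 < a i. Proof. by []. Qed.
Let w_ge0 i : 0 <= w i.
Proof. by rewrite subr_ge0 lef_pV2 ?posrE ?exprn_gt0// ler_pXn2r ?nnegrE ?(ltW (a_gt0 _)). Qed.

Let cost_ge1 j i (s : pst (be i)) : 1 <= pcost j s.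
Proof. by have [_ [_ h _ _ _]] := be_valid i. Qed.

Let Ecost_le j i n : Ecost pr (pcost (p:=be i) j) n (pini (be i)) <= E i j.
Proof. by have [_ [_ _ _ _ h]] := be_valid i. Qed.

Let E_ge0 i j : 0 <= E i j. Proof. exact: (Ecost_le j i 0). Qed.

(** The sum includes the budget of the possibly unfinished cycle [n], whose certified length lies
    beyond [a n]; [L_slow] makes it negligible. *)
Let E_sum (j : J) (e : R) : 0 < e -> exists n0, forall n, (n0 <= n)%N ->
  \sum_(k < n.+1) E k j <= (Mc + e) * a n.
Proof.
move=> e0; have e40 : 0 < e / 4 by rewrite divr_gt0.
have Mc0 : 0 <= Mc by apply: le_trans Mc_ge1.
have [n1 n1P] := E_good e40.
pose q := e / 4 / (Mc + e / 4); have q0 : 0 < q by rewrite !divr_gt0// ltr_wpDl.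
have [n2 n2P] := L_slow q0.
pose D := \sum_(k < n1) E k j; have D0 : 0 <= D by apply: sumr_ge0.
have main n : \sum_(k < n) E k j <= D + (Mc + e / 4) * a n.
  elim: n => [|n IH].
    by rewrite big_ord0 addr_ge0// mulr_ge0// ?addr_ge0 ?(ltW e40)// ltW.
  have [nn1|nn1] := ltnP n n1.
    apply: (@le_trans _ _ D); last by rewrite lerDl mulr_ge0// ?addr_ge0 ?(ltW e40)// ltW.
    rewrite /D -(subnKC nn1) big_split_ord/= lerDl; exact: sumr_ge0.
  rewrite big_ord_recr aS mulrDr addrA; apply: lerD IH _; exact: n1P.
have [n3 n3P] := le_linear D e40.
exists (maxn n2 n3) => n; rewrite geq_max => /andP[h2 h3].
apply: le_trans (main _) _; rewrite aS mulrDr.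
have hD : D <= e / 4 * a n.
  by apply: le_trans (n3P n h3) _; rewrite ler_wpM2l ?(ltW e40)// ler_nat ltnW// ltnS tm_ge.
have hL : (Mc + e / 4) * (Ls n)%:R <= e / 4 * a n.
  have Me : 0 < Mc + e / 4 by rewrite ltr_wpDl.
  rewrite mulrC -ler_pdivlMr//; apply: le_trans (n2P n h2) _.
  by rewrite [leRHS]mulrAC ler_wpM2l// ltW.
have : 0 < e * a n by rewrite mulr_gt0.
have -> : (Mc + e) * a n = Mc * a n + e / 4 * a n + e / 4 * a n + e / 4 * a n + e / 4 * a n by field.
rewrite mulrDl; have : 0 < e / 4 * a n by rewrite mulr_gt0.
lra.
Qed.

(** The existential certificates of [valid] are carried along, together with the fact that elapsed
    time plus certified rest reaches the start of the next cycle. *)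
Definition on_track (q : cfg be) (x : ages N K) (t : nat) :=
  exists (rem : pst (be (projT1 q)) -> nat) (Inv : pst (be (projT1 q)) -> ages N K -> Prop),
  [/\ forall s c, pr c != 0 ->
        if pnxt s c is Some s' then (rem s <= (rem s').+1)%N else (rem s <= 1)%N,
      (forall s x, Inv s x -> forall j, gj j (x (jk j) (ji j)) - al j + Mc <= pcost j s) /\
      (forall s x c, Inv s x -> pr c != 0 ->
         if pnxt s c is Some s' then Inv s' (next_ages (pact s) c x)
         else small jk ji gj (cs (projT1 q)) (next_ages (pact s) c x)),
      Inv (projT2 q) x,
      (tm (projT1 q).+1 <= t + rem (projT2 q))%N &
      (tm (projT1 q) <= t)%N].

Lemma on_track_start i x t : small jk ji gj (cs i) x -> (tm i <= t)%N ->
  on_track (existT _ i (pini (be i))) x t.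
Proof.
move=> sx ti; have [_ [_ _ [rem [remi remS]] [Inv [I1 I2 I3]] _]] := be_valid i.
exists rem, Inv; split => //=; first exact: I1.
by rewrite tmS remi leq_add2r.
Qed.

Lemma on_track_step q x t c : pr c != 0 -> on_track q x t ->
  on_track (cstep q c) (next_ages (pact (projT2 q)) c x) t.+1.
Proof.
case: q => i s pc [rem [Inv [/= remS [I2 I3] Is t1 t2]]].
have := I3 _ _ _ Is pc; have := remS s c pc; rewrite /cstep /=.
case: (pnxt s c) => [s'|] /= h h'.
  exists rem, Inv; split => //=; last exact: leqW.
  by apply: leq_trans t1 _; rewrite addSnnS leq_add2l.
apply: on_track_start.
  move=> j uj; apply: leq_trans (h' j uj) _; exact: cs_homo.
by apply: leq_trans t1 _; rewrite -addn1 leq_add2l.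
Qed.

Variable x0 : ages N K.
Hypothesis x0_small : small jk ji gj (cs 0) x0.

Lemma on_track_run h : (forall c, c \in h -> pr c != 0) ->
  on_track (crun be h) (traj (@next_ages N K G) (seq_policy be) x0 h) (size h).
Proof.
rewrite /crun; elim/last_ind: h => [|h c IH] hp.
  by apply: on_track_start => //; rewrite /tm big_ord0.
rewrite foldl_rcons traj_rcons size_rcons; apply: on_track_step.
  by apply: hp; rewrite mem_rcons mem_head.
by apply: IH => c' ch; apply: hp; rewrite mem_rcons inE ch orbT.
Qed.

Lemma cost_le_ccost h j : (forall c, c \in h -> pr c != 0) ->
  gj j (traj (@next_ages N K G) (seq_policy be) x0 h (jk j) (ji j)) - al j + Mc <=
  ccost j (crun be h).
Proof. by move=> /on_track_run[rem [Inv [_ [I2 _] Is _ _]]]; exact: I2. Qed.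

Lemma idx_time h : (forall c, c \in h -> pr c != 0) ->
  (tm (projT1 (crun be h)) <= size h)%N.
Proof. by move=> /on_track_run[rem [Inv [_ _ _ _]]]. Qed.

Lemma seq_policy_feasible h : seq_policy be h \in feasible G.
Proof.
have [_ [pactF _ _ _ _]] := be_valid (projT1 (crun be h)); exact: pactF.
Qed.

Section One_destination.
Variable j : J.
Local Notation run := (xrun be j).

Definition total (x : xcfg be) : R := \sum_(u <- us x) u + cur x.

Lemma total_rcons h c : total (run (rcons h c)) = total (run h) + ccost j (crun be h).
Proof.
rewrite /xrun foldl_rcons -/(run h) /xstep -(xq_run be j h) /total.
case: (pnxt _ _) => [s|] /=; first by rewrite addrA.
by rewrite big_rcons/= addr0 addrA.
Qed.

Let ok h : xok (run h). Proof. by apply: xok_run => i s; exact: cost_ge1. Qed.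

Lemma total_cycles h : total (run h) =
  \sum_(n < (projT1 (crun be h)).+1) cyc_cost n (run h).
Proof.
have [sz _] := ok h; rewrite -(xq_run be j h) -/(xidx (run h)) -sz big_ord_recr/=.
rewrite /total (big_nth 0) big_mkord; congr (_ + _).
  by apply: eq_bigr => i _; rewrite /cyc_cost ltn_ord.
by rewrite /cyc_cost ltnn sz eqxx.
Qed.

Let nn h : all (fun u => 0 <= u) (us (run h)).
Proof.
elim/last_ind: h => [|h c IH] //; have [sz c0] := ok h.
rewrite /xrun foldl_rcons -/(run h) /xstep.
case: (pnxt _ _) => [s|] //=; rewrite all_rcons IH andbT addr_ge0// ccost_ge0//.
Qed.

Lemma cyc_cost_ge0 n h : 0 <= cyc_cost n (run h).
Proof.
have [sz c0] := ok h; rewrite /cyc_cost; case: ifP => [ns|_]; last by case: ifP.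
by apply: (allP (nn h)); apply: mem_nth.
Qed.

Lemma cyc_cost_step n h c : cyc_cost n (run h) <= cyc_cost n (run (rcons h c)).
Proof.
have [sz c0] := ok h; have [sz' c0'] := ok (rcons h c); have g0 := cyc_cost_ge0 n (rcons h c).
have cc0 : 0 <= ccost j (xq (run h)) by apply: ccost_ge0 => i s; exact: cost_ge1.
rewrite {1}/cyc_cost; case: (ltnP n (size (us (run h)))) => ns.
  rewrite /cyc_cost /xrun foldl_rcons -/(run h) /xstep.
  case: (pnxt _ _) => [s|] /=; first by rewrite ns.
  by rewrite size_rcons ltnW// nth_rcons ns.
case: eqP => [nE|_] //.
rewrite /cyc_cost /xrun foldl_rcons -/(run h) /xstep /xidx /cstep.
case: (pnxt _ _) => [s|] /=; first by rewrite ltnNge ns /= nE eqxx lerDl.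
by rewrite size_rcons sz -nE ltnSn nth_rcons sz -nE ltnn eqxx lerDl.
Qed.

Let cyc_cost_done n h c : (n < size (us (run h)))%N ->
  cyc_cost n (run (rcons h c)) = cyc_cost n (run h).
Proof.
move=> ns; rewrite [RHS]/cyc_cost ns /cyc_cost /xrun foldl_rcons -/(run h) /xstep.
case: (pnxt _ _) => [s|] /=; first by rewrite ns.
by rewrite size_rcons ltnW// nth_rcons ns.
Qed.

Section One_path.
Variable ch : nat -> chan_state G.
Hypothesis ch_pos : forall t, pr (ch t) != 0.
Let h T := mkseq ch T.
Let hS T : h T.+1 = rcons (h T) (ch T). Proof. by rewrite /h mkseqS. Qed.
Hypothesis energy_bounded : exists b, forall T, xenergy (E^~ j) a (run (h T)) <= b.
Hypothesis cyc_bounded : forall n, exists b, forall T, cyc_cost n (run (h T)) <= b.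

Let idx T := projT1 (crun be (h T)).
Let h_pos T c : c \in h T -> pr c != 0.
Proof. by move=> /mapP[t _ ->]. Qed.

Let idx_us T : size (us (run (h T))) = idx T.
Proof. by have [-> _] := ok (h T); rewrite /xidx xq_run. Qed.

Let cyc_homo n T T' : (T <= T')%N -> cyc_cost n (run (h T)) <= cyc_cost n (run (h T')).
Proof.
move=> /subnK <-; elim: (T' - T)%N => // p IH; rewrite addSn hS.
exact: le_trans IH (cyc_cost_step _ _ _).
Qed.

Let idx_step T : idx T.+1 = idx T \/ idx T.+1 = (idx T).+1.
Proof.
rewrite /idx hS /crun foldl_rcons -/(crun be (h T)) /cstep.
by case: (pnxt _ _) => [s|] /=; [left|right].
Qed.

Let idx_homo T T' : (T <= T')%N -> (idx T <= idx T')%N.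
Proof.
move=> /subnK <-; elim: (T' - T)%N => // p IH; rewrite addSn.
by apply: leq_trans IH _; case: (idx_step (p + T)) => ->.
Qed.

Let cur_grows T : idx T.+1 = idx T ->
  cur (run (h T)) + 1 <= cur (run (h T.+1)).
Proof.
rewrite /idx hS -!(xq_run be j) /xrun foldl_rcons -/(run (h T)) /xstep /cstep.
case: (pnxt _ _) => [s|] /=; first by move=> _; rewrite lerD2l ccost_ge1.
by move=> /esym /n_Sn.
Qed.

(** Every slot costs at least 1, so a cycle that never ended would contradict [cyc_bounded]. *)
Let idx_unbounded n : exists T, (n <= idx T)%N.
Proof.
elim: n => [|n [T0 T0P]]; first by exists 0%N.
apply: contrapT => /forallNP nT.
have idxE p : idx (T0 + p)%N = n.
  apply/eqP; rewrite eqn_leq; have := nT (T0 + p)%N => /negP; rewrite -ltnNge ltnS => -> /=.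
  by apply: leq_trans T0P _; apply: idx_homo; rewrite leq_addr.
have curP p : p%:R <= cur (run (h (T0 + p)%N)).
  elim: p => [|p IH]; first by have [_] := ok (h (T0 + 0)%N).
  rewrite -natr1 addnS; apply: (le_trans _ (cur_grows _)); first by rewrite lerD2r.
  by rewrite -addnS !idxE.
have [b bP] := cyc_bounded n.
have [p pP] := le_linear (b + 1) (@ltr01 R).
have : p%:R <= b.
  apply: le_trans (curP p) _; apply: le_trans (bP (T0 + p)%N).
  by rewrite /cyc_cost idx_us idxE ltnn /xidx xq_run -/(idx _) idxE eqxx.
by have := pP p (leqnn p); lra.
Qed.

Lemma path_total (e : R) : 0 < e -> exists T0, forall T, (T0 <= T)%N ->
  total (run (h T)) <= (Mc + e) * T%:R.
Proof.
move=> e0.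
have /choice[tau tauP] n : exists T, (n < idx T)%N by exact: (idx_unbounded n.+1).
pose u n := cyc_cost n (run (h (tau n))).
have cyc_done n T T' : (T <= T')%N -> (n < idx T)%N ->
    cyc_cost n (run (h T')) = cyc_cost n (run (h T)).
  move=> /subnK <- nT; elim: (T' - T)%N => // p IH.
  by rewrite addSn hS cyc_cost_done// idx_us; apply: leq_trans nT (idx_homo (leq_addl _ _)).
have cyc_u n T : cyc_cost n (run (h T)) <= u n.
  have [le|/ltnW ge] := leqP T (tau n); first exact: cyc_homo.
  by rewrite (cyc_done _ _ _ ge).
have u_done n T : (n < idx T)%N -> u n = cyc_cost n (run (h T)).
  move=> nT; have [le|/ltnW ge] := leqP T (tau n); rewrite /u.
    exact: cyc_done le nT.
  by rewrite (cyc_done _ _ _ ge).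
have u0 n : 0 <= u n by apply: cyc_cost_ge0.
have C0 : 0 < Mc + 1 by apply: ltr_wpDl => //; apply: le_trans Mc_ge1.
have mC i : E i j <= (Mc + 1) * (a i.+1 - a i).
  by rewrite aS [a i + _]addrC addrK; have [] := r_good i j 0.
have a2 : exists n0, forall n, (n0 <= n)%N -> a n.+1 <= 2 * a n.
  have [n0 n0P] := L_slow ltr01; exists n0 => n nn0; rewrite aS mulr2n mulrDl !mul1r lerD2l.
  by apply: le_trans (n0P n nn0) _; rewrite mul1r.
have eB : exists b, forall n, energy w (E^~ j) u n <= b.
  have [b bP] := energy_bounded; exists b => n; apply: le_trans (bP (tau n)).
  have nt : (n <= idx (tau n))%N by apply: ltnW; exact: tauP.
  rewrite /xenergy idx_us -/w.
  apply: (@le_trans _ _ (energy w (E^~ j) (nth 0 (us (run (h (tau n))))) n)).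
    rewrite (@eq_energy R w (E^~ j) u (nth 0 (us (run (h (tau n))))) n)// => k kn.
    have ki : (k < idx (tau n))%N by apply: leq_trans nt.
    transitivity (cyc_cost k (run (h (tau n)))); last by rewrite /cyc_cost idx_us ki.
    by apply: u_done.
  rewrite /energy -(subnKC nt) big_split_ord/= lerDl; apply: sumr_ge0 => k _.
  by rewrite addr_ge0// mulr_ge0// sqr_ge0.
have [b bP] := eB.
have e20 : 0 < e / 2 by rewrite divr_gt0.
have [n0 n0P] := path_bound a_ge a_homo C0 mC bP u0 (Mc := Mc) (e := e / 2) (E_sum j) a2 e20.
have [T1 T1P] := idx_unbounded n0.
have [T2 T2P] := le_linear_succ Mc e0.
exists (maxn T1 T2) => T; rewrite geq_max => /andP[h1 h2].
have nT : (n0 <= idx T)%N by apply: leq_trans T1P _; exact: idx_homo.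
rewrite total_cycles -/(idx T).
apply: (@le_trans _ _ ((Mc + e / 2) * a (idx T))).
  by apply: le_trans (n0P _ nT); apply: ler_sum => n _; exact: cyc_u.
have Me0 : 0 <= Mc + e / 2 by rewrite addr_ge0// ?(ltW e20)//; apply: le_trans Mc_ge1.
apply: le_trans (T2P T h2); rewrite ler_wpM2l// ler_nat ltnS.
by apply: leq_trans (idx_time (h_pos (T := T))) _; rewrite size_mkseq.
Qed.
End One_path.

Lemma cycle_mean n T : Ehist T (fun h => cyc_cost n (run h)) <= E n j.
Proof. exact: (cyc_cost_mean pr_ge0 pr_sum1 (@cost_ge1 j) (Eb := E^~ j) (Ecost_le j)). Qed.

(** By time [T] no cycle after the last [n] with [tm n <= T] has begun, and each cycle up to [n] has
    mean cost at most its budget. *)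
Lemma mean_total (e : R) : 0 < e -> exists T0, forall T, (T0 <= T)%N ->
  Ehist T (fun h => total (run h)) <= (Mc + e) * T%:R.
Proof.
move=> e0; have e20 : 0 < e / 2 by rewrite divr_gt0.
have [n1 n1P] := E_sum j e20.
have Me0 : 0 <= Mc + e / 2 by rewrite addr_ge0// ?(ltW e20)//; apply: le_trans Mc_ge1.
have [T2 T2P] := le_linear_succ Mc e0.
exists (maxn (tm n1) T2) => T; rewrite geq_max => /andP[h1 h2].
have [n nT nmax] : exists2 n, (n1 <= n)%N /\ (tm n <= T)%N & forall k, (tm k <= T)%N -> (k <= n)%N.
  have ex : exists n, (tm n <= T)%N by exists 0%N; rewrite /tm big_ord0.
  have ub n : (tm n <= T)%N -> (n <= T)%N by apply: leq_trans (tm_ge n).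
  have := ex_maxnP ex ub; case=> n nT nmax; exists n => //; split=> //; exact: nmax.
apply: (@le_trans _ _ (Ehist T (fun h => \sum_(i < n.+1) cyc_cost i (run h)))).
  apply: Ehist_le => // h hT hp; rewrite total_cycles.
  have idn : (projT1 (crun be h) <= n)%N by apply: nmax; rewrite -hT; apply: idx_time.
  rewrite -(subnKC idn) -addSn big_split_ord/= lerDl; apply: sumr_ge0 => i _; exact: cyc_cost_ge0.
apply: (@le_trans _ _ (\sum_(i < n.+1) E i j)).
  rewrite (Ehist_sum T n.+1 (fun i h => cyc_cost i (run h))); apply: ler_sum => i _.
  exact: cycle_mean.
apply: le_trans (n1P n nT.1) _.
by apply: le_trans (T2P T h2); rewrite ler_wpM2l// ler_nat ltnS; case: nT.
Qed.

Lemma run_energy_mean T : Ehist T (fun h => xenergy (E^~ j) a (run h)) <= B.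
Proof.
apply: (energy_mean pr_ge0 pr_sum1 (@cost_ge1 j) (Eb := E^~ j) (Ecost_le j) a_ge a_homo _ r_sum).
by move=> i n; have [] := r_good i j n.
Qed.

Lemma run_energy_ge0 h : 0 <= xenergy (E^~ j) a (run h).
Proof.
apply: sumr_ge0 => k _; apply: addr_ge0 => //; apply: mulr_ge0; [exact: w_ge0|exact: sqr_ge0].
Qed.

Lemma run_energy_step h c :
  xenergy (E^~ j) a (run h) <= xenergy (E^~ j) a (run (rcons h c)).
Proof.
rewrite {2}/xrun foldl_rcons -/(run h) /xstep.
case: (pnxt _ _) => [s|] //=.
rewrite /xenergy /= size_rcons -/w {2}/energy big_ord_recr/=.
rewrite -/(energy w (E^~ j) (nth 0 (rcons (us (run h)) (cur (run h) + ccost j (xq (run h))))) (size (us (run h)))).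
rewrite (@eq_energy R w (E^~ j) (nth 0 (rcons _ _)) (nth 0 (us (run h)))).
  by rewrite lerDl; apply: addr_ge0 => //; apply: mulr_ge0; [exact: w_ge0|exact: sqr_ge0].
by move=> k ks; rewrite nth_rcons ks.
Qed.

Lemma total_ge0 h : 0 <= total (run h).
Proof. by rewrite total_cycles; apply: sumr_ge0 => n _; exact: cyc_cost_ge0. Qed.
End One_destination.
End Schedule_run.

(** * The policy for an acceptable target *)

Section Schedule_policy.
Context d (Omega : measurableType d) (R : realType) (P : probability Omega R).
Variables (N K : nat) (G : network N K) (gamma : link G -> R).
Variable S : nat -> link G -> {RV P >-> bool}.
Hypothesis S_channel : channel_process gamma S.
Variable A0 : ages N K.
Local Notation pr := (chan_pr gamma).
Local Notation nx := (@next_ages N K G).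
Local Notation ch := (fun s w => chan_at S s w).
Variables (J : finType) (jk : J -> 'I_K) (ji : J -> 'I_N) (gj : J -> nat -> R).
Hypothesis gj_homo : forall j m n, (m <= n)%N -> gj j m <= gj j n.
Variable a0 : action G.
Hypothesis a0F : a0 \in feasible G.
Local Notation cost j x := (gj j (x (jk j) (ji j))).

Definition oblivious_policy (act0 : seq (chan_state G) -> action G)
    (actF : forall h, act0 h \in feasible G) : policy G R.
Proof.
apply: (@Policy N K G R _ unit (\d_tt)%E (fun h _ => act0 h)) => [h _|h a]; first exact: actF.
by [].
Defined.

(** [Y] is the cost in the bookkeeping of the programs. Its mean is controlled separately, as the
    pathwise bound does not imply the mean bound on which the debts rely. *)
Lemma schedule_policy (al : J -> R) : acceptable gamma jk ji gj a0 al ->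
  exists (pi : policy G R) (Mc : R) (Y : J -> nat -> Omega * seed pi -> R),
  [/\ 0 <= Mc /\ forall j, 0 <= gj j 0%N - al j + Mc,
      forall j T, measurable_fun setT (Y j T), forall j T x, 0 <= Y j T x,
      {ae (P \x seed_law pi)%E, forall x, (forall j T,
          \sum_(t < T) (cost j (age S A0 t x) - al j + Mc) <= Y j T x) /\
        forall j (e : R), 0 < e -> exists T0, forall T, (T0 <= T)%N ->
          Y j T x <= (Mc + e) * T%:R} &
      forall j (e : R), 0 < e -> exists T0, forall T, (T0 <= T)%N ->
        (\int[P \x seed_law pi]_x (Y j T x)%:E <= ((Mc + e) * T%:R)%:E)%E].
Proof.
move=> AAal.
have pr0 := chan_pr_ge0 S_channel; have pr1 := chan_pr_sum1 gamma.
pose Mc : R := 1 + \sum_j `|gj j 0%N - al j|.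
have Mc1 : 1 <= Mc by rewrite lerDl; apply: sumr_ge0.
have gal j : 1 <= gj j 0%N - al j + Mc.
  have : `|gj j 0%N - al j| <= \sum_j `|gj j 0%N - al j|.
    by rewrite (bigD1 j)//= lerDl; apply: sumr_ge0.
  have := ler_norm (- (gj j 0%N - al j)); rewrite normrN /Mc; lra.
pose x0 := init_ages G A0.
pose c := \max_j x0 (jk j) (ji j).
have sc := scalar_program pr0 pr1 gj_homo Mc1 gal (chan_pr_sure_links S_channel)
  (@sure_links_sub _ _ _ _ gamma) a0F AAal.
have ve := vector_program pr0 pr1 Mc1 sc.
have [be [cs [Ls [E [r [B [V [ccs0 csS] Eg rg [rs Lslow]]]]]]]] := program_schedule pr0 pr1 ve c.
have x0s : small jk ji gj (cs 0%N) x0.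
  move=> j _; apply: leq_trans ccs0; exact: (leq_bigmax (F := fun j => x0 (jk j) (ji j))).
have polF := seq_policy_feasible V.
pose pi := oblivious_policy polF.
pose ch' s (x : Omega * seed pi) := chan_at S s x.1.
have cylm h : measurable (cyl ch' h) by exact: seed_cyl_measurable.
have cyll h : (P \x seed_law pi)%E (cyl ch' h) = (\prod_(c <- h) pr c)%:E by exact: seed_cyl_law.
have hS T x : hist ch' T.+1 x = rcons (hist ch' T x) (ch' T x) by exact: histS.
have bounded (F : seq (chan_state G) -> R) b : (forall h, 0 <= F h) ->
    (forall h c, F h <= F (rcons h c)) -> (forall T, Ehist pr T F <= b) ->
    {ae (P \x seed_law pi)%E, forall x, exists b, forall T, F (hist ch' T x) <= b}.
  move=> F0 FS FE; apply: (ae_bounded (f := fun T x => F (hist ch' T x)) (B := b)) => //.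
  - by move=> T; exact: measurable_hist_fun.
  - move=> n m x /subnK <-; elim: (m - n)%N => // p IH; rewrite addSn hS.
    exact: le_trans IH (FS _ _).
  - by move=> T; rewrite (integral_hist cylm cyll)// lee_fin.
pose a i : R := (\sum_(k < i) Ls k)%N.+1%:R.
have ae_e j := bounded _ _ (run_energy_ge0 be Ls E j) (run_energy_step be Ls E j)
  (run_energy_mean pr0 pr1 V rg rs j).
have ae_c j n := bounded _ _ (cyc_cost_ge0 V j n) (cyc_cost_step V j n) (cycle_mean pr0 pr1 V j n).
have tot0 j h : 0 <= total (xrun be j h) by exact: (total_ge0 V).
exists pi, Mc, (fun j T x => total (xrun be j (hist ch' T x))); split.
- split; first exact: le_trans Mc1.
  by move=> j; apply: le_trans (gal j).
- by move=> j T; exact: (measurable_hist_fun cylm (fun h => total (xrun be j h))).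
- by [].
- have pos := ae_positive cylm cyll.
  have ae_e' : {ae (P \x seed_law pi)%E, forall x, forall j, exists b, forall T,
      xenergy (E^~ j) a (xrun be j (hist ch' T x)) <= b} by apply: filter_forall.
  have ae_c' : {ae (P \x seed_law pi)%E, forall x, forall j n, exists b, forall T,
      cyc_cost n (xrun be j (hist ch' T x)) <= b}.
    by apply: filter_forall => j; apply: ae_foralln.
  apply: filterS3 pos ae_e' ae_c' => x pos xe xc; split => [j T|j e e0]; last first.
    exact: (path_total Mc1 V csS Eg rg Lslow x0s (ch := fun t => ch' t x) pos (xe j) (xc j) e0).
  elim: T => [|T IH]; first by rewrite big_ord0.
  rewrite big_ord_recr/= hS total_rcons; apply: lerD IH _.
  rewrite age_traj; apply: (cost_le_ccost V csS x0s) => c' /mapP[t _ ->]; exact: pos.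
- move=> j e e0; have [T0 T0P] := mean_total pr0 pr1 Mc1 V csS Eg Lslow x0s j e0.
  exists T0 => T /T0P le; rewrite (integral_hist cylm cyll (f := fun h => total (xrun be j h)))//.
Qed.
End Schedule_policy.

(** * Reflected sums, and lower averages at a minimal target *)

Section Reflected_sums.
Variables (R : realType) (Q S : nat -> R).
Hypothesis QS : forall t, Q t.+1 <= Num.max (Q t + S t.+1 - S t) 0.

(** When [Q] is reflected at 0, [Q - S] is at most [- S]; otherwise it does not increase. After any
    given time it is thus bounded by its value then and the largest [- S] since, which is
    sublinear. *)
Lemma reflected_sum_sublinear :
  (forall e : R, 0 < e -> exists T0, forall T, (T0 <= T)%N -> `|S T| <= e * T%:R) ->
  forall e : R, 0 < e -> exists T0, forall T, (T0 <= T)%N -> Q T <= e * T%:R.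
Proof.
move=> Ssmall e e0; have e30 : 0 < e / 3 by rewrite divr_gt0.
have [T0 T0P] := Ssmall _ e30.
pose D := `|Q T0 - S T0|.
have gap p : Q (T0 + p)%N - S (T0 + p)%N <= D + e / 3 * (T0 + p)%N%:R.
  elim: p => [|p IH].
    rewrite addn0; apply: (@le_trans _ _ D); first exact: ler_norm.
    by rewrite lerDl mulr_ge0// ltW.
  have := T0P (T0 + p.+1)%N (leq_addr _ _); rewrite addnS.
  have := QS (T0 + p)%N; have := ler_norm (- S (T0 + p).+1); rewrite normrN.
  have : e / 3 * (T0 + p)%N%:R <= e / 3 * (T0 + p).+1%:R.
    by rewrite ler_wpM2l ?(ltW e30)// ler_nat.
  have D0 : 0 <= D by apply: normr_ge0.
  rewrite le_max => h1 h2 /orP[h3|h3] h4; lra.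
have [T1 T1P] := le_linear D e30.
exists (maxn T0 T1) => T; rewrite geq_max => /andP[h1 /T1P h2].
have := gap (T - T0)%N; rewrite subnKC//.
have := T0P T h1; have := ler_norm (S T).
have -> : e * T%:R = e / 3 * T%:R + e / 3 * T%:R + e / 3 * T%:R by field.
lra.
Qed.
End Reflected_sums.

Section Sufficiency.
Context d (Omega : measurableType d) (R : realType) (P : probability Omega R).
Variables (N K : nat) (G : network N K) (gamma : link G -> R).
Variable S : nat -> link G -> {RV P >-> bool}.
Hypothesis S_channel : channel_process gamma S.
Variable A0 : ages N K.
Local Notation pr := (chan_pr gamma).
Variables (J : finType) (jk : J -> 'I_K) (ji : J -> 'I_N) (gj : J -> nat -> R).
Hypothesis gj_homo : forall j m n, (m <= n)%N -> gj j m <= gj j n.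
Variable a0 : action G.
Hypothesis a0F : a0 \in feasible G.
Local Notation cost j x := (gj j (x (jk j) (ji j))).
Local Notation acceptable := (acceptable gamma jk ji gj a0).

Section Lower_average.
Variables (pi : policy G R) (al : J -> R).
Local Notation mu := (P \x seed_law pi)%E.
Local Notation exc al := (excess_sum S A0 jk ji gj (pi := pi) al).
Hypothesis al_min : forall j (v : R), 0 < v -> ~ acceptable (bump al j (- v)).

Lemma exc_bump j v i T x :
  exc (bump al j (- v)) i T x = exc al i T x + (if i == j then v * T%:R else 0).
Proof.
rewrite /excess_sum /bump; case: eqP => [->|_]; last first.
  by rewrite !addr0.
under eq_bigr do rewrite opprD opprK addrA.
by rewrite big_split/= sumr_const_nat subn1 /= mulr_natr.
Qed.

(* Lowering the target of [j] makes it unacceptable, so the costs exceed the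
   lowered target; the other coordinates cannot compensate. *)
Lemma minimal_lower_average :
  {ae mu, forall x, forall j (e : R), 0 < e -> exists T0, forall T, (T0 <= T)%N ->
    exc al j T x <= e * T%:R} ->
  {ae mu, forall x, forall j (e : R), 0 < e -> exists T0, forall T, (T0 <= T)%N ->
    - (e * T%:R) <= exc al j T x}.
Proof.
move=> up.
have lo j n : {ae mu, forall x, exists T0, forall T, (T0 <= T)%N ->
    - (2 / n.+1%:R * T%:R) <= exc al j T x}.
  pose v : R := n.+1%:R^-1; have v0 : 0 < v by rewrite invr_gt0.
  have [y [e [H [y0 e0 V0]]]] := not_acceptable_excess S_channel a0F (al_min (j := j) v0).
  have lt := lower_tail_ae S_channel A0 pi a0F (excess_mono jk ji gj_homo (bump al j (- v)) e y0) V0.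
  apply: filterS2 up lt => x up [T0 T0P].
  pose c := excess jk ji gj (bump al j (- v)) y e (init_ages G A0).
  pose Y := \sum_i y i; have Y0 : 0 <= Y by apply: sumr_ge0 => i _; apply: ltW.
  pose de := y j * v / 2 / (Y + 1).
  have Y1 : 0 < Y + 1 by apply: ltr_wpDl.
  have yv0 : 0 < y j * v by rewrite mulr_gt0.
  have de0 : 0 < de by rewrite /de !divr_gt0.
  have [T1 T1P] : exists n, forall i T, (n <= T)%N -> exc al i T x <= de * T%:R.
    apply: (@finite_uniform _ (fun i n => forall T, (n <= T)%N -> exc al i T x <= de * T%:R)).
      by move=> i k l kl h T nT; apply: h; apply: leq_trans nT.
    by move=> i; apply: up.
  have yv20 : 0 < y j * v / 2 by rewrite divr_gt0.
  have [T2 T2P] := le_linear c yv20.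
  exists (maxn T0 (maxn T1 T2)) => T; rewrite !geq_max => /and3P[h0 h1 /T2P s2].
  have := T0P T.+1 (leqW h0); rewrite (sum_excess S A0 jk ji gj (bump al j (- v))) -/c.
  rewrite (eq_bigr (fun i => y i * exc al i T x + (if i == j then y j * (v * T%:R) else 0))); last first.
    by move=> i _; rewrite exc_bump; case: eqP => [->|_]; rewrite mulrDr ?mulr0.
  rewrite big_split/= -big_mkcond big_pred1_eq (bigD1 j)//=.
  have s1 : \sum_(i | i != j) y i * exc al i T x <= y j * v / 2 * T%:R.
    apply: (@le_trans _ _ (\sum_(i | i != j) y i * (de * T%:R))).
      by apply: ler_sum => i _; apply: ler_wpM2l; [exact: ltW|exact: T1P].
    rewrite -mulr_suml; apply: (@le_trans _ _ ((Y + 1) * (de * T%:R))).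
      apply: ler_wpM2r; first by rewrite mulr_ge0// ltW.
      have -> : Y = y j + \sum_(i | i != j) y i by rewrite /Y (bigD1 j).
      have := y0 j; lra.
    by rewrite mulrA /de [(Y + 1) * _]mulrC divfK// gt_eqF.
  have s3 : 0 <= e * T%:R by rewrite mulr_ge0// ltW.
  move=> s4.
  have : 0 < y j * exc al j T x + 2 * (y j * v * T%:R) by lra.
  have -> : y j * exc al j T x + 2 * (y j * v * T%:R) = y j * (exc al j T x + 2 * v * T%:R) by ring.
  by rewrite pmulr_rgt0// => /ltW; rewrite -lerBlDr sub0r.
have lo' : {ae mu, forall x, forall j n, exists T0, forall T, (T0 <= T)%N ->
    - (2 / n.+1%:R * T%:R) <= exc al j T x}.
  by apply: filter_forall => j; apply: ae_foralln.
apply: filterS lo' => x lo' j e e0.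
have [n nP] := le_linear 2 e0; have [T0 T0P] := lo' j n.
exists T0 => T /T0P; apply: le_trans; rewrite lerN2 ler_wpM2r// ler_pdivrMr//.
exact: nP (leqnSn n).
Qed.
End Lower_average.
End Sufficiency.

(** * Equivalence of both properties with acceptability *)

Section Characterization.
Context d (Omega : measurableType d) (R : realType) (P : probability Omega R).
Variables (N K : nat) (G : network N K) (gamma : link G -> R).
Variable S : nat -> link G -> {RV P >-> bool}.
Hypothesis S_channel : channel_process gamma S.
Variables (A0 : ages N K) (g : 'I_K -> 'I_N -> nat -> R).
Hypothesis g_increasing : forall k j, j \in dest G k ->
  {homo g k j : m n / (m <= n)%N >-> m <= n}.
Variable alpha : 'I_K -> 'I_N -> R.

(* All pairs are kept as indices; those that are not source-destination pairs
   get zero cost and zero target. *)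
Let J := ('I_K * 'I_N)%type.
Let gj (p : J) n := if p.2 \in dest G p.1 then g p.1 p.2 n else 0.
Let tgt (p : J) := if p.2 \in dest G p.1 then alpha p.1 p.2 else 0.
Local Notation excess_cost pi al := (excess_sum S A0 fst snd gj (pi := pi) al).
Local Notation acceptable := (@acceptable R N K G gamma J fst snd gj).

Let gj_homo p m n : (m <= n)%N -> gj p m <= gj p n.
Proof. by rewrite /gj; case: ifP => // pd; apply: g_increasing. Qed.

Local Notation Q p := (age_debt S A0 g alpha p.1 p.2).

Section Policy.
Variable pi : policy G R.
Implicit Types (x : Omega * seed pi) (al : J -> R).
Local Notation exc al := (excess_cost pi al).

Lemma excS al p T x : exc al p T.+1 x =
  exc al p T x + (gj p (age S A0 T.+1 x p.1 p.2) - al p).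
Proof. by rewrite /excess_sum big_nat_recr. Qed.

Lemma exc0 al p x : exc al p 0 x = 0.
Proof. by rewrite /excess_sum big_geq. Qed.

Lemma exc_not_dest p T x : p.2 \notin dest G p.1 -> exc tgt p T x = 0.
Proof.
by move=> pd; rewrite /excess_sum /gj /tgt (negbTE pd) big1// => t _; rewrite subrr.
Qed.

Lemma age_debt_ge0 p T x : 0 <= Q p T x.
Proof. by case: T => [|T] //=; rewrite le_max lexx orbT. Qed.

Lemma exc_le_age_debt p T x : p.2 \in dest G p.1 -> exc tgt p T x <= Q p T x.
Proof.
move=> pd; elim: T => [|T IH]; first by rewrite exc0.
rewrite excS /= le_max; apply/orP; left; rewrite addrA [in X in X + _]addrC.
by rewrite /gj /tgt pd /effective_age; move: IH => /=; lra.
Qed.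

Lemma average_cost_exc al p T x : p.2 \in dest G p.1 -> (0 < T)%N ->
  average_cost S A0 g p.1 p.2 x T = al p + exc al p T x / T%:R.
Proof.
move=> pd T0; have T0' : T%:R != 0 :> R by rewrite pnatr_eq0 -lt0n.
rewrite /excess_sum sumrB sumr_const_nat subn1 /= /average_cost.
rewrite mulrBl -[al p *+ T]mulr_natr mulfK// addrC subrK; congr (_ / _).
by apply: eq_bigr => t _; rewrite /gj pd.
Qed.

(** A probability law lives on a nonempty space, so the policy has a seed to act with. *)
Lemma feasible_nonempty : exists a0, a0 \in feasible G.
Proof.
have [z _] : exists z : seed pi, True by apply: (ae_nonempty (mu := seed_law pi)); exact: aeW.
by exists (act [::] z); exact: act_feasible.
Qed.

Variable a0 : action G.
Hypothesis a0F : a0 \in feasible G.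

Lemma achieves_acceptable : achieves S A0 g alpha pi -> acceptable a0 tgt.
Proof.
move=> ach; apply: (achieved_acceptable S_channel (A0 := A0) (pi := pi) gj_homo a0F).
apply: filterS ach => x ach p de de0.
have [pd|pd] := boolP (p.2 \in dest G p.1); last first.
  by exists 0%N => T _; rewrite exc_not_dest// mulr_ge0// ltW.
have [l cvl lea] := ach _ _ pd.
have lde : l < l + de by rewrite ltrDl.
have [T0 _ T0P] := cvgr_le _ cvl _ lde.
exists (maxn T0 1) => T; rewrite geq_max => /andP[/T0P/= h T1].
move: h; rewrite (average_cost_exc tgt)// /tgt pd => h.
by rewrite -ler_pdivrMr ?ltr0n//; lra.
Qed.

Lemma stabilizes_acceptable : stabilizes S A0 g alpha pi -> acceptable a0 tgt.
Proof.
move=> stab.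
pose W T x := \sum_(k < K) \sum_(j in dest G k) age_debt S A0 g alpha k j T x / T%:R.
have Q0 (k : 'I_K) (j : 'I_N) T x : 0 <= age_debt S A0 g alpha k j T x / T%:R.
  by rewrite divr_ge0//; exact: (age_debt_ge0 (k, j)).
apply: (stabilized_acceptable S_channel (A0 := A0) gj_homo a0F (W := W)).
- move=> T; apply: measurable_sum => k.
  under eq_fun do rewrite big_mkcond.
  apply: measurable_sum => j; case: (j \in dest G k); last exact: measurable_cst.
  apply: measurable_funM; last exact: measurable_cst.
  exact: age_debt_measurable.
- by move=> T x; apply: sumr_ge0 => k _; apply: sumr_ge0.
- move=> T x [k j] T0; have [pd|pd] := boolP (j \in dest G k); last first.
    rewrite (exc_not_dest (p := (k, j)) T x pd) mulr_ge0//.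
    by apply: sumr_ge0 => k' _; apply: sumr_ge0.
  apply: le_trans (exc_le_age_debt (p := (k, j)) T x pd) _.
  rewrite -ler_pdivrMr ?ltr0n// /W (bigD1 k)//= (bigD1 j)//= -addrA lerDl.
  by rewrite addr_ge0//; apply: sumr_ge0 => // k' _; apply: sumr_ge0.
- by move: stab; rewrite /stabilizes unlock.
Qed.
End Policy.

(** One policy, built for a minimal target [al] below [tgt], serves both properties: its excesses
    over [al] are sublinear from both sides, which gives convergent averages and, by reflection,
    sublinear debts. *)
Lemma acceptable_policy a0 : a0 \in feasible G -> acceptable a0 tgt ->
  exists pi : policy G R, achieves S A0 g alpha pi /\ stabilizes S A0 g alpha pi.
Proof.
move=> a0F AAt.
have [al [al_le AAal al_min]] := acceptable_minimal (chan_pr_sum1 gamma) a0F AAt.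
have [pi [Mc [Y [[Mc0 gMc] mY Y0 Yae Yint]]]] := schedule_policy S_channel A0 gj_homo a0F AAal.
exists pi.
pose mu := (P \x seed_law pi)%E.
have inc_ge0 p t (x : Omega * seed pi) : 0 <= gj p (age S A0 t x p.1 p.2) - al p + Mc.
  by apply: le_trans (gMc p) _; rewrite !lerD2r gj_homo.
have exc_Y p T (x : Omega * seed pi) : excess_cost pi al p T x + Mc * T%:R <=
    \sum_(t < T.+1) (gj p (age S A0 t x p.1 p.2) - al p + Mc).
  rewrite big_ord_recl /= -[leLHS]add0r; apply: lerD; first exact: (inc_ge0 p 0%N).
  by rewrite /excess_sum big_add1 /= big_mkord [leRHS]big_split/= sumr_const card_ord mulr_natr.
have upper : {ae mu, forall x, forall p (e : R), 0 < e -> exists T0, forall T, (T0 <= T)%N ->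
    excess_cost pi al p T x <= e * T%:R}.
  apply: filterS Yae => x [Yge Yle] p e e0; have e20 : 0 < e / 2 by rewrite divr_gt0.
  have [T0 T0P] := Yle p _ e20.
  have [T1 T1P] := le_linear_succ Mc e0.
  exists (maxn T0 T1) => T; rewrite geq_max => /andP[h1 /T1P].
  have := exc_Y p T x; have := Yge p T.+1; have := T0P _ (leqW h1); rewrite [(Mc + e) * _]mulrDl; lra.
have lower := minimal_lower_average S_channel gj_homo a0F al_min upper.
have small : {ae mu, forall x, forall p (e : R), 0 < e -> exists T0, forall T, (T0 <= T)%N ->
    `|excess_cost pi al p T x| <= e * T%:R}.
  apply: filterS2 upper lower => x up lo p e e0.
  have [T0 T0P] := up p e e0; have [T1 T1P] := lo p e e0.
  exists (maxn T0 T1) => T; rewrite geq_max => /andP[/T0P h1 /T1P h2].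
  by rewrite ler_norml h2.
split.
  apply: filterS small => x small k j jd; exists (al (k, j)); last first.
    by have := al_le (k, j); rewrite /tgt jd.
  apply/cvgrPdist_le => e e0; have [T0 T0P] := small (k, j) e e0.
  exists (maxn T0 1) => // T; rewrite /= geq_max => /andP[/T0P h T1].
  rewrite (average_cost_exc al (p := (k, j)))// opprD addNKr normrN normrM normfV.
  by rewrite [`|T%:R|]ger0_norm// ler_pdivrMr// ltr0n.
have meanQ p : p.2 \in dest G p.1 -> forall e : R, 0 < e -> exists T0, forall T, (T0 <= T)%N ->
    (\int[mu]_x (Q p T x / T%:R)%:E <= e%:E)%E.
  move=> pd.
  have Q_step t (x : Omega * seed pi) : Q p t.+1 x <=
      Num.max (Q p t x + excess_cost pi al p t.+1 x - excess_cost pi al p t x) 0.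
    rewrite excS /= ge_max !le_max lexx orbT andbT; apply/orP; left.
    have := al_le p; rewrite /tgt /gj pd /effective_age /=; lra.
  have Q_le T (x : Omega * seed pi) : Q p T x <=
      \sum_(t < T.+1) (gj p (age S A0 t x p.1 p.2) - al p + Mc).
    elim: T => [|T IH].
      by rewrite /= big_ord1; exact: inc_ge0.
    rewrite big_ord_recr/=; have := inc_ge0 p T.+1 x; rewrite ge_max => i0.
    apply/andP; split; last by apply: addr_ge0 => //; apply: sumr_ge0 => t _; exact: inc_ge0.
    have := al_le p; move: i0 IH; rewrite /tgt /gj pd /effective_age /=; lra.
  (* The debt is at most the accumulated shifted cost, hence at most [Y]; almost surely it is
     sublinear while [Y] grows at a rate of at least nearly [Mc]. The index [T.+1] accounts for slot
     0, which the debt does not count. *)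
  apply: (sandwiched_mean (M := Mc) (Y := fun T x => Y p T.+1 x / T%:R)) => //.
  - move=> T; apply: measurable_funM; last exact: measurable_cst.
    exact: age_debt_measurable.
  - by move=> T; apply: measurable_funM => //; exact: measurable_cst.
  - by move=> T x; rewrite divr_ge0// age_debt_ge0.
  - by move=> T x; rewrite divr_ge0.
  - apply: filterS2 Yae small => x [Yge _] small; split=> [T|e e0].
      by rewrite ler_wpM2r// ?invr_ge0//; apply: le_trans (Q_le T x) (Yge p T.+1).
    have [T0 T0P] := reflected_sum_sublinear (Q_step^~ x) (small p) e0.
    have [T1 T1P] := small p e e0.
    exists (maxn 1 (maxn T0 T1)) => T; rewrite !geq_max => /and3P[h0 /T0P h1 /T1P h2].
    have T0' : 0 < T%:R :> R by rewrite ltr0n.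
    split; first by rewrite ler_pdivrMr.
    rewrite ler_pdivlMr//; apply: le_trans (Yge p T.+1); apply: le_trans (exc_Y p T x).
    have := ler_norm (- excess_cost pi al p T x); rewrite normrN mulrBl; lra.
  - move=> e e0; have e20 : 0 < e / 2 by rewrite divr_gt0.
      have [T0 T0P] := Yint p _ e20.
    have [T1 T1P] := le_linear_succ Mc e0.
    exists (maxn (maxn T0 1) T1) => T; rewrite !geq_max => /andP[/andP[h1 h2] /T1P h3].
    have T0' : 0 < T%:R :> R by rewrite ltr0n.
    under eq_integral do rewrite mulrC EFinM.
    have mYE : measurable_fun setT (fun x => (Y p T.+1 x)%:E) by apply/measurable_EFinP.
    have iT0 : (0 <= (T%:R^-1)%:E :> \bar R)%E by rewrite lee_fin invr_ge0.
    rewrite (ge0_integralZl _ measurableT mYE _ iT0)//; last by move=> x _; rewrite lee_fin.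
    apply: (@le_trans _ _ ((T%:R^-1)%:E * ((Mc + e / 2) * T.+1%:R)%:E)%E).
      by apply: lee_wpmul2l; [rewrite lee_fin invr_ge0|exact: T0P (leqW h1)].
    by rewrite -EFinM lee_fin ler_pdivrMl// [leRHS]mulrC.
rewrite /stabilizes unlock.
pose D := enum [pred p : J | p.2 \in dest G p.1].
pose W T (x : Omega * seed pi) := \sum_(k < K) \sum_(j in dest G k) age_debt S A0 g alpha k j T x / T%:R.
have mQ p T : measurable_fun setT (fun x : Omega * seed pi => (Q p T x / T%:R)%:E).
  apply/measurable_EFinP; apply: measurable_funM; last exact: measurable_cst.
  exact: age_debt_measurable.
have sumE T (x : Omega * seed pi) : (W T x)%:E =
    (\sum_(p <- D) (Q p T x / T%:R)%:E)%E.
  by rewrite sumEFin /D big_enum /W pair_big_dep.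
have Q0 p T (x : Omega * seed pi) : (0 <= (Q p T x / T%:R)%:E)%E.
  by rewrite lee_fin divr_ge0// age_debt_ge0.
have intE T : (\int[mu]_x (W T x)%:E =
    \sum_(p <- D) \int[mu]_x (Q p T x / T%:R)%:E)%E.
  by under eq_integral do rewrite sumE; rewrite ge0_integral_sum.
pose n := #|{: J}|.+1%:R : R.
have n0 : 0 < n by rewrite ltr0n.
have vanish (e : R) : 0 < e -> exists T0, forall T, (T0 <= T)%N ->
    (\int[mu]_x (W T x)%:E <= e%:E)%E.
  move=> e0; have en0 : 0 < e / n by rewrite divr_gt0.
  have [T0 T0P] : exists T0, forall p, forall T, (T0 <= T)%N -> p.2 \in dest G p.1 ->
      (\int[mu]_x (Q p T x / T%:R)%:E <= (e / n)%:E)%E.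
    apply: (@finite_uniform J (fun p T0 => forall T, (T0 <= T)%N -> p.2 \in dest G p.1 ->
      (\int[mu]_x (Q p T x / T%:R)%:E <= (e / n)%:E)%E)).
      by move=> p i k ik h T kT; apply: h; apply: leq_trans kT.
    move=> p; have [pd|pd] := boolP (p.2 \in dest G p.1); last by exists 0%N.
    by have [T0 T0P] := meanQ p pd _ en0; exists T0 => T /T0P.
  exists T0 => T TT; rewrite intE.
  apply: (@le_trans _ _ (\sum_(p <- D) (e / n)%:E)%E).
    rewrite big_seq [leRHS]big_seq; apply: lee_sum => p.
    by rewrite mem_enum => pd; apply: T0P.
  rewrite sumEFin lee_fin /D big_enum sumr_const -mulr_natl mulrA ler_pdivrMr// mulrC.
  by rewrite ler_wpM2l ?(ltW e0)// ler_nat ltnW// ltnS max_card.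
apply/fine_cvgP; split.
  have [T0 T0P] := vanish 1 ltr01; exists T0 => // T /= /T0P h.
  rewrite ge0_fin_numE ?(le_lt_trans h) ?ltry//.
  by apply: integral_ge0 => x _; rewrite sumE; apply: sume_ge0.
apply/cvgrPdist_le => e e0; have [T0 T0P] := vanish e e0.
exists T0 => // T /= /T0P h; rewrite sub0r normrN.
have I0 : (0 <= \int[mu]_x (W T x)%:E)%E.
  by apply: integral_ge0 => x _; rewrite sumE; apply: sume_ge0.
rewrite ger0_norm ?fine_ge0// -lee_fin fineK//.
by rewrite ge0_fin_numE// (le_lt_trans h) ?ltry.
Qed.
End Characterization.

Theorem lemma4 (R : realType) (d : measure_display) (Omega : measurableType d)
    (P : probability Omega R) (N K : nat) (G : network N K)
    (gamma : link G -> R) (S : nat -> link G -> {RV P >-> bool})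
    (S_channel : channel_process gamma S)
    (A0 : ages N K)
    (g : 'I_K -> 'I_N -> nat -> R)
    (g_increasing : forall k j, j \in dest G k ->
      {homo g k j : m n / (m <= n)%N >-> m <= n})
    (alpha : 'I_K -> 'I_N -> R) :
  age_achievable S A0 g alpha <->
  exists pi : policy G R, stabilizes S A0 g alpha pi.
Proof.
split=> -[pi].
  have [a0 a0F] := feasible_nonempty pi => /(achieves_acceptable S_channel g_increasing a0F) AAt.
  by have [pi' [_ stab]] := acceptable_policy S_channel A0 g_increasing a0F AAt; exists pi'.
have [a0 a0F] := feasible_nonempty pi => /(stabilizes_acceptable S_channel g_increasing a0F) AAt.
by have [pi' [ach _]] := acceptable_policy S_channel A0 g_increasing a0F AAt; exists pi'.
Qed.
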